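(* Let $p\ge4$ be a real number and let $K:\mathbf R\to\mathbf R$ be a function of bounded variation such that $\int_{\mathbf R}|K(u)|\,du<\infty$ and $\int_{\mathbf R}|K(u)|^p\,du<\infty$. Let $(Y_i)_{i\in\mathbf Z}$ be a stationary sequence of real-valued random variables whose marginal law has a density $f$ with $\|f\|_\infty<\infty$. Let $(h_n)_{n\ge1}$ be a sequence of positive real numbers and define $$ X_{k,n}(x)=K\bigl(h_n^{-1}(x-Y_k)\bigr),\qquad f_n(x)=\frac{1}{nh_n}\sum_{k=1}^nX_{k,n}(x). $$ (1) Assume that there exists a positive constant $c$ such that for some $\eta>0$ and all $n\ge1$, $$\beta_{2,Y}(n)\le c\,n^{-(p-1+\eta)}.$$ Then there exist positive constants $C_1$ and $C_2$ depending only on $p$, $\eta$ and $c$ such that for every positive integer $n$, $$ \mathbf E\int_{\mathbf R}|f_n(x)-\mathbf E(f_n(x))|^p\,dx\le C_1(nh_n)^{-p/2}\|dK\|^{p/2}\|f\|_\infty^{p/2-1}\Bigl(\int_{\mathbf R}|K(u)|\,du\Bigr)^{p/2} $$ $$ \quad+\,C_2(nh_n)^{1-p}\Bigl(\int_{\mathbf R}|K(u)|^p\,du+\|dK\|\int_{\mathbf R}|K(u)|^{p-1}\,du+\|dK\|^2\int_{\mathbf R}|K(u)|^{p-2}\,du\Bigr), $$ where $\|dK\|$ is the total variation norm of the measure $dK$. (2) Assume in addition that $nh_n\to\infty$. Then $$ \limsup_{n\to\infty}(nh_n)^{p/2}\,\mathbf E\int_{\mathbf R}|f_n(x)-\mathbf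 E(f_n(x))|^p\,dx\le a_{p,c,\eta}\|dK\|^{p/2}\|f\|_\infty^{p/2-1}\Bigl(\int_{\mathbf R}|K(u)|\,du\Bigr)^{p/2}, $$ where $a_{p,c,\eta}$ is a constant depending only on $p$, $c$ and $\eta$.
   Context: Dependence coefficients: for a stationary sequence $(Y_i)_{i\in\mathbf Z}$ of real-valued random variables, let $\mathcal F_0=\sigma(Y_i,i\le0)$. For positive $i,j$ define the random variable $$b(\mathcal F_0,i,j)=\sup_{(s,t)\in\mathbf R^2}\bigl|\mathbf P(Y_i\le t,Y_j\le s\mid\mathcal F_0)-\mathbf P(Y_i\le t,Y_j\le s)\bigr|,$$ and set $\beta_{2,Y}(k)=\sup_{i\ge j\ge k}\mathbf E(b(\mathcal F_0,i,j))$. *)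

(* Defs.v *)
From mathcomp Require Export all_boot all_order all_algebra.
From mathcomp Require Export all_classical all_reals all_analysis.

Set Implicit Arguments.
Unset Strict Implicit.
Unset Printing Implicit Defensive.

Export Order.TTheory GRing.Theory Num.Theory.
Export numFieldNormedType.Exports.

Local Open Scope classical_set_scope.
Local Open Scope ring_scope.

Section process.
Context d (T : measurableType d) (R : realType) (P : probability T R).
Variable Y : int -> {RV P >-> R}.

(* Strict stationarity: equality of the laws on R^n, the type n.-tuple R
   carrying the product sigma-algebra. *)
Definition stationary : Prop :=
  forall (n : nat) (t : n.-tuple int) (m : int) (B : set (n.-tuple R)),
    measurable B ->
    P [set w | B [tuple Y (tnth t l + m) w | l < n]] =
    P [set w | B [tuple Y (tnth t l) w | l < n]].

Definition past_events : set (set T) :=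
  \bigcup_(i in [set i : int | i <= 0]) g_sigma_algebra_preimage (Y i).

(* The sample space equipped with F_0 = sigma(Y_i, i <= 0); a kernel with this
   source is F_0-measurable. *)
Definition pastType := g_sigma_algebraType past_events.

(* Q is a regular version of the conditional law of (Y_i, Y_j) given F_0. *)
Definition is_conditional_law (i j : nat)
    (Q : R.-pker pastType ~> (R * R)%type) : Prop :=
  forall (A : set T) (B : set (R * R)),
    <<s past_events >> A -> measurable B ->
    (\int[P]_(w in A) Q w B =
     P (A `&` [set w | B (Y i%:Z w, Y j%:Z w)]))%E.

Variable Q : nat -> nat -> R.-pker pastType ~> (R * R)%type.

(* The supremum over the uncountable set R^2 is taken on a regular version of
   the conditional law: it is then F_0-measurable (the distribution functions
   are right-continuous) and does not depend, up to a null set, on the version.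
   On unrelated versions of P(Y_i <= t, Y_j <= s | F_0), one for each (s, t),
   it would be neither. *)
Definition b_coef (i j : nat) (w : T) : \bar R :=
  ereal_sup [set `|Q i j w [set z | z.1 <= st.2 /\ z.2 <= st.1]%R
                  - P [set w' | Y i%:Z w' <= st.2 /\ Y j%:Z w' <= st.1]%R|%E
            | st in [set: R * R]].

Definition beta2 (k : nat) : \bar R :=
  ereal_sup [set (\int[P]_w b_coef ij.1 ij.2 w)%E
            | ij in [set ij : nat * nat | (k <= ij.2 <= ij.1)%N]].

Definition is_density (i : int) (f : R -> R) : Prop :=
  [/\ measurable_fun setT f, forall x, 0 <= f x &
      forall B : set R, measurable B ->
        (distribution P (Y i) B = \int[lebesgue_measure]_(x in B) (f x)%:E)%E].

Definition density_estimator (K : R -> R) (h : nat -> R) (n : nat)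
    (x : R) (w : T) : R :=
  (n%:R * h n)^-1 * \sum_(1 <= k < n.+1) K ((h n)^-1 * (x - Y k%:Z w)).

(* E of the p-th power of the L^p norm of f_n - E(f_n) *)
Definition Lp_risk (K : R -> R) (h : nat -> R) (p : R) (n : nat) : \bar R :=
  (\int[P]_w \int[lebesgue_measure]_x
     (`|(density_estimator K h n x w)%:E
        - 'E_P[density_estimator K h n x]| `^ p))%E.

End process.

Section bounded_variation_on_the_line.
Context {R : realType}.

(* The library notion of bounded variation is relative to a segment. *)
Definition bounded_variation_line (K : R -> R) : Prop :=
  exists M : R, forall a b : R, a <= b -> (total_variation a b K <= M%:E)%E.

(* nu is the signed measure dK: as K need not be right-continuous,
   dK(]a, b]) is K(b+) - K(a+). *)
Definition is_stieltjes_charge (K : R -> R)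
    (nu : {charge set (measurableTypeR R) -> \bar R}) : Prop :=
  forall a b : R, a <= b ->
    (nu (`]a, b]%classic : set R) = (lim (K y @[y --> b^'+]) - lim (K y @[y --> a^'+]))%:E)%E.

End bounded_variation_on_the_line.

(* |nu|(T) for the Jordan decomposition of nu; it does not depend on the Hahn
   decomposition used. *)
Definition total_variation_norm d (T : measurableType d) (R : realType)
    (nu : {charge set T -> \bar R}) : \bar R :=
  charge_variation (svalP (cid (svalP (cid (Hahn_decomposition nu))))) setT.

(* Main.v *)
Require Import Defs.
From HB Require Import structures.
From mathcomp Require Import ring lra measurable_realfun ess_sup_inf.

Set Implicit Arguments.
Unset Strict Implicit.
Unset Printing Implicit Defensive.

(** Let V be the norm of dK. Up to a countable set of points, K is the difference G of the
    distribution functions of the two parts of the Jordan decomposition of dK, so the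
    estimator may be computed with G, and the risk is (n h_n)^(-p) times the integral over x
    of E|S_n|^p, where S_n = zeta_1 + ... + zeta_n and zeta_k = G((x - Y_k) / h_n) - E G(...).
    Split S_(n1+n2) into two blocks, shifted by stationarity so that the first one is
    F_0-measurable, and expand |s + y|^p in y to second order: besides the two p-th powers,
    only E(zeta_i | F_0) and E(zeta_i zeta_j | F_0) matter. Writing G as the integral of
    indicators of half-lines, Tonelli's theorem bounds the discrepancy of these conditional
    moments by V b(F_0, i, i) and V^2 b(F_0, i, j). Hoelder's inequality on R x Omega and
    Jensen's inequality then bound the p-th moments of blocks of length 2^(r+1) by twice
    those of blocks of length 2^r plus lower order terms, and solving this recursion gives
    the Rosenthal bound C (n^(p/2) a + n b), where a and b are the quantities of the two
    terms of the theorem. *)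

(** The coefficient b(F_0, i, j) depends on omega but not on x. Integrating in x first therefore
    leaves only its mean. As b <= 1, its powers reduce to b itself, so a power of a conditional
    moment keeps one factor controlled by b, and the rest is bounded by averages of |zeta|^(p-2)
    through Jensen's inequality. This asks for p/2 - 1 >= 1. In the expansion of |s + y|^p the
    remainder |s| |y|^(p-1) is out of reach of conditioning. Hoelder's inequality interpolates it
    between |s|^(p-2) y^2 and |y|^p, which produces the exponent 2/(p(p-2)) and a nonlinear
    recursion. The linear factor 2 of that recursion is exactly the growth of n b, so a constant
    loss at every doubling is forbidden. The excess eta of the mixing rate saves it: sums over a
    block of length N give N^(1-eta) b instead of N b. The term n^(p/2) a comes from the
    covariances, whose size is governed by the supremum over x of E|zeta(x, Y_0)|; the factor
    ||f||_oo enters there. *)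

Local Open Scope classical_set_scope.
Local Open Scope ring_scope.

(** * Elementary inequalities *)

Section powR_inequalities.
Context {R : realType}.
Implicit Types (x y s t p : R).

(** Young's inequality for the product of s^theta and 1, with exponents 1/theta and 1/(1 - theta).
    The right side is the tangent at 1 of a concave power. *)
Lemma powR_le_affine s (theta : R) : 0 <= s -> 0 <= theta <= 1 ->
  s `^ theta <= 1 - theta + theta * s.
Proof.
move=> s0 /andP[]; rewrite le_eqVlt => /predU1P[<- _|t0].
  by rewrite powRr0 subr0 mul0r addr0.
rewrite le_eqVlt => /predU1P[->|t1]; first by rewrite powRr1// subrr add0r mul1r.
have p0 : 0 < theta^-1 by rewrite invr_gt0.
have q0 : 0 < (1 - theta)^-1 by rewrite invr_gt0 subr_gt0.
have := @conjugate_powR R (s `^ theta) 1 theta^-1 (1 - theta)^-1 (powR_ge0 _ _) ler01.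
rewrite !invrK => /(_ p0 q0); rewrite addrC subrK => /(_ erefl).
by rewrite mulr1 -powRrM mulfV ?gt_eqF// powRr1// powR1 mul1r [s * _]mulrC addrC.
Qed.

Lemma exprn_le_quadratic t (m : nat) : -1 <= t <= 1 ->
  (1 + t) ^+ m <= 1 + m%:R * t + 4 ^+ m * t ^+ 2.
Proof.
move=> /andP[t1 t2]; elim: m => [|m IH]; first by rewrite !expr0; nra.
rewrite exprS; apply: le_trans (ler_wpM2l _ IH) _; first lra.
have m4 : (m%:R : R) <= 4 ^+ m.
  by rewrite -natrX ler_nat ltnW// ltn_expl.
have F0 : 0 <= 4 ^+ m :> R by exact: exprn_ge0.
have M0 : 0 <= m%:R :> R by [].
have H : 0 <= (4 ^+ m + (4 ^+ m - m%:R) + 4 ^+ m * (1 - t)) * t ^+ 2.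
  rewrite mulr_ge0 ?sqr_ge0//.
  have : 0 <= 4 ^+ m * (1 - t) by rewrite mulr_ge0 ?subr_ge0.
  lra.
rewrite [4 ^+ m.+1]exprS -[m.+1%:R]natr1; move: H; set F := 4 ^+ m; set M := m%:R; nra.
Qed.

(** With m the integer part of p and q = p - m, this bounds the coefficient of t^2 in (1 + m t + 4^m
    t^2)(1 + q t): m q <= m, and 4^m (1 + q t) <= 2 4^m for t <= 1. *)
Definition taylor_const p : R := (Num.truncn p)%:R + 2 * 4 ^+ Num.truncn p.

Lemma taylor_const_ge0 p : 0 <= taylor_const p.
Proof. by rewrite addr_ge0// mulr_ge0// exprn_ge0. Qed.

(** Write (1 + t)^p as the power of integer order m times the power of order q in [0, 1]; the first
    factor has a quadratic bound by induction, the second an affine one by concavity. *)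
Lemma powR_le_quadratic p t : 1 <= p -> -1 <= t <= 1 ->
  (1 + t) `^ p <= 1 + p * t + taylor_const p * t ^+ 2.
Proof.
move=> p1 t1; rewrite /taylor_const; set m := Num.truncn p.
have p0 : 0 <= p by exact: le_trans p1.
have /andP[mp pm] : m%:R <= p < m.+1%:R by rewrite truncn_itv.
have m0 : (0 < m)%N by rewrite truncn_gt0.
have [t0 t2] : 0 <= 1 + t /\ t <= 1 by case/andP: t1 => *; lra.
have [th0 th1] : 0 <= p - m%:R /\ p - m%:R <= 1.
  by rewrite -natr1 in pm; split; lra.
have th : 0 <= p - m%:R <= 1 by rewrite th0.
have -> : (1 + t) `^ p = (1 + t) ^+ m * (1 + t) `^ (p - m%:R).
  have [z|nz] := eqVneq (1 + t) 0; last first.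
    by rewrite -powR_mulrn// -powRD ?nz ?implybT// [m%:R + _]addrC subrK.
  rewrite z powR0; last by rewrite gt_eqF// (lt_le_trans ltr01).
  by rewrite expr0n eqn0Ngt m0 mul0r.
apply: le_trans (ler_wpM2l (exprn_ge0 m t0) (powR_le_affine t0 th)) _.
have := exprn_le_quadratic m t1.
have -> : 1 - (p - m%:R) + (p - m%:R) * (1 + t) = 1 + (p - m%:R) * t by ring.
set q := p - m%:R; have -> : p = m%:R + q by rewrite /q addrC subrK.
move=> H.
have q1 : 0 <= 1 + q * t by rewrite /q; nra.
apply: le_trans (ler_wpM2r q1 H) _.
have F0 : 0 <= 4 ^+ m :> R by exact: exprn_ge0.
have K : 0 <= (m%:R * (1 - q) + 4 ^+ m * (1 - q * t)) * t ^+ 2.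
  by rewrite mulr_ge0 ?sqr_ge0// addr_ge0 ?mulr_ge0// /q; nra.
by move: K; set F := 4 ^+ m; set M := m%:R; nra.
Qed.

Definition rosenthal_const p : R := 2 * p + taylor_const p.

(** Expand around the larger of x and y. If |y| <= |x|, use t = y / x, keeping the linear term with
    its sign for later conditioning. Otherwise expand |y|^p (1 + |x|/|y|)^p; the linear term p x
    |x|^(p-2) y on the right may then be negative, but its size is at most p |x| |y|^(p-1). Hence
    the [2 * p] in the constant: one p from the expansion, one to compensate that term. *)
Lemma powR_addr_le p x y : 2 < p ->
  `|x + y| `^ p <= `|x| `^ p + `|y| `^ p + p * (x * `|x| `^ (p - 2)) * y
    + rosenthal_const p * (`|x| `^ (p - 2) * y ^+ 2 + `|x| * `|y| `^ (p - 1)).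
Proof.
move=> p2; have p1 : 1 <= p by lra.
have pN0 : p != 0 by rewrite gt_eqF//; lra.
have tc := taylor_const_ge0 p.
have [yx|xy] := leP `|y| `|x|.
  have [xE|x0] := eqVneq x 0.
    move: yx; rewrite xE normr0 normr_le0 => /eqP ->.
    by rewrite expr0n/= !(mulr0, mul0r, addr0, normr0) powR0// !addr0.
  have nx : 0 < `|x| by rewrite normr_gt0.
  have t1 : -1 <= y / x <= 1.
    by rewrite -ler_norml normrM normfV ler_pdivrMr// mul1r.
  have -> : `|x + y| `^ p = `|x| `^ p * (1 + y / x) `^ p.
    rewrite -powRM//; last by case/andP: t1 => *; lra.
    congr (_ `^ _); rewrite -[in RHS](@ger0_norm _ (1 + y / x)); last by case/andP: t1 => *; lra.
    by rewrite -normrM mulrDr mulr1 mulrCA mulfV// mulr1.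
  apply: le_trans (ler_wpM2l (powR_ge0 _ _) (powR_le_quadratic p1 t1)) _.
  have xp : `|x| `^ p = `|x| `^ (p - 2) * x ^+ 2.
    rewrite -[x ^+ 2]real_normK ?num_real// -powR_mulrn// -powRD ?subrK//.
    by rewrite (negbTE pN0).
  have -> : `|x| `^ p * (1 + p * (y / x) + taylor_const p * (y / x) ^+ 2) =
    `|x| `^ p + p * (x * `|x| `^ (p - 2)) * y + taylor_const p * (`|x| `^ (p - 2) * y ^+ 2).
    by rewrite xp; field.
  rewrite /rosenthal_const; have := powR_ge0 `|y| p.
  have : 0 <= `|x| `^ (p - 2) * y ^+ 2 by rewrite mulr_ge0 ?powR_ge0 ?sqr_ge0.
  have : 0 <= `|x| * `|y| `^ (p - 1) by rewrite mulr_ge0 ?powR_ge0.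
  nra.
have ny : 0 < `|y| by exact: le_lt_trans xy.
have t1 : -1 <= `|x| / `|y| <= 1.
  by rewrite -ler_norml normrM normfV !normr_id ler_pdivrMr// mul1r ltW.
have t0 : 0 <= `|x| / `|y| by rewrite divr_ge0.
have H1 : `|x + y| `^ p <= `|y| `^ p * (1 + `|x| / `|y|) `^ p.
  rewrite -powRM// ?addr_ge0//; apply: ge0_ler_powR; rewrite ?nnegrE ?mulr_ge0 ?addr_ge0//; first lra.
  by rewrite mulrDr mulr1 mulrCA mulfV ?gt_eqF// mulr1 addrC ler_normD.
have yp : `|y| `^ p = `|y| * `|y| `^ (p - 1) by rewrite mulr_powRB1//; lra.
have H2 : `|y| `^ p * (1 + `|x| / `|y|) `^ p <=
    `|y| `^ p + (p + taylor_const p) * (`|x| * `|y| `^ (p - 1)).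
  apply: le_trans (ler_wpM2l (powR_ge0 _ _) (powR_le_quadratic p1 t1)) _.
  have -> : `|y| `^ p + (p + taylor_const p) * (`|x| * `|y| `^ (p - 1)) =
     `|y| `^ p * (1 + p * (`|x| / `|y|) + taylor_const p * (`|x| / `|y|)).
    by rewrite yp; field; rewrite gt_eqF.
  rewrite ler_wpM2l ?powR_ge0// lerD2l ler_wpM2l// expr2 ler_piMl//.
  by case/andP: t1.
have H3 : - (p * (x * `|x| `^ (p - 2)) * y) <= p * (`|x| * `|y| `^ (p - 1)).
  apply: le_trans (ler_norm _) _; rewrite normrN !normrM ger0_norm; last lra.
  rewrite -!mulrA ler_wpM2l//; first lra.
  rewrite ler_wpM2l// ger0_norm ?powR_ge0//.
  have -> : `|y| `^ (p - 1) = `|y| `^ (p - 2) * `|y|.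
    have := @mulr_powRB1 R `|y| (p - 1) (ltW ny) ltac:(lra).
    by rewrite mulrC => <-; congr (_ `^ _ * _); lra.
  rewrite ler_wpM2r// ge0_ler_powR ?nnegrE// ?ltW//; lra.
rewrite /rosenthal_const; have := powR_ge0 `|x| p.
have : 0 <= `|x| `^ (p - 2) * y ^+ 2 by rewrite mulr_ge0 ?powR_ge0 ?sqr_ge0.
have : 0 <= `|x| * `|y| `^ (p - 1) by rewrite mulr_ge0 ?powR_ge0.
nra.
Qed.

(** Discrete comparison with the integral of x^(-sigma): each term is at most the increment of x^s /
    s, s = 1 - sigma, by the tangent bound [powR_le_affine]. *)
Lemma sum_powR_neg_le (sigma : R) (N : nat) : 0 < sigma < 1 ->
  \sum_(j < N) j.+1%:R `^ (- sigma) <= (1 - sigma)^-1 * N%:R `^ (1 - sigma).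
Proof.
move=> /andP[s0 s1]; elim: N => [|N IH].
  by rewrite big_ord0 mulr_ge0 ?powR_ge0// invr_ge0 subr_ge0 ltW.
rewrite big_ord_recr/=; apply: le_trans (lerD IH (lexx _)) _.
have d0 : 0 < 1 - sigma by rewrite subr_gt0.
set s := 1 - sigma in d0 *.
have N0 : (N.+1%:R : R) != 0 by rewrite pnatr_eq0.
have H : N%:R `^ s <= N.+1%:R `^ s * (1 - s / N.+1%:R).
  have -> : (N%:R : R) = N.+1%:R * (N%:R / N.+1%:R) by rewrite mulrCA mulfV ?mulr1.
  rewrite powRM ?divr_ge0// ler_wpM2l ?powR_ge0//.
  have th : 0 <= s <= 1 by rewrite (ltW d0)/= /s; lra.
  apply: le_trans (powR_le_affine _ th) _; first by rewrite divr_ge0.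
  rewrite le_eqVlt; apply/orP; left; apply/eqP.
  by rewrite -natr1 in N0 *; field.
have -> : N.+1%:R `^ (- sigma) = N.+1%:R `^ s / N.+1%:R.
  have -> : - sigma = s - 1 by rewrite /s; ring.
  by rewrite powRB ?powRr1// N0 implybT.
have si : 0 <= s^-1 by rewrite invr_ge0 ltW.
have -> : s^-1 * N.+1%:R `^ s = s^-1 * (N.+1%:R `^ s * (1 - s / N.+1%:R)) + N.+1%:R `^ s / N.+1%:R.
  by field; rewrite addrC natr1 N0 gt_eqF.
by rewrite lerD2r ler_wpM2l.
Qed.

(** The exponent 3/2 is the worst case. There the bound 3 - 2 M^(-1/2), suggested by the tail
    integral of x^(-3/2), is strong enough to pass through an induction. *)
Lemma sum_powR_neg_bounded (sigma : R) (N : nat) : 3 / 2 <= sigma ->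
  \sum_(j < N) j.+1%:R `^ (- sigma) <= 3.
Proof.
move=> s32; apply: le_trans (_ : \sum_(j < N) j.+1%:R `^ (- (3 / 2)) <= _).
  by apply: ler_sum => j _; rewrite ler_powR ?ler1n ?lerN2.
suff H (M : nat) : \sum_(j < M.+1) j.+1%:R `^ (- (3 / 2)) <= 3 - 2 * M.+1%:R `^ (- (1 / 2)) :> R.
  case: N => [|N]; first by rewrite big_ord0.
  apply: le_trans (H N) _; rewrite gerBl mulr_ge0// powR_ge0.
elim: M => [|M IH]; first by rewrite big_ord_recr big_ord0/= !powR1; lra.
rewrite big_ord_recr/=; apply: le_trans (lerD IH (lexx _)) _.
have N0 : (M.+2%:R : R) != 0 by rewrite pnatr_eq0.
have M2 : 2 <= M.+2%:R :> R by rewrite ler_nat.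
have h : 0 <= (1 / 2 : R) <= 1 by lra.
have q0 : 0 <= M.+1%:R / M.+2%:R :> R by rewrite divr_ge0.
have E : (M.+1%:R : R) = M.+2%:R * (M.+1%:R / M.+2%:R) by rewrite mulrCA mulfV ?mulr1.
have q : M.+1%:R / M.+2%:R = 1 - M.+2%:R^-1 :> R.
  by rewrite -[M.+1%:R](addrK 1) natr1 mulrBl mulfV// mul1r.
have EU : M.+1%:R `^ (1 / 2) = M.+2%:R `^ (1 / 2) * (M.+1%:R / M.+2%:R) `^ (1 / 2) :> R.
  by rewrite -powRM// -E.
have := powR_le_affine q0 h; rewrite [in X in _ <= X]q.
rewrite !powRN EU.
have -> : M.+2%:R `^ (3 / 2) = M.+2%:R * M.+2%:R `^ (1 / 2) :> R.
  by rewrite -{2}[M.+2%:R]powRr1// -powRD ?N0 ?implybT//; congr (_ `^ _); lra.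
set u := (M.+1%:R / M.+2%:R) `^ _ => Hu.
have u0 : 0 < u by rewrite powR_gt0// divr_gt0.
set v := M.+2%:R `^ _; have v0 : 0 < v by rewrite powR_gt0.
set m := M.+2%:R^-1 in Hu *; have mE : M.+2%:R = m^-1 by rewrite invrK.
have m0 : 0 < m by rewrite invr_gt0.
have m1 : m <= 1 / 2 by rewrite /m -[X in X <= _]mul1r ler_pdivrMr//; lra.
rewrite mE !invfM invrK.
have ui : 1 + m / 2 <= u^-1.
  by rewrite -[u^-1]mul1r ler_pdivlMr//; nra.
have vi : 0 < v^-1 by rewrite invr_gt0.
have : 2 * (v^-1 * (1 + m / 2)) <= 2 * (v^-1 * u^-1) by rewrite ler_wpM2l// ler_wpM2l// ltW.
set w := v^-1; set z := u^-1; nra.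
Qed.

(* A geometric sum over the scales 2^r controls both the part growing with r,
   dominated by its last term, and the summable part. *)
Lemma dyadic_recursion (p kappa c D : R) : 4 <= p -> 0 < kappa <= 1 -> 0 <= c -> 0 <= D ->
  exists2 A : R, 0 < A & forall (a b : R) (u : nat -> R), 0 <= a -> 0 <= b ->
    (forall r, 0 <= u r) -> u 0%N <= b ->
    (forall r, u r.+1 <= 2 * u r + c *
      let x := D * ((2 ^+ r) `^ (p / 2) * a + (2 ^+ r) `^ (1 - kappa) * b) in
      (u r `^ (1 - 2 / (p * (p - 2))) * x `^ (2 / (p * (p - 2))) + x)) ->
    forall r, u r <= A * ((2 ^+ r) `^ (p / 2) * a + 2 ^+ r * b).
Proof.
move=> p4 /andP[k0 k1] c0 D0.
set th := 2 / (p * (p - 2)).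
have th0 : 0 < th by rewrite divr_gt0// mulr_gt0; lra.
have th1 : th <= 1.
  by rewrite ler_pdivrMr ?mulr_gt0//; nra.
have pow1 (q : R) : 1 `^ q = 1 :> R by rewrite powR1.
pose tau : R := 2 `^ (- kappa).
have tau0 : 0 < tau by rewrite powR_gt0.
have tau1 : tau < 1.
  by rewrite /tau powRN invf_lt1 ?powR_gt0// -[ltLHS](pow1 kappa) gt0_ltr_powR ?nnegrE// ltr1n.
pose rho := tau `^ th.
have rho0 : 0 < rho by rewrite powR_gt0.
have rho1 : rho < 1.
  by rewrite -[ltRHS](pow1 th) gt0_ltr_powR ?nnegrE// ltW.
have d0 : 0 < 1 - rho by rewrite subr_gt0.
have taurho : tau <= rho by rewrite ger1_powR// tau0 ltW.
pose Gam := c * (2 * D `^ th + D) / (1 - rho).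
have Gam0 : 0 <= Gam 
  by apply: divr_ge0 (ltW d0); rewrite mulr_ge0// addr_ge0// mulr_ge0// powR_ge0.
(* A^th = 1 + Gam and A >= 1 give 1 + Gam A^(1-th) <= A: a bound of size A, inserted in the
   sublinear term, returns a bound of size A. *)
pose A := (1 + Gam) `^ th^-1.
have A1 : 1 <= A.
  rewrite -[leLHS](pow1 th^-1) ge0_ler_powR ?nnegrE//; [|lra|lra].
  by rewrite invr_ge0 ltW.
have A0 : 0 < A by apply: lt_le_trans A1.
have Ath : A `^ th = 1 + Gam by rewrite -powRrM mulVf ?gt_eqF// powRr1//; lra.
have powth x : 0 <= x -> x `^ (1 - th) * x `^ th = x.
  by move=> x0; rewrite -powRD ?subrK ?powRr1// oner_eq0.
have AA : 1 + Gam * A `^ (1 - th) <= A.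
  rewrite -[leRHS](powth _ (ltW A0)) Ath mulrDr mulr1 [Gam * _]mulrC lerD2r.
  by rewrite -[leLHS](powRr0 A) ler_powR// subr_ge0.
have p2E (s : nat) : (2 ^+ s : R) = 2 `^ s%:R by rewrite powR_mulrn.
have tauE (n : nat) : tau ^+ n = 2 `^ (- kappa * n%:R) by rewrite -powR_mulrn ?powR_ge0// -powRrM.
have rho_n (n : nat) : rho ^+ n = (tau ^+ n) `^ th by rewrite -(powR_mulrn n (ltW rho0)) -(powR_mulrn n (ltW tau0)) /rho powRAC.
have GamE : Gam = c * (2 * D `^ th + D) / (1 - rho) by [].
clearbody A Gam rho tau th.
exists A => // a b u a0 b0 u0 ub urec r.
(* The target at scale r is A 2^r w. With w frozen at this last scale, every earlier u s is compared
   with 2^s w, which absorbs the factor 2 of the recursion. *)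
have [w wE] : exists w, w = (2 ^+ r) `^ (p / 2 - 1) * a + b by exists ((2 ^+ r) `^ (p / 2 - 1) * a + b).
have w0 : 0 <= w by rewrite wE addr_ge0// mulr_ge0// powR_ge0.
have bw : b <= w by rewrite wE lerDr mulr_ge0// powR_ge0.
(* The cruder bound feeds the power of u s in the recursion. The finer one keeps track of the
   increments: its fraction dominates the sum of rho^(r-k) + rho^k over k < s and never exceeds 2 /
   (1 - rho). *)
suff H : forall s : nat, (s <= r)%N -> u s <= 2 ^+ s * (w + c / 2 * w * (2 * A `^ (1 - th) * D `^ th + D)
            * ((rho ^+ (r - s) + 1 - rho ^+ s) / (1 - rho))) /\ u s <= 2 ^+ s * (A * w).
  have [_ /le_trans] := H r (leqnn r); apply.
  rewrite wE mulrCA ler_wpM2l// ?(ltW A0)// mulrDr mulrA lerD2r.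
  rewrite [X in X * _ <= _](_ : _ = (2 ^+ r) `^ (p / 2))//.
  by rewrite mulr_powRB1//; lra.
have key (s : nat) : (s <= r)%N -> (rho ^+ (r - s) + 1 - rho ^+ s) / (1 - rho) <= 2 / (1 - rho).
  move=> _; rewrite ler_wpM2r ?invr_ge0 ?(ltW d0)//.
  have : rho ^+ (r - s) <= 1 by rewrite exprn_ile1// ltW.
  have : 0 <= rho ^+ s by rewrite exprn_ge0// ltW.
  lra.
have K0 : 0 <= 2 * A `^ (1 - th) * D `^ th + D by rewrite addr_ge0// !mulr_ge0// powR_ge0.
have second (s : nat) : (s <= r)%N -> u s <= 2 ^+ s * (w + c / 2 * w * (2 * A `^ (1 - th) * D `^ th + D)
            * ((rho ^+ (r - s) + 1 - rho ^+ s) / (1 - rho))) -> u s <= 2 ^+ s * (A * w).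
  move=> sr /le_trans; apply; rewrite ler_wpM2l ?exprn_ge0//.
  have h : 0 <= c / 2 * w * (2 * A `^ (1 - th) * D `^ th + D).
    by rewrite !mulr_ge0// divr_ge0.
  apply: le_trans (lerD (lexx w) (ler_wpM2l h (key s sr))) _.
  apply: le_trans (ler_wpM2r w0 AA).
  rewrite [X in _ <= X]mulrDl [X in _ <= X + _]mul1r lerD2l.
  have -> : c / 2 * w * (2 * A `^ (1 - th) * D `^ th + D) * (2 / (1 - rho)) =
     c / (1 - rho) * w * (2 * D `^ th * A `^ (1 - th) + D) by field; rewrite gt_eqF.
  have -> : Gam * A `^ (1 - th) * w = c / (1 - rho) * w * (2 * D `^ th * A `^ (1 - th) + D * A `^ (1 - th)).
    by rewrite GamE; field; rewrite gt_eqF.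
  rewrite ler_wpM2l//; first by rewrite mulr_ge0// divr_ge0// ltW.
  rewrite lerD2l ler_peMr// -[leLHS](powRr0 A) ler_powR// subr_ge0//.
elim=> [|s IH] sr.
  suff h : u 0%N <= 2 ^+ 0 * (w + c / 2 * w * (2 * A `^ (1 - th) * D `^ th + D)
            * ((rho ^+ (r - 0) + 1 - rho ^+ 0) / (1 - rho))) by split=> //; exact: second.
  rewrite !expr0 mul1r addrK; apply: le_trans ub _; apply: le_trans bw _.
  rewrite lerDl !mulr_ge0// ?invr_ge0// ?exprn_ge0// ltW//.
have {IH}[IH1 IH2] := IH (ltnW sr).
suff h : u s.+1 <= 2 ^+ s.+1 * (w + c / 2 * w * (2 * A `^ (1 - th) * D `^ th + D)
            * ((rho ^+ (r - s.+1) + 1 - rho ^+ s.+1) / (1 - rho))) by split=> //; exact: second.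
have := urec s; move: IH1 IH2; set x := (D * _) => IH1 IH2 Hu.
pose t := tau ^+ (r - s) + tau ^+ s.
have xle : x <= 2 ^+ s * (D * w * t).
  rewrite /x (_ : 2 ^+ s * (D * w * t) = D * (2 ^+ s * (w * t))); last by ring.
  apply: ler_wpM2l => //; rewrite /t wE !p2E -!powRrM !tauE.
  have -> : 2 `^ (s%:R * (p / 2)) = 2 `^ s%:R * 2 `^ (s%:R * (p / 2 - 1)) :> R.
    by rewrite -powRD ?pnatr_eq0 ?implybT//; congr (_ `^ _); ring.
  have -> : 2 `^ (s%:R * (1 - kappa)) = 2 `^ s%:R * 2 `^ (- kappa * s%:R) :> R.
    by rewrite -powRD ?pnatr_eq0 ?implybT//; congr (_ `^ _); ring.
  rewrite -!mulrA -mulrDr ler_wpM2l ?powR_ge0//.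
  (* As kappa <= 1 <= p/2 - 1, the part in a at scale s is smaller than at scale r by at least the
     factor tau^(r-s); this is the growing part of the sum over scales. *)
  have h1 : 2 `^ (s%:R * (p / 2 - 1)) <= 2 `^ (r%:R * (p / 2 - 1)) * 2 `^ (- kappa * (r - s)%:R) :> R.
    rewrite -powRD ?pnatr_eq0 ?implybT// ler_powR ?ler1n// natrB ?(ltnW sr)//.
    have : s%:R <= r%:R :> R by rewrite ler_nat ltnW.
    nra.
  have e1 := powR_ge0 (2 : R) (- kappa * s%:R).
  have e2 := powR_ge0 (2 : R) (- kappa * (r - s)%:R).
  have e3 := powR_ge0 (2 : R) (r%:R * (p / 2 - 1)).
  have := ler_wpM2r a0 h1.
  have := mulr_ge0 b0 e2.
  have := mulr_ge0 (mulr_ge0 e3 a0) e1.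
  move: (2 `^ (- kappa * s%:R)) (2 `^ (- kappa * (r - s)%:R)) (2 `^ (r%:R * (p / 2 - 1))) (2 `^ (s%:R * (p / 2 - 1))) => *.
  nra.
have t0 : 0 <= t by rewrite addr_ge0// exprn_ge0// ltW.
have x0 : 0 <= x by rewrite mulr_ge0// addr_ge0// mulr_ge0// powR_ge0.
pose rr := rho ^+ (r - s) + rho ^+ s.
have tth : t `^ th <= 2 * rr.
  pose m := Num.max (tau ^+ (r - s)) (tau ^+ s).
  have m0 : 0 <= m by rewrite le_max exprn_ge0// ltW.
  have tm : t <= 2 * m.
    have : tau ^+ (r - s) <= m by rewrite le_max lexx.
    have : tau ^+ s <= m by rewrite le_max lexx orbT.
    rewrite /t; lra.
  apply: le_trans (_ : (2 * m) `^ th <= _).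
    by rewrite ge0_ler_powR ?nnegrE// ?(ltW th0)// mulr_ge0.
  rewrite powRM//; apply: ler_pM; rewrite ?powR_ge0//.
    by rewrite -[leRHS](powRr1 (ler0n R 2)) ler_powR// ler1n.
  have [mE|mE] : m = tau ^+ (r - s) \/ m = tau ^+ s.
    by rewrite /m; case: leP; [right|left].
    by rewrite mE /rr !rho_n lerDl powR_ge0.
  by rewrite mE /rr !rho_n lerDr powR_ge0.
have tr : t <= rr.
  by rewrite /t /rr lerD// lerXn2r// ?nnegrE ltW.
have Hx : u s `^ (1 - th) * x `^ th + x <= 2 ^+ s * w * ((2 * A `^ (1 - th) * D `^ th + D) * rr).
  have s0 : 0 <= 2 ^+ s * w by rewrite mulr_ge0// exprn_ge0.
  have -> : 2 ^+ s * w * ((2 * A `^ (1 - th) * D `^ th + D) * rr) =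
     2 ^+ s * w * (A `^ (1 - th) * D `^ th) * (2 * rr) + 2 ^+ s * (D * w * rr) by ring.
  apply: lerD; last first.
    apply: le_trans xle _; rewrite ler_wpM2l ?exprn_ge0// ler_wpM2l// mulr_ge0//.
  apply: le_trans (_ : (2 ^+ s * w * A) `^ (1 - th) * (2 ^+ s * w * D * t) `^ th <= _).
    apply: ler_pM; rewrite ?powR_ge0// ge0_ler_powR ?nnegrE// ?subr_ge0// ?mulr_ge0// ?exprn_ge0// ?(ltW A0)// ?(ltW th0)//.
      by rewrite -[2 ^+ s * w * A]mulrA [w * A]mulrC.
    by apply: le_trans xle _; rewrite [D * w]mulrC !mulrA.
  rewrite ![in X in X <= _]powRM ?mulr_ge0 ?exprn_ge0 ?(ltW A0)//.
  rewrite -[in X in _ <= X * _ * _](powth _ s0) powRM ?exprn_ge0// powRM ?exprn_ge0//.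
  set X1 := (2 ^+ s) `^ _; set X2 := w `^ _; set X3 := A `^ _; set X4 := (2 ^+ s) `^ _.
  set X5 := w `^ _; set X6 := D `^ _.
  have -> : X1 * X2 * X3 * (X4 * X5 * X6 * t `^ th) = X1 * X2 * (X4 * X5) * (X3 * X6) * t `^ th by ring.
  by rewrite ler_wpM2l// !mulr_ge0// powR_ge0.
apply: le_trans Hu _.
apply: le_trans (lerD (ler_wpM2l (ler0n _ 2) IH1) (ler_wpM2l c0 Hx)) _.
rewrite exprS; set K := (2 * _ * _ + D).
have -> : 2 * (2 ^+ s * (w + c / 2 * w * K * ((rho ^+ (r - s) + 1 - rho ^+ s) / (1 - rho)))) + c * (2 ^+ s * w * (K * rr)) =
   2 * 2 ^+ s * (w + c / 2 * w * K * ((rho ^+ (r - s) + 1 - rho ^+ s) / (1 - rho) + rr)).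
  by field; rewrite gt_eqF.
rewrite ler_wpM2l ?mulr_ge0 ?exprn_ge0// lerD2l ler_wpM2l ?mulr_ge0// ?divr_ge0//.
rewrite /rr exprS -(subnSK sr) exprS.
set z1 := rho ^+ _; set z2 := rho ^+ s.
have z10 : 0 <= z1 by rewrite exprn_ge0// ltW.
rewrite ler_pdivlMr// mulrDl divfK ?gt_eqF//.
have z11 : rho * z1 <= z1 by rewrite ler_piMl// ltW.
nra.
Qed.

End powR_inequalities.

(** * Functions of bounded variation as distribution functions *)

Section bounded_variation_limits.
Context {R : realType}.
Implicit Types (K g : R -> R).

Lemma nondecreasing_right_limit g (a b x : R) :
  {in `[a, b] &, nondecreasing_fun g} -> a < x < b ->
  cvg (g y @[y --> x^'+]) /\
  (~ discontinuity g x -> lim (g y @[y --> x^'+]) = g x).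
Proof.
move=> ndg /andP[ax xb].
have cr : cvg (g y @[y --> x^'+]).
  apply: nondecreasing_at_right_is_cvgr; near=> s.
    move=> y z; rewrite !in_itv/= => /andP[xy ys] /andP[xz zs] yz.
    have sb : s <= b by near: s; exact: nbhs_right_le.
    by rewrite ndg// in_itv/= (ltW (lt_trans ax _))//= (le_trans (ltW _) sb).
  exists (g x) => _ /= [y + <-]; rewrite in_itv/= => /andP[xy ys].
  have sb : s <= b by near: s; exact: nbhs_right_le.
  by rewrite ndg ?in_itv/= ?(ltW xy) ?(ltW ax) ?(ltW xb)//= (ltW (lt_trans ax _))//= (le_trans (ltW _) sb).
have cl : cvg (g y @[y --> x^'-]).
  apply: nondecreasing_at_left_is_cvgr; near=> s.
    move=> y z; rewrite !in_itv/= => /andP[xy ys] /andP[xz zs] yz.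
    have sb : a <= s by near: s; exact: nbhs_left_ge.
    by rewrite ndg// in_itv/= (le_trans sb (ltW _))//= (ltW (lt_trans _ xb)).
  exists (g x) => _ /= [y + <-]; rewrite in_itv/= => /andP[xy ys].
  have sb : a <= s by near: s; exact: nbhs_left_ge.
  by rewrite ndg ?in_itv/= ?(ltW ys) ?(ltW ax) ?(ltW xb)//= (le_trans sb (ltW _))//= (ltW (lt_trans _ xb)).
split=> // nd.
have lr : lim (g y @[y --> x^'-]) = lim (g y @[y --> x^'+]).
  by apply: contrapT => /eqP ne; apply: nd; split.
apply/eqP; rewrite eq_le; apply/andP; split.
  rewrite -lr; apply: limr_le => //; near=> y.
  have ay : a <= y by near: y; exact: nbhs_left_ge.
  have yx : y <= x by near: y; exact: nbhs_left_le.
  by rewrite ndg// in_itv/= ?ay ?(ltW ax) ?(ltW xb)//= (le_trans yx (ltW _)).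
apply: limr_ge => //; near=> y.
have yb : y <= b by near: y; exact: nbhs_right_le.
have xy : x <= y by near: y; exact: nbhs_right_ge.
by rewrite ndg// in_itv/= ?yb ?(ltW ax) ?(ltW xb)//= andbT (le_trans (ltW ax)).
Unshelve. all: end_near. Qed.

(** On each segment [-n, n] the Jordan decomposition writes K as a difference of nondecreasing
    functions, whose discontinuities are countable; D is the union over n of these sets. *)
Lemma bounded_variation_right_limit K : bounded_variation_line K ->
  exists2 D : set R, countable D & forall x, cvg (K y @[y --> x^'+]) /\
    (~ D x -> lim (K y @[y --> x^'+]) = K x).
Proof.
move=> [M KM].
have BV (a b : R) : a <= b -> bounded_variation a b K.
  move=> ab; apply/bounded_variationP => //.
  by rewrite ge0_fin_numE ?total_variation_ge0// (le_lt_trans (KM _ _ ab))// ltry.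
pose l (n : nat) : R := - n%:R; pose r (n : nat) : R := n%:R.
have lr n : l n <= r n by rewrite /l /r; have : 0 <= n%:R :> R by []; lra.
pose gp n := fine \o pos_tv (l n) K.
pose gn n := fine \o neg_tv (l n) K.
have ndgn n : {in `[l n, r n] &, nondecreasing_fun (gn n)}.
  by apply: fine_neg_tv_nondecreasing; exact: BV.
have ndgp n : {in `[l n, r n] &, nondecreasing_fun (gp n)}.
  by apply: fine_neg_tv_nondecreasing; apply/bounded_variationN; exact: BV.
have KE n : {in `[l n, r n], K =1 gp n \- gn n}.
  by apply: bounded_variation_pos_neg_tvE; exact: BV.
exists (\bigcup_(nb : nat * bool) [set x | x \in (`]l nb.1, r nb.1[) /\
    discontinuity (if nb.2 then gp nb.1 else gn nb.1) x]).
  apply: bigcup_countable => // -[n []] _ /=; exact: discontinuity_countable.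
move=> x; pose n := (Num.truncn `|x|).+1.
have xn : `|x| < n%:R by rewrite /n truncnS_gt.
have lx : l n < x < r n by rewrite -ltr_norml.
have [cp ep] := nondecreasing_right_limit (@ndgp n) lx.
have [cn en] := nondecreasing_right_limit (@ndgn n) lx.
have KEx : \forall y \near x^'+, (gp n \- gn n) y = K y.
  case/andP: lx => lx1 lx2; near=> y; rewrite -KE// in_itv/=; apply/andP; split.
    by rewrite (le_trans (ltW lx1))//; near: y; exact: nbhs_right_ge.
  by near: y; exact: nbhs_right_le.
have cK : K y @[y --> x^'+] --> lim (gp n y @[y --> x^'+]) - lim (gn n y @[y --> x^'+]).
  apply: cvg_trans (cvgB cp cn); apply: near_eq_cvg; exact: KEx.
split; first by apply/cvg_ex; eexists; exact: cK.
move=> nD; rewrite (cvg_lim _ cK)//.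
have -> : K x = (gp n \- gn n) x.
  by rewrite (KE n)// in_itv/=; case/andP: lx => /ltW -> /ltW ->.
rewrite ep ?en// => dx; apply: nD; [exists (n, false)|exists (n, true)] => //;
  by split=> //; rewrite in_itv/=.
Unshelve. all: end_near. Qed.

End bounded_variation_limits.

Section signed_distribution_function.
Context {R : realType}.
Local Notation mR := (measurableTypeR R).

Definition cdf_diff (m1 m2 : set mR -> \bar R) (u : R) : R :=
  fine (m1 `]-oo, u]%classic) - fine (m2 `]-oo, u]%classic).

Lemma measurable_cdf (m : {finite_measure set mR -> \bar R}) :
  measurable_fun [set: R] (fun u : R => fine (m `]-oo, u]%classic)).
Proof.
apply: nondecreasing_measurable => // u v uv; apply: fine_le; rewrite ?fin_num_measure//.
by apply: le_measure; rewrite ?inE//; exact: subset_itvl.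
Qed.

Lemma measurable_cdf_diff (m1 m2 : {finite_measure set mR -> \bar R}) :
  measurable_fun [set: R] (cdf_diff m1 m2).
Proof. by apply: measurable_funB; exact: measurable_cdf. Qed.

Lemma cdf_diff_le (m1 m2 : {finite_measure set mR -> \bar R}) (u : R) :
  `|cdf_diff m1 m2 u| <= fine (m1 setT) + fine (m2 setT).
Proof.
have H (m : {finite_measure set mR -> \bar R}) : 0 <= fine (m `]-oo, u]%classic) <= fine (m setT).
  rewrite fine_ge0//=; apply: fine_le; rewrite ?fin_num_measure//.
  by apply: le_measure; rewrite ?inE.
have /andP[a1 b1] := H m1; have /andP[a2 b2] := H m2.
rewrite /cdf_diff ler_norml; lra.
Qed.

Lemma cdf_small (m : {finite_measure set mR -> \bar R}) (e : R) : 0 < e ->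
  exists M : R, forall u, u <= M -> fine (m `]-oo, u]%classic) < e.
Proof.
move=> e0; pose F (n : nat) : set mR := `]-oo, - n%:R]%classic.
have F0 : \bigcap_n F n = set0.
  rewrite -subset0 => x Fx; have := Fx (Num.truncn `|x|).+1 I.
  rewrite /F/= in_itv/= => xn; have := truncnS_gt `|x|.
  have := ler_norm (- x); rewrite normrN; lra.
have mF n : measurable (F n) by exact: measurable_itv.
have : m (F n) @[n --> \oo] --> m (\bigcap_n F n).
  apply: nonincreasing_cvg_mu => //.
  - by rewrite -ge0_fin_numE// fin_num_measure.
  - by rewrite F0.
  - move=> i j ij; apply/subsetPset; apply: subset_itvl.
    by rewrite bnd_simp lerN2 ler_nat.
rewrite F0 measure0 => /fine_cvgP[_ /cvgrPdist_lt/(_ _ e0)[N _ HN]].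
exists (- N%:R) => u uN; apply: le_lt_trans (_ : fine (m (F N)) < e).
  apply: fine_le; rewrite ?fin_num_measure//.
  by apply: le_measure; rewrite ?inE//; exact: subset_itvl.
by have := HN N (leqnn N); rewrite /= sub0r normrN ger0_norm ?fine_ge0.
Qed.

(** The right limits of K and the function G built from the Jordan parts have the same increments,
    so off the countable set D the kernel is G plus a constant. G tends to 0 at -oo, hence a nonzero
    constant would contradict the integrability of K. Measurability of K is inherited from G. *)
Lemma stieltjes_charge_cdf (K : R -> R) (nu : {charge set mR -> \bar R}) :
  bounded_variation_line K -> is_stieltjes_charge K nu ->
  (\int[lebesgue_measure]_u `|(K u)%:E| < +oo)%E ->
  measurable_fun [set: R] K /\
  exists m1 m2 : {finite_measure set mR -> \bar R},
    total_variation_norm nu = (fine (m1 setT) + fine (m2 setT))%:E /\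
    exists2 D : set R, countable D & forall u, ~ D u -> K u = cdf_diff m1 m2 u.
Proof.
move=> bvK nuK intK.
have [D cD KD] := bounded_variation_right_limit bvK.
set H := svalP (cid (svalP (cid (Hahn_decomposition nu)))).
pose m1 : {finite_measure set mR -> \bar R} := jordan_pos H.
pose m2 : {finite_measure set mR -> \bar R} := jordan_neg H.
have nuE (A : set mR) : measurable A -> nu A = (m1 A - m2 A)%E.
  by move=> mA; rewrite (jordan_decomp H)// /cadd/= cscaleN1.
have fE (m : {finite_measure set mR -> \bar R}) (A : set mR) : measurable A -> m A = (fine (m A))%:E.
  by move=> mA; rewrite fineK// fin_num_measure.
have split_itv (m : {finite_measure set mR -> \bar R}) (a b : R) : a <= b ->
    fine (m `]-oo, b]%classic) = fine (m `]-oo, a]%classic) + fine (m `]a, b]%classic).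
  move=> ab; rewrite -fineD ?fin_num_measure// -measureU//.
    by congr (fine (m _)); rewrite -itv_bndbnd_setU// bnd_simp.
  rewrite -subset0 => x /= []; rewrite !in_itv/= => xa /andP[ax _].
  by move: ax; rewrite ltNge xa.
pose G := cdf_diff m1 m2.
have GK (a b : R) : a <= b -> G b - G a = lim (K y @[y --> b^'+]) - lim (K y @[y --> a^'+]).
  move=> ab; apply/EFin_inj; rewrite -(nuK _ _ ab) nuE// (fE m1)// (fE m2)// -EFinB.
  congr EFin; rewrite /G /cdf_diff !(split_itv _ _ _ ab); ring.
(* The additive constant, read off at the arbitrary point 0; the rest of the proof shows that it
   vanishes. *)
pose kap := lim (K y @[y --> 0^'+]) - G 0.
have KG u : ~ D u -> K u = G u + kap.
  move=> Du; have [_ /(_ Du) <-] := KD u; rewrite /kap.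
  by have [u0|/ltW u0] := leP u 0; move: (GK _ _ u0); clear; lra.
have mD : measurable (D : set mR) by apply: countable_measurable cD => t; exact: measurable_set1.
have mG : measurable_fun [set: R] G by exact: measurable_cdf_diff.
have mK : measurable_fun [set: R] K.
  rewrite -(setvU D); apply/measurable_funU => //; first exact: measurableC.
  split.
    apply: eq_measurable_fun (_ : measurable_fun _ (fun u => G u + kap)) => [u|].
      by rewrite inE => Du; rewrite KG.
    by apply: measurable_funS (measurable_funD mG (measurable_cst kap)).
  move=> _ B mB; apply: countable_measurable; first by move=> t; exact: measurable_set1.
  by apply: sub_countable cD; apply: subset_card_le => x [].
split=> //; exists m1, m2; split.
  by rewrite /total_variation_norm /charge_variation -/H EFinD -!fE.
exists D => // u Du; rewrite KG//; suff -> : kap = 0 by rewrite addr0.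
apply: contrapT => /eqP kap0.
have k0 : 0 < `|kap| / 4 by rewrite divr_gt0 ?normr_gt0.
have [M1 HM1] := cdf_small m1 k0.
have [M2 HM2] := cdf_small m2 k0.
pose M := Num.min M1 M2.
have KM v : v <= M -> ~ D v -> `|kap| / 2 <= `|K v|.
  rewrite le_min => /andP[v1 v2] Dv; rewrite KG// /G /cdf_diff.
  have := HM1 _ v1; have := HM2 _ v2.
  have := fine_ge0 (measure_ge0 m1 `]-oo, v]%classic).
  have := fine_ge0 (measure_ge0 m2 `]-oo, v]%classic).
  set x := fine (m2 _); set y := fine (m1 _) => x0 y0 xl yl.
  have : `|kap| <= `|y - x + kap| + `|y - x|.
    by rewrite -{1}(addKr (y - x) kap) (le_trans (ler_normD _ _))// normrN addrC.
  have : `|y - x| <= x + y by rewrite ler_norml; move: x0 y0; clear; lra.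
  by move: xl yl; clear; lra.
(* Were the constant nonzero, |K| would be at least |kap| / 2 on a half-line minus a countable set,
   which has infinite measure. *)
have : (\int[lebesgue_measure]_(u in `]-oo, M]%classic `\` D) (`|kap| / 2)%:E <= \int[lebesgue_measure]_u `|(K u)%:E|)%E.
  apply: le_trans (_ : (\int[lebesgue_measure]_(u in `]-oo, M]%classic `\` D) `|(K u)%:E| <= _)%E).
    apply: ge0_le_integral => //.
    - exact: measurableD.
    - by apply: measurableT_comp => //; apply/measurable_EFinP; exact: measurable_funTS.
    - by move=> z [/=]; rewrite in_itv/= => zM Dz; rewrite lee_fin KM.
  apply: ge0_subset_integral => //; first exact: measurableD.
  by apply: measurableT_comp => //; exact/measurable_EFinP.
rewrite integral_cst; last exact: measurableD.
rewrite [X in (_ * X <= _)%E](_ : _ = +oo%E); last first.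
  apply/eqP; rewrite -leye_eq.
  have -> : (+oo = lebesgue_measure (`]-oo, M]%classic : set R))%E.
    by rewrite lebesgue_measure_itv/= ltNyr.
  rewrite -[leRHS]adde0 -(countable_lebesgue_measure0 cD).
  apply: le_trans (measureU2 _ _ _); [|exact: measurableD|by []].
  by apply: le_measure; rewrite ?inE//; [exact: measurableU (measurableD _ _) _|by move=> z zM; have [?|?] := pselect (D z); [right|left]].
by rewrite gt0_muley ?lte_fin ?divr_gt0 ?normr_gt0// leye_eq => /eqP iy; rewrite iy in intK.
Qed.
End signed_distribution_function.

(** * Integrals of bounded measurable functions *)

Section measurable_induction.
Context d (T : measurableType d) (R : realType).
Import HBNNSimple.

(** The standard extension from indicators through simple functions to monotone limits, as an
    induction principle. It serves for the conditioning identity, equality of laws, the affine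
    change of variables and comparison with a dominating measure. *)
Lemma ge0_measurable_ind (phi : (T -> \bar R) -> Prop) :
  (forall A, measurable A -> phi (fun x => (\1_A x)%:E)) ->
  (forall (k : R) f, 0 <= k -> measurable_fun setT f -> (forall x, 0 <= f x)%E ->
     phi f -> phi (fun x => k%:E * f x)%E) ->
  (forall f g, measurable_fun setT f -> (forall x, 0 <= f x)%E ->
     measurable_fun setT g -> (forall x, 0 <= g x)%E ->
     phi f -> phi g -> phi (fun x => f x + g x)%E) ->
  (forall (f_ : nat -> T -> \bar R), (forall n, measurable_fun setT (f_ n)) ->
     (forall n x, 0 <= f_ n x)%E ->
     (forall x, nondecreasing_seq (f_ ^~ x)) ->
     (forall n, phi (f_ n)) -> phi (fun x => limn (f_ ^~ x))) ->
  forall f, measurable_fun setT f -> (forall x, 0 <= f x)%E -> phi f.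
Proof.
move=> phi1 phiZ phiD phil f mf f0.
have phis (g : {nnsfun T >-> R}) : phi (fun x => (g x)%:E).
  pose F r := fun x => (r%:E * (\1_(g @^-1` [set r]) x)%:E)%E.
  have H (s : seq R) : all (>= 0) s -> [/\ measurable_fun setT (fun x => \sum_(r <- s) F r x)%E,
      (forall x, 0 <= \sum_(r <- s) F r x)%E & phi (fun x => \sum_(r <- s) F r x)%E].
    elim: s => [_|r s IH /=/andP[r0 /IH[mS S0 pS]]].
      split; [|by move=> x; rewrite big_nil|].
        by under eq_fun do rewrite big_nil; exact: measurable_cst.
      have := phi1 set0 measurable0; congr phi; apply/funext => x.
      by rewrite big_nil indic0.
    have mF : measurable_fun setT (F r).
      by apply: measurable_funeM; apply/measurable_EFinP; exact: measurable_indic.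
    have F0 x : (0 <= F r x)%E by rewrite mule_ge0// lee_fin.
    split.
    - under eq_fun do rewrite big_cons.
      exact: emeasurable_funD.
    - by move=> x; rewrite big_cons adde_ge0.
    - have -> : (fun x => \sum_(r0 <- r :: s) F r0 x)%E = (fun x => F r x + \sum_(r0 <- s) F r0 x)%E.
        by apply/funext => x; rewrite big_cons.
      apply: phiD => //; apply: phiZ => //; first by apply/measurable_EFinP; exact: measurable_indic.
      exact: phi1.
  have := H (finmap.enum_fset (fset_set (range g))).
  have -> : all (>= 0) (finmap.enum_fset (fset_set (range g))).
    by apply/allP => r; rewrite in_fset_set// => /set_mem[x _ <-] /=.
  move=> /(_ isT)[_ _]; congr phi; apply/funext => x.
  rewrite fimfunE -fsumEFin// fsbig_finite//=.
pose f_ := nnsfun_approx measurableT mf.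
have -> : f = (fun x => limn (fun n => (f_ n x)%:E)).
  apply/funext => x; apply/esym/cvg_lim => //; apply: cvg_nnsfun_approx => //.
apply: (phil (fun n x => (f_ n x)%:E)) => //.
- by move=> n; apply/measurable_EFinP.
- by move=> n x; rewrite lee_fin.
- by move=> x m n mn; rewrite lee_fin; exact/lefP/nd_nnsfun_approx.
Qed.

End measurable_induction.

Section hoelder_bound.
Context d (T : measurableType d) (R : realType) (mu : {measure set T -> \bar R}).

Lemma hoelder_bound (f g : T -> R) (a b U X : R) :
  measurable_fun setT f -> measurable_fun setT g -> 
  (forall x, 0 <= f x) -> (forall x, 0 <= g x) ->
  0 < a -> 0 < b -> a^-1 + b^-1 = 1 -> 0 <= U -> 0 <= X ->
  (\int[mu]_x ((f x) `^ a)%:E <= U%:E)%E ->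
  (\int[mu]_x ((g x) `^ b)%:E <= X%:E)%E ->
  (\int[mu]_x (f x * g x)%:E <= (U `^ a^-1 * X `^ b^-1)%:E)%E.
Proof.
move=> mf mg f0 g0 a0 b0 ab U0 X0 fU gX.
have LE (h : T -> R) (r M : R) : (forall x, 0 <= h x) -> 0 < r -> 0 <= M ->
    (\int[mu]_x ((h x) `^ r)%:E <= M%:E)%E -> ('N[mu]_r%:E[EFin \o h] <= (M `^ r^-1)%:E)%E.
  move=> h0 r0 M0 hM; rewrite unlock -poweR_EFin.
  under eq_integral do rewrite /= ger0_norm//.
  have I0 : (0 <= \int[mu]_x (h x `^ r)%:E)%E by apply: integral_ge0 => x _; rewrite lee_fin powR_ge0.
  move: (\int[mu]_x (h x `^ r)%:E)%E I0 hM => I I0 IM.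
  have ri : 0 <= r^-1 by rewrite invr_ge0 ltW.
  by apply: (gt0_ler_poweR ri) => //; rewrite in_itv/= leey andbT.
have := hoelder mu mf mg a0 b0 ab; rewrite Lnorm1.
under eq_integral do rewrite /= ger0_norm ?mulr_ge0//.
move/le_trans; apply; rewrite EFinM; apply: lee_pmul; rewrite ?Lnorm_ge0//; exact: LE.
Qed.

End hoelder_bound.

Section bounded_measurable.
Context d (T : measurableType d) (R : realType).
Implicit Types f g : T -> R.

(** Centered summands are bounded by a multiple of the variation of K, so every function under an
    expectation can be kept in this class. It is stable under the operations used and integrable
    under a probability, which allows real-valued integrals throughout. *)
Definition bounded_measurable f :=
  measurable_fun setT f /\ exists M : R, forall x, `|f x| <= M.

Lemma bounded_measurable_cst (k : R) : bounded_measurable (fun=> k).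
Proof. by split=> //; exists `|k|. Qed.

Lemma bounded_measurableD f g : bounded_measurable f -> bounded_measurable g ->
  bounded_measurable (fun x => f x + g x).
Proof.
move=> [mf [M fM]] [mg [N gN]]; split; first exact: measurable_funD.
by exists (M + N) => x; rewrite (le_trans (ler_normD _ _))// lerD.
Qed.

Lemma bounded_measurableM f g : bounded_measurable f -> bounded_measurable g ->
  bounded_measurable (fun x => f x * g x).
Proof.
move=> [mf [M fM]] [mg [N gN]]; split; first exact: measurable_funM.
by exists (M * N) => x; rewrite normrM ler_pM.
Qed.

Lemma bounded_measurableB f g : bounded_measurable f -> bounded_measurable g ->
  bounded_measurable (fun x => f x - g x).
Proof.
move=> [mf [M fM]] [mg [N gN]]; split; first exact: measurable_funB.
by exists (M + N) => x; rewrite (le_trans (ler_normB _ _))// lerD.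
Qed.

Lemma bounded_measurable_norm f : bounded_measurable f -> bounded_measurable (fun x => `|f x|).
Proof.
move=> [mf [M fM]]; split; first exact: measurableT_comp.
by exists M => x; rewrite normr_id.
Qed.

Lemma bounded_measurable_powR f (r : R) : 0 <= r -> bounded_measurable f ->
  bounded_measurable (fun x => `|f x| `^ r).
Proof.
move=> r0 [mf [M fM]]; split.
  by apply: (measurableT_comp (measurable_powR r)); exact: measurableT_comp.
exists (M `^ r) => x; rewrite ger0_norm ?powR_ge0// ge0_ler_powR ?nnegrE//.
by rewrite (le_trans _ (fM x)).
Qed.

Lemma bounded_measurable_sum (I : Type) (s : seq I) (F : I -> T -> R) :
  (forall i, bounded_measurable (F i)) -> bounded_measurable (fun x => \sum_(i <- s) F i x).
Proof.
move=> bF; elim: s => [|i s IH].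
  by under eq_fun do rewrite big_nil; exact: bounded_measurable_cst.
by under eq_fun do rewrite big_cons; exact: bounded_measurableD.
Qed.

Variable mu : {measure set T -> \bar R}.
Hypothesis mu1 : mu setT = 1%E.

Lemma bounded_measurable_integrable f : bounded_measurable f ->
  mu.-integrable setT (EFin \o f).
Proof.
move=> [mf [M fM]]; apply: measurable_bounded_integrable => //.
  by rewrite mu1 ltry.
exists M; split; first exact: num_real.
by move=> K MK x _ /=; rewrite (le_trans (fM x))// ltW.
Qed.

Lemma EFin_Rint f : bounded_measurable f ->
  (\int[mu]_x f x)%:E = (\int[mu]_x (f x)%:E)%E.
Proof. by move=> bf; rewrite /Rintegral fineK// integrable_fin_num//; exact: bounded_measurable_integrable. Qed.

Lemma Rint_cst (k : R) : \int[mu]_x k = k.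
Proof. by rewrite Rintegral_cst// mu1/= mulr1. Qed.

Lemma RintD f g : bounded_measurable f -> bounded_measurable g ->
  \int[mu]_x (f x + g x) = \int[mu]_x f x + \int[mu]_x g x.
Proof. by move=> bf bg; rewrite RintegralD//; exact: bounded_measurable_integrable. Qed.

Lemma RintB f g : bounded_measurable f -> bounded_measurable g ->
  \int[mu]_x (f x - g x) = \int[mu]_x f x - \int[mu]_x g x.
Proof. by move=> bf bg; rewrite RintegralB//; exact: bounded_measurable_integrable. Qed.

Lemma RintZ f (k : R) : bounded_measurable f ->
  \int[mu]_x (k * f x) = k * \int[mu]_x f x.
Proof. by move=> bf; rewrite RintegralZl//; exact: bounded_measurable_integrable. Qed.

Lemma Rint_sum (I : Type) (s : seq I) (F : I -> T -> R) :
  (forall i, bounded_measurable (F i)) ->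
  \int[mu]_x (\sum_(i <- s) F i x) = \sum_(i <- s) \int[mu]_x F i x.
Proof.
move=> bF; elim: s => [|i s IH].
  by rewrite big_nil -[RHS]Rint_cst; apply: eq_Rintegral => x _; rewrite big_nil.
rewrite big_cons -IH -RintD//; last exact: bounded_measurable_sum.
by apply: eq_Rintegral => x _; rewrite big_cons.
Qed.

Lemma Rint_le f g : bounded_measurable f -> bounded_measurable g ->
  (forall x, f x <= g x) -> \int[mu]_x f x <= \int[mu]_x g x.
Proof. by move=> bf bg fg; apply: le_Rintegral => //; exact: bounded_measurable_integrable. Qed.

Lemma Rint_norm f : bounded_measurable f -> `|\int[mu]_x f x| <= \int[mu]_x `|f x|.
Proof. by move=> bf; apply: le_normr_Rintegral => //; exact: bounded_measurable_integrable. Qed.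

Lemma Rint_bound f (M : R) : bounded_measurable f -> (forall x, `|f x| <= M) ->
  `|\int[mu]_x f x| <= M.
Proof.
move=> bf fM; apply: le_trans (Rint_norm bf) _; rewrite -[leRHS]Rint_cst.
by apply: Rint_le => //; [exact: bounded_measurable_norm|exact: bounded_measurable_cst].
Qed.

(** Jensen's inequality, from Hoelder's inequality against the constant 1. The case q = 1 is
    separate because its conjugate exponent is infinite. *)
Lemma powR_Rint_le f (q : R) : 1 <= q -> bounded_measurable f ->
  `|\int[mu]_x f x| `^ q <= \int[mu]_x `|f x| `^ q.
Proof.
move=> q1 bf; have q0 : 0 < q by exact: lt_le_trans q1.
have bn := bounded_measurable_norm bf.
apply: le_trans (_ : (\int[mu]_x `|f x|) `^ q <= _).
  by rewrite ge0_ler_powR ?nnegrE ?(ltW q0)// ?Rint_norm//; apply: Rintegral_ge0.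
move: q1; rewrite le_eqVlt => /predU1P[<-|q1].
  rewrite powRr1; last exact: Rintegral_ge0.
  by apply: Rint_le => //; [exact: bounded_measurable_powR|move=> x; rewrite powRr1].
have bp := bounded_measurable_powR (ltW q0) bf.
have qi : 0 < 1 - q^-1 by rewrite subr_gt0 invf_lt1.
set X := \int[mu]_x `|f x| `^ q.
have X0 : 0 <= X by apply: Rintegral_ge0 => x _; rewrite powR_ge0.
have : (\int[mu]_x (`|f x| * 1)%:E <= (X `^ q^-1 * 1 `^ (1 - q^-1)^-1^-1)%:E)%E.
  apply: hoelder_bound => //.
  - by case: bn.
  - by rewrite invr_gt0.
  - by rewrite invrK addrC subrK.
  - by rewrite EFin_Rint.
  - by under eq_integral do rewrite powR1; rewrite integral_cst// mu1 mule1.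
under eq_integral do rewrite mulr1.
rewrite -EFin_Rint// lee_fin powR1 mulr1 => H.
rewrite -[leRHS](powRr1 X0) -(mulVf (lt0r_neq0 q0)) powRrM.
by rewrite ge0_ler_powR ?nnegrE ?powR_ge0 ?(ltW q0)//; apply: Rintegral_ge0.
Qed.

End bounded_measurable.

(** * Conditioning on the past *)

Section second_projection_kernel.
Context d1 d2 d3 (Z : measurableType d1) (X : measurableType d2) (Y : measurableType d3) (R : realType).
Variable k : R.-pker X ~> Y.

(** Adjoins to the source a parameter on which the kernel does not depend. Measurability of kernel
    integrals then gives joint measurability in (x, w) of a conditional expectation whose integrand
    depends on x. *)
Definition kernel_snd : Z * X -> {measure set Y -> \bar R} := fun zx => k zx.2.

Let measurable_kernel_snd U : measurable U -> measurable_fun [set: Z * X] (kernel_snd ^~ U).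
Proof. by move=> mU; exact: measurableT_comp (measurable_kernel k U mU) measurable_snd. Qed.

HB.instance Definition _ := isKernel.Build _ _ _ _ R kernel_snd measurable_kernel_snd.

Let kernel_snd_prob zx : kernel_snd zx setT = 1%E.
Proof. exact: prob_kernel. Qed.

HB.instance Definition _ := Kernel_isProbability.Build _ _ _ _ R kernel_snd kernel_snd_prob.

Lemma measurable_integral_kernel_snd (f : Z * X * Y -> \bar R) :
  measurable_fun setT f -> (forall z, 0 <= f z)%E ->
  measurable_fun [set: Z * X] (fun zx => \int[k zx.2]_y f (zx, y))%E.
Proof.
by move=> mf f0; exact: (@measurable_fun_integral_finite_kernel _ _ _ _ _ f kernel_snd f0 mf).
Qed.

Lemma measurable_Rintegral_kernel_snd (f : Z * X * Y -> R) :
  bounded_measurable f ->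
  measurable_fun [set: Z * X] (fun zx => \int[k zx.2]_y f (zx, y)).
Proof.
move=> [mf [M fM]].
have bf zx : bounded_measurable (fun y => f (zx, y)).
  by split; [exact: measurableT_comp mf (measurable_pair1 _)|exists M].
(* Adding the bound M makes the integrand nonnegative; as the kernel has mass one, M is simply
   subtracted afterwards. The same device recurs for other integrals of signed bounded functions. *)
have -> : (fun zx => \int[k zx.2]_y f (zx, y)) =
          (fun zx => fine (\int[k zx.2]_y (f (zx, y) + M)%:E)%E - M).
  apply/funext => zx.
  rewrite -(EFin_Rint (@prob_kernel _ _ _ _ _ k zx.2)); last exact/bounded_measurableD/bounded_measurable_cst.
  by rewrite RintD ?Rint_cst ?prob_kernel ?addrK//; exact: bounded_measurable_cst.
apply: measurable_funB => //; apply: measurableT_comp => //.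
apply: (measurable_integral_kernel_snd (f := fun z => (f z + M)%:E)).
  by apply/measurable_EFinP; exact: measurable_funD.
by move=> z; rewrite lee_fin -lerBlDr sub0r (le_trans _ (lexx _))// ; have := fM z; rewrite ler_norml => /andP[].
Qed.

End second_projection_kernel.

Section conditioning.
Context d (T : measurableType d) (R : realType) (P : probability T R).
Variable Y : int -> {RV P >-> R}.

Lemma past_measurable : <<s past_events Y >> `<=` d.-measurable.
Proof.
apply: smallest_sub; first exact: sigma_algebra_measurable.
move=> A [i _ [B mB <-]]; exact: (@measurable_funPT _ _ _ _ (Y i)).
Qed.

Lemma past_measurable_fun d' (U : measurableType d') (f : T -> U) :
  measurable_fun (setT : set (pastType Y)) f -> measurable_fun (setT : set T) f.
Proof.
move=> mf _ B mB; have := mf measurableT B mB; rewrite !setTI.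
exact: past_measurable.
Qed.

Lemma measurable_past (k : int) : k <= 0 ->
  measurable_fun (setT : set (pastType Y)) (Y k : T -> R).
Proof.
move=> k0 _ B mB; rewrite setTI; apply: sub_sigma_algebra.
by exists k => //; exists B => //; rewrite setTI.
Qed.

Lemma bounded_past (f : T -> R) : bounded_measurable (f : pastType Y -> R) ->
  bounded_measurable f.
Proof. by move=> [mf bf]; split=> //; exact: past_measurable_fun. Qed.

Variables (i j : nat) (Q : R.-pker (pastType Y) ~> (R * R)%type).
Hypothesis condQ : is_conditional_law i j Q.

Let YY (w : T) : R * R := (Y i%:Z w, Y j%:Z w).

Let mYY : measurable_fun setT YY.
Proof. by apply/measurable_fun_pairP; split; exact: measurable_funPT. Qed.

(** The definition of a conditional law gives the identity for two indicators. It extends in g with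
    A an indicator, then in A with g fixed; in this second extension the bound M keeps the factors
    finite when a product is exchanged with a limit. *)
Lemma cond_integral_ge0 (A : T -> \bar R) (g : R * R -> \bar R) (M : R) :
  measurable_fun (setT : set (pastType Y)) A -> (forall w, 0 <= A w)%E ->
  measurable_fun setT g -> (forall z, 0 <= g z)%E -> (forall z, g z <= M%:E)%E ->
  (\int[P]_w (A w * \int[Q w]_z g z) = \int[P]_w (A w * g (YY w)))%E.
Proof.
move=> mA A0 mg g0 gM.
have mint (g' : R * R -> \bar R) : measurable_fun setT g' -> (forall z, 0 <= g' z)%E ->
    measurable_fun (setT : set T) (fun w => \int[Q w]_z g' z)%E.
  move=> mg' g0'; apply: past_measurable_fun.
  by apply: measurable_fun_integral_kernel => //; exact: measurable_kernel.
have int0 (g' : R * R -> \bar R) : (forall z, 0 <= g' z)%E -> forall w, (0 <= \int[Q w]_z g' z)%E.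
  by move=> g0' w; apply: integral_ge0.
have mgY (g' : R * R -> \bar R) : measurable_fun setT g' -> measurable_fun setT (fun w => g' (YY w)).
  by move=> mg'; exact: measurableT_comp.
pose phi (A : T -> \bar R) g' := (\int[P]_w (A w * \int[Q w]_z g' z) = \int[P]_w (A w * g' (YY w)))%E.
have mA1 B : measurable (B : set (pastType Y)) -> measurable_fun setT (fun w : T => (\1_B w)%:E : \bar R).
  by move=> mB; apply/measurable_EFinP; apply: measurable_indic; exact: past_measurable.
suff H B : measurable (B : set (pastType Y)) -> phi (fun w => (\1_B w)%:E) g.
  apply: (@ge0_measurable_ind _ (pastType Y) R (fun A => phi A g)) => //.
  - move=> k f k0 /past_measurable_fun mf f0; rewrite /phi.
    move=> e; under eq_integral do rewrite -muleA.
    under [RHS]eq_integral do rewrite -muleA.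
    rewrite !ge0_integralZl ?e//; try (by move=> w _; rewrite mule_ge0// int0);
      by apply: emeasurable_funM => //; first [exact: mint|exact: mgY].
  - move=> f1 f2 /past_measurable_fun mf1 f10 /past_measurable_fun mf2 f20; rewrite /phi => e1 e2.
    under eq_integral do rewrite ge0_muleDl//.
    under [RHS]eq_integral do rewrite ge0_muleDl//.
    have mM (h1 h2 : T -> \bar R) : measurable_fun setT h1 -> measurable_fun setT h2 ->
      measurable_fun setT (fun w => h1 w * h2 w)%E by move=> *; exact: emeasurable_funM.
    rewrite !ge0_integralD ?e1 ?e2//; try (by move=> w _; rewrite mule_ge0// int0);
      first [exact: (mM _ _ mf1 (mint _ mg g0))|exact: (mM _ _ mf2 (mint _ mg g0))
            |exact: (mM _ _ mf1 (mgY _ mg))|exact: (mM _ _ mf2 (mgY _ mg))].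
  - move=> f_ mf_ f0_ ndf_ e_; rewrite /phi.
    have {}mf_ n : measurable_fun (setT : set T) (f_ n) by exact: past_measurable_fun (mf_ n).
    have L (h : T -> \bar R) : measurable_fun setT h -> (forall w, 0 <= h w)%E ->
      (forall w, h w <= M%:E)%E ->
      (\int[P]_w (limn (f_ ^~ w) * h w) = limn (fun n => \int[P]_w (f_ n w * h w)))%E.
      move=> mh h0 hM; rewrite -monotone_convergence//.
      + apply: eq_integral => w _; rewrite muleC -limeMl//.
        * by congr (limn _); apply/funext => n; rewrite muleC.
        * by rewrite ge0_fin_numE// (le_lt_trans (hM w))// ltry.
        * by apply: ereal_nondecreasing_is_cvgn; exact: ndf_.
      + by move=> n; exact: emeasurable_funM.
      + by move=> n w _; rewrite mule_ge0.
      + by move=> w _ m n mn; rewrite lee_wpmul2r//; exact: ndf_.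
    have intM w : (\int[Q w]_z g z <= M%:E)%E.
      apply: le_trans (_ : (\int[Q w]_z M%:E <= _)%E); last by rewrite integral_cst// prob_kernel mule1.
      by apply: ge0_le_integral.
    rewrite !L//; [|exact: mgY|exact: mint|exact: int0].
    by congr (limn _); apply/funext => n; exact: e_.
move=> mB; apply: (@ge0_measurable_ind _ _ R (phi (fun w => (\1_B w)%:E))) => //; rewrite /phi.
- move=> C mC; under eq_integral do rewrite integral_indic// setIT.
  have H := condQ mB mC.
  transitivity (\int[P]_(w in B) Q w C)%E.
    rewrite [RHS]integral_mkcond.
    by apply: eq_integral => w _; rewrite patchE indicE; case: ifPn => _; rewrite ?mul1e ?mul0e.
  rewrite H.
  transitivity (\int[P]_w (\1_(B `&` [set w | C (YY w)]) w)%:E)%E; last first.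
    apply: eq_integral => w _; rewrite indicI EFinM; congr (_ * _%:E)%E.
  rewrite integral_indic ?setIT//; apply: measurableI; first exact: past_measurable.
  by rewrite -[X in measurable X]setTI; exact: mYY.
- move=> k f k0 mf f0 IH.
  under eq_integral do rewrite ge0_integralZl_EFin// muleCA.
  under [RHS]eq_integral do rewrite muleCA.
  rewrite !ge0_integralZl//; try (by move=> w _; rewrite mule_ge0// ?int0// lee_fin);
    try (by apply: emeasurable_funM; first [exact: mA1|exact: mint|exact: mgY]).
  by rewrite IH.
- move=> f1 f2 mf1 f10 mf2 f20 e1 e2.
  under eq_integral do rewrite ge0_integralD// ge0_muleDr ?int0//.
  under [RHS]eq_integral do rewrite ge0_muleDr//.
  rewrite !ge0_integralD//; try (by move=> w _; rewrite mule_ge0// ?int0// lee_fin);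
    try (by apply: emeasurable_funM; first [exact: mA1|exact: mint|exact: mgY]).
  by rewrite e1 e2.
- move=> f_ mf_ f0_ ndf_ e_.
  transitivity (limn (fun n => \int[P]_w ((\1_B w)%:E * \int[Q w]_z f_ n z)))%E.
    rewrite -monotone_convergence//.
    + apply: eq_integral => w _; rewrite monotone_convergence//.
      rewrite -limeMl//; apply: ereal_nondecreasing_is_cvgn => m n mn.
      by apply: ge0_le_integral => // z _; exact: ndf_.
    + by move=> n; apply: emeasurable_funM; [exact: mA1|exact: mint].
    + by move=> n w _; rewrite mule_ge0 ?int0// lee_fin.
    + move=> w _ m n mn; rewrite lee_wpmul2l ?lee_fin//.
      by apply: ge0_le_integral => // z _; exact: ndf_.
  transitivity (limn (fun n => \int[P]_w ((\1_B w)%:E * f_ n (YY w))))%E.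
    by congr (limn _); apply/funext => n; exact: e_.
  rewrite -monotone_convergence//.
  + apply: eq_integral => w _; rewrite -limeMl//; apply: ereal_nondecreasing_is_cvgn => m n mn.
    exact: ndf_.
  + by move=> n; apply: emeasurable_funM; [exact: mA1|exact: mgY].
  + by move=> n w _; rewrite mule_ge0 ?lee_fin.
  + by move=> w _ m n mn; rewrite lee_wpmul2l ?lee_fin//; exact: ndf_.
Qed.

Lemma bounded_measurable_cond (g : R * R -> R) : bounded_measurable g ->
  bounded_measurable (fun w : pastType Y => \int[Q w]_z g z).
Proof.
move=> bg; have [mg [M gM]] := bg; split; last first.
  by exists M => w; apply: Rint_bound => //; exact: prob_kernel.
have -> : (fun w : pastType Y => \int[Q w]_z g z) =
          (fun w => fine (\int[Q w]_z (g z + M)%:E)%E - M).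
  apply/funext => w.
  rewrite -(EFin_Rint (@prob_kernel _ _ _ _ _ Q w)); last exact/bounded_measurableD/bounded_measurable_cst.
  by rewrite RintD ?Rint_cst ?prob_kernel ?addrK//; exact: bounded_measurable_cst.
apply: measurable_funB => //; apply: measurableT_comp => //.
apply: measurable_fun_integral_kernel => //; first exact: measurable_kernel.
  by move=> z; rewrite lee_fin; have := gM z; rewrite ler_norml => /andP[]; lra.
by apply/measurable_EFinP; exact: measurable_funD.
Qed.

Lemma cond_Rint (D : T -> R) (g : R * R -> R) :
  bounded_measurable (D : pastType Y -> R) -> bounded_measurable g ->
  \int[P]_w (D w * g (YY w)) = \int[P]_w (D w * \int[Q w]_z g z).
Proof.
move=> bD bg; have [mD [M DM]] := bD; have [mg [N gN]] := bg.
have P1 := probability_setT P.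
have D0 w : 0 <= D w + M by have := DM w; rewrite ler_norml => /andP[]; lra.
have g0 z : 0 <= g z + N by have := gN z; rewrite ler_norml => /andP[]; lra.
have bD' := bounded_past bD.
have bDM : bounded_measurable (fun w => D w + M) by exact/bounded_measurableD/bounded_measurable_cst.
have bgN : bounded_measurable (fun z => g z + N) by exact/bounded_measurableD/bounded_measurable_cst.
have bgY (g' : R * R -> R) : bounded_measurable g' -> bounded_measurable (fun w => g' (YY w)).
  by move=> [mg' [K gK]]; split; [exact: measurableT_comp|exists K].
have bc := bounded_past (bounded_measurable_cond bg).
have bcN := bounded_past (bounded_measurable_cond bgN).
have E (a : R) (D' : T -> R) : bounded_measurable (D' : pastType Y -> R) -> (forall w, 0 <= D' w) ->
    \int[P]_w (D' w * (g (YY w) + N)) = \int[P]_w (D' w * \int[Q w]_z (g z + N)).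
  move=> b' D0'; have b'' := bounded_past b'; apply: EFin_inj.
  rewrite !EFin_Rint//; [|exact: bounded_measurableM|exact: bounded_measurableM b'' (bgY _ bgN)].
  under [RHS]eq_integral do rewrite EFinM (EFin_Rint (@prob_kernel _ _ _ _ _ Q _))//.
  rewrite (@cond_integral_ge0 (fun w => (D' w)%:E) (fun z => (g z + N)%:E) (N + N))//.
  - by apply/measurable_EFinP; case: b'.
  - by apply/measurable_EFinP; case: bgN.
  - by move=> z; rewrite lee_fin lerD2r; have := gN z; rewrite ler_norml => /andP[].
have e1 := E 0 _ (bounded_measurableD bD (bounded_measurable_cst _ M)) D0.
have e2 := E 0 (fun=> 1) (bounded_measurable_cst _ 1) (fun=> ler01).
have qE w : \int[Q w]_z (g z + N) = \int[Q w]_z g z + N.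
  by rewrite RintD ?Rint_cst ?prob_kernel//; exact: bounded_measurable_cst.
(* D h = (D + M)(h + N) - M (h + N) - N D reduces the signed identity to products of nonnegative
   factors, applied with D + M and with the constant 1. *)
have expand (h : T -> R) : bounded_measurable h ->
    \int[P]_w (D w * h w) = \int[P]_w ((D w + M) * (h w + N)) - M * \int[P]_w (1 * (h w + N)) - N * \int[P]_w D w.
  move=> bh; have bhN : bounded_measurable (fun w => h w + N) by exact/bounded_measurableD/bounded_measurable_cst.
  have b1 : bounded_measurable (fun w => 1 * (h w + N)) by exact/bounded_measurableM/bhN/bounded_measurable_cst.
  have b2 := bounded_measurableM bDM bhN.
  have b3 := bounded_measurableM (bounded_measurable_cst _ M) b1.
  have b4 := bounded_measurableM (bounded_measurable_cst _ N) bD'.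
  have b5 := bounded_measurableB b2 b3.
  rewrite -!RintZ// -!RintB//.
  by apply: eq_Rintegral => w _; ring.
rewrite (expand (fun w => g (YY w))); last exact: bgY.
rewrite (expand (fun w => \int[Q w]_z g z))//.
under [X in _ = X - _ - _]eq_Rintegral do rewrite -qE.
under [X in _ = _ - _ * X - _]eq_Rintegral do rewrite -qE.
by rewrite -e1 -e2.
Qed.

End conditioning.

(** * Stationarity and quadrant discrepancies *)

Section equal_laws.
Context d d' (T : measurableType d) (S : measurableType d') (R : realType).
Variables (P : {measure set T -> \bar R}) (X1 X2 : T -> S).
Hypotheses (mX1 : measurable_fun setT X1) (mX2 : measurable_fun setT X2).
Hypothesis eqX : forall B, measurable B -> P (X1 @^-1` B) = P (X2 @^-1` B).

Lemma ge0_integral_eq_law (psi : S -> \bar R) : measurable_fun setT psi ->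
  (forall s, 0 <= psi s)%E -> (\int[P]_w psi (X1 w) = \int[P]_w psi (X2 w))%E.
Proof.
have mX (X : T -> S) (f : S -> \bar R) : measurable_fun setT X -> measurable_fun setT f ->
  measurable_fun setT (fun w => f (X w)) by move=> *; exact: measurableT_comp.
move: psi; apply: ge0_measurable_ind.
- move=> B mB; have H (X : T -> S) : measurable_fun setT X -> (\int[P]_w (\1_B (X w))%:E = P (X @^-1` B))%E.
    move=> mX'; have mXB : measurable (X @^-1` B) by rewrite -[X in measurable X]setTI; exact: mX'.
    by rewrite -[in RHS](setIT (X @^-1` B)) -integral_indic.
  by rewrite !H// eqX.
- move=> k f k0 mf f0 e; rewrite !ge0_integralZl_EFin ?e//; exact: mX.
- move=> f g mf f0 mg g0 e1 e2; rewrite !ge0_integralD ?e1 ?e2//; exact: mX.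
- move=> f_ mf_ f0_ ndf_ e_.
  rewrite !monotone_convergence//; try (by move=> n; exact: mX); try (by move=> w _; exact: ndf_).
  by congr (limn _); apply/funext => n; exact: e_.
Qed.

Lemma Rint_eq_law (psi : S -> R) : P setT = 1%E -> bounded_measurable psi ->
  \int[P]_w psi (X1 w) = \int[P]_w psi (X2 w).
Proof.
move=> P1 [mpsi [M psiM]].
have bX (X : T -> S) : measurable_fun setT X -> bounded_measurable (fun w => psi (X w)).
  by move=> mX; split; [exact: measurableT_comp|exists M].
have H (X : T -> S) : measurable_fun setT X ->
    \int[P]_w psi (X w) = fine (\int[P]_w (psi (X w) + M)%:E)%E - M.
  move=> mX; rewrite -(EFin_Rint P1); last exact/bounded_measurableD/bounded_measurable_cst/bX.
  by rewrite RintD ?Rint_cst ?addrK//; [exact: bX|exact: bounded_measurable_cst].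
rewrite !H//; congr (fine _ - _).
apply: (ge0_integral_eq_law (psi := fun s => (psi s + M)%:E)).
  by apply/measurable_EFinP; exact: measurable_funD.
by move=> s; rewrite lee_fin; have := psiM s; rewrite ler_norml => /andP[]; lra.
Qed.

End equal_laws.

Section stationary_sums.
Context d (T : measurableType d) (R : realType) (P : probability T R).
Variable Y : int -> {RV P >-> R}.
Hypothesis statY : stationary Y.
Variable z : R -> R.
Hypothesis mz : measurable_fun setT z.

(** Everything that must be shifted is a function of one partial sum and two more variables. This
    triple is a measurable image of the vector indexed by i, j and s, so stationarity of finite
    vectors carries over to it. *)
Let V (s : seq int) (i j m : int) (w : T) : R * R * R :=
  (\sum_(k <- s) z (Y (k + m) w), Y (i + m) w, Y (j + m) w).

Let mV s i j m : measurable_fun setT (V s i j m).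
Proof.
apply/measurable_fun_pairP; split; last exact: measurable_funPT.
apply/measurable_fun_pairP; split; last exact: measurable_funPT.
by apply: measurable_sum => k; exact: measurableT_comp.
Qed.

Let lawV s i j m (B : set (R * R * R)) : measurable B ->
  P (V s i j m @^-1` B) = P (V s i j 0 @^-1` B).
Proof.
move=> mB; pose n := (size s).+2; pose t : n.-tuple int := in_tuple [:: i, j & s].
pose Psi (v : n.-tuple R) : R * R * R :=
  (\sum_(l < size s) z (tnth v (lift ord0 (lift ord0 l))), tnth v ord0, tnth v (lift ord0 ord0)).
have mPsi : measurable_fun setT Psi.
  apply/measurable_fun_pairP; split; last exact: measurable_tnth.
  apply/measurable_fun_pairP; split; last exact: measurable_tnth.
  by apply: measurable_sum => k; apply: measurableT_comp => //; exact: measurable_tnth.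
have VE m' w : V s i j m' w = Psi [tuple Y (tnth t l + m') w | l < n].
  rewrite /V /Psi !tnth_mktuple; congr (_, _, _).
  rewrite (big_nth 0) big_mkord; apply: eq_bigr => l _.
  by rewrite tnth_mktuple (tnth_nth 0).
have mB' : measurable (Psi @^-1` B) by rewrite -[X in measurable X]setTI; exact: mPsi.
have := statY t m mB'; rewrite -(statY t 0 mB').
rewrite [X in P X = _](_ : _ = V s i j m @^-1` B); last first.
  by apply/seteqP; split => w /=; rewrite VE.
move=> ->; congr (P _).
by apply/seteqP; split => w /=; rewrite VE.
Qed.

Lemma ge0_integral_stationary (s : seq int) (i j m : int) (psi : R * R * R -> \bar R) :
  measurable_fun setT psi -> (forall v, 0 <= psi v)%E ->
  (\int[P]_w psi ((\sum_(k <- s) z (Y (k + m) w))%R, Y (i + m) w, Y (j + m) w) =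
   \int[P]_w psi ((\sum_(k <- s) z (Y k w))%R, Y i w, Y j w))%E.
Proof.
move=> mpsi psi0; rewrite (ge0_integral_eq_law (mV s i j m) (mV s i j 0) (lawV s i j m) mpsi psi0).
apply: eq_integral => w _; rewrite /V !addr0; congr (psi (_, _, _)).
by apply: eq_bigr => k _; rewrite addr0.
Qed.

Lemma Rint_stationary (s : seq int) (i j m : int) (psi : R * R * R -> R) :
  bounded_measurable psi ->
  \int[P]_w psi ((\sum_(k <- s) z (Y (k + m) w))%R, Y (i + m) w, Y (j + m) w) =
  \int[P]_w psi ((\sum_(k <- s) z (Y k w))%R, Y i w, Y j w).
Proof.
move=> bpsi; rewrite (Rint_eq_law (mV s i j m) (mV s i j 0) (lawV s i j m) (probability_setT P) bpsi).
apply: eq_Rintegral => w _; rewrite /V !addr0; congr (psi (_, _, _)).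
by apply: eq_bigr => k _; rewrite addr0.
Qed.

End stationary_sums.

Section quadrant_discrepancy.
Context (R : realType).
Implicit Types m : {measure set (R * R) -> \bar R}.

Definition quadrant (s t : R) : set (R * R) := [set z | z.1 <= s /\ z.2 <= t].

Lemma measurable_quadrant s t : measurable (quadrant s t).
Proof.
rewrite (_ : quadrant s t = `]-oo, s]%classic `*` `]-oo, t]%classic).
  exact: measurableX.
by apply/seteqP; split => z /=; rewrite !in_itv.
Qed.

Definition quadrant_close m1 m2 (b : R) := forall s t : R,
  `|fine (m1 (quadrant s t)) - fine (m2 (quadrant s t))| <= b.

Lemma fin_prob d (T : measurableType d) (m : {measure set T -> \bar R}) (A : set T) :
  m setT = 1%E -> measurable A -> m A \is a fin_num.
Proof.
move=> m1 mA; rewrite ge0_fin_numE//; apply: le_lt_trans (ltry 1).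
by rewrite -m1; apply: le_measure; rewrite ?inE.
Qed.

Lemma limit_close d (T : measurableType d) (m1 m2 : {measure set T -> \bar R}) (b : R)
    (F : nat -> set T) :
  m1 setT = 1%E -> m2 setT = 1%E -> (forall n, measurable (F n)) ->
  {homo F : n p / (n <= p)%N >-> n `<=` p} ->
  (forall n, `|fine (m1 (F n)) - fine (m2 (F n))| <= b) ->
  `|fine (m1 (\bigcup_n F n)) - fine (m2 (\bigcup_n F n))| <= b.
Proof.
move=> m11 m21 mF ndF Fb.
have mU : measurable (\bigcup_n F n) by apply: bigcup_measurable => n _.
have cv (m : {measure set T -> \bar R}) : m setT = 1%E ->
    fine (m (F n)) @[n --> \oo] --> fine (m (\bigcup_n F n)).
  move=> m1'; apply: fine_cvg; rewrite fineK ?fin_prob//.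
  apply: nondecreasing_cvg_mu => //.
  by move=> a c ac; apply/subsetPset; exact: ndF.
apply: cvgr_to_le (cvg_norm (cvgB (cv _ m11) (cv _ m21))) _.
by near=> n; exact: Fb.
Unshelve. all: end_near. Qed.

(** Let the second threshold tend to infinity: the coefficient of a pair also controls each of its
    marginals. *)
Lemma quadrant_close_fst m1 m2 (b s : R) : m1 setT = 1%E -> m2 setT = 1%E ->
  quadrant_close m1 m2 b ->
  `|fine (m1 [set z | z.1 <= s]) - fine (m2 [set z | z.1 <= s])| <= b.
Proof.
move=> m11 m21 cl; rewrite (_ : [set z : R * R | z.1 <= s] = \bigcup_n quadrant s n%:R).
  apply: limit_close => // [n|p n pn z [zs zt]]; first exact: measurable_quadrant.
  by split=> //; rewrite (le_trans zt)// ler_nat.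
apply/seteqP; split => z /=; last by move=> [n _ []].
move=> zs; exists (Num.truncn `|z.2|).+1 => //; split => //=.
by rewrite (le_trans (ler_norm _))// ltW// truncnS_gt.
Qed.

Lemma quadrant_close_snd m1 m2 (b t : R) : m1 setT = 1%E -> m2 setT = 1%E ->
  quadrant_close m1 m2 b ->
  `|fine (m1 [set z | z.2 <= t]) - fine (m2 [set z | z.2 <= t])| <= b.
Proof.
move=> m11 m21 cl; rewrite (_ : [set z : R * R | z.2 <= t] = \bigcup_n quadrant n%:R t).
  apply: limit_close => // [n|p n pn z [zs zt]]; first exact: measurable_quadrant.
  by split=> //; rewrite (le_trans zs)// ler_nat.
apply/seteqP; split => z /=; last by move=> [n _ []].
move=> zs; exists (Num.truncn `|z.1|).+1 => //; split => //=.
by rewrite (le_trans (ler_norm _))// ltW// truncnS_gt.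
Qed.

Lemma quadrant_right_continuous m (s t e : R) : m setT = 1%E -> 0 < e ->
  exists2 d : R, 0 < d & forall s' t', s <= s' <= s + d -> t <= t' <= t + d ->
    `|fine (m (quadrant s' t')) - fine (m (quadrant s t))| < e.
Proof.
move=> m1 e0; pose F (n : nat) := quadrant (s + n.+1%:R^-1) (t + n.+1%:R^-1).
have mF n : measurable (F n) by exact: measurable_quadrant.
have FE : \bigcap_n F n = quadrant s t.
  apply/seteqP; split => z /=.
    move=> Fz; split; apply/ler_addgt0Pr => d d0.
      have [n _ nd] := @near_infty_natSinv_lt R (PosNum d0).
      have [+ _] := Fz n I; move/le_trans; apply.
      by rewrite lerD2l ltW//; apply: nd => /=.
    have [n _ nd] := @near_infty_natSinv_lt R (PosNum d0).
    have [_ +] := Fz n I; move/le_trans; apply.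
    by rewrite lerD2l ltW//; apply: nd => /=.
  by move=> [zs zt] n _; split; rewrite (le_trans zs, le_trans zt)// lerDl.
have : fine (m (F n)) @[n --> \oo] --> fine (m (\bigcap_n F n)).
  have mq : measurable (\bigcap_n F n) by rewrite FE; exact: measurable_quadrant.
  apply: fine_cvg; rewrite fineK ?fin_prob//.
  apply: nonincreasing_cvg_mu => //.
    by rewrite -ge0_fin_numE// fin_prob.
  move=> a c ac; apply/subsetPset => z [zs zt]; split;
    rewrite (le_trans zs, le_trans zt)// lerD2l lef_pV2 ?posrE// ler_nat//.
rewrite FE => /cvgrPdist_lt/(_ _ e0)[n _ Hn].
exists n.+1%:R^-1 => // s' t' /andP[ss ss'] /andP[tt tt'].
have sub1 : quadrant s t `<=` quadrant s' t'.
  by move=> z [zs zt]; split; [exact: le_trans zs ss|exact: le_trans zt tt].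
have sub2 : quadrant s' t' `<=` F n.
  by move=> z [zs zt]; split; [exact: le_trans zs ss'|exact: le_trans zt tt'].
have le1 : fine (m (quadrant s t)) <= fine (m (quadrant s' t')).
  apply: fine_le; rewrite ?fin_prob//; try exact: measurable_quadrant.
  by apply: le_measure; rewrite ?inE//; exact: measurable_quadrant.
have le2 : fine (m (quadrant s' t')) <= fine (m (F n)).
  apply: fine_le; rewrite ?fin_prob//; try exact: measurable_quadrant.
  by apply: le_measure; rewrite ?inE//; exact: measurable_quadrant.
have := Hn n (leqnn n); rewrite distrC ger0_norm; last by rewrite subr_ge0 (le_trans le1).
rewrite ger0_norm ?subr_ge0//; apply: le_lt_trans; rewrite lerB//.
Qed.

(** Distribution functions are right-continuous in both thresholds jointly, so rational thresholds
    suffice. This makes the supremum in [b_coef] countable, hence measurable. *)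
Lemma quadrant_close_rat m1 m2 (b : R) : m1 setT = 1%E -> m2 setT = 1%E ->
  (forall q r : rat, `|fine (m1 (quadrant (ratr q) (ratr r))) - fine (m2 (quadrant (ratr q) (ratr r)))| <= b) ->
  quadrant_close m1 m2 b.
Proof.
move=> m11 m21 H s t; apply/ler_addgt0Pr => e e0.
have e20 : 0 < e / 2 by rewrite divr_gt0.
have [d1 d10 H1] := quadrant_right_continuous s t m11 e20.
have [d2 d20 H2] := quadrant_right_continuous s t m21 e20.
pose d := Num.min d1 d2; have d0 : 0 < d by rewrite lt_min d10.
have [q] := @rat_in_itvoo R s (s + d) ltac:(by rewrite ltrDl).
have [r] := @rat_in_itvoo R t (t + d) ltac:(by rewrite ltrDl).
rewrite !in_itv/= => /andP[/ltW r1 /ltW r2] /andP[/ltW q1 /ltW q2].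
have [dd1 dd2] : d <= d1 /\ d <= d2 by rewrite /d !ge_min !lexx orbT.
have {}H1 := H1 (ratr q) (ratr r) ltac:(by rewrite q1 (le_trans q2)// lerD2l) ltac:(by rewrite r1 (le_trans r2)// lerD2l).
have {}H2 := H2 (ratr q) (ratr r) ltac:(by rewrite q1 (le_trans q2)// lerD2l) ltac:(by rewrite r1 (le_trans r2)// lerD2l).
have := H q r; move: H1 H2; rewrite !ltr_norml !ler_norml => /andP[? ?] /andP[? ?] /andP[? ?].
by apply/andP; split; lra.
Qed.

End quadrant_discrepancy.

Section pair_law.
Context d (T : measurableType d) (R : realType) (P : probability T R).
Variable Y : int -> {RV P >-> R}.
Variables i j : nat.

Definition pair_map (w : T) : R * R := (Y i%:Z w, Y j%:Z w).

Lemma measurable_pair_map : measurable_fun setT pair_map.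
Proof. by apply/measurable_fun_pairP; split; exact: measurable_funPT. Qed.

HB.instance Definition _ := @isMeasurableFun.Build _ _ _ _ pair_map measurable_pair_map.

Definition pair_law : probability (R * R)%type R := distribution P pair_map.

Lemma pair_law_setT : pair_law setT = 1%E.
Proof. exact: probability_setT. Qed.

Lemma bounded_pair_map (g : R * R -> R) : bounded_measurable g ->
  bounded_measurable (fun w => g (pair_map w)).
Proof.
move=> [mg [M gM]]; split; last by exists M.
by apply: measurableT_comp => //; exact: measurable_pair_map.
Qed.

Lemma Rint_pair_law (g : R * R -> R) : bounded_measurable g ->
  \int[pair_law]_z g z = \int[P]_w g (pair_map w).
Proof.
move=> bg; have [mg _] := bg.
rewrite /Rintegral; congr fine.
rewrite (integral_pushforward measurable_pair_map)//.
- exact/measurable_EFinP.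
- rewrite preimage_setT; apply: bounded_measurable_integrable; first exact: probability_setT.
  exact: bounded_pair_map.
Qed.

End pair_law.

Section dependence_coefficient.
Context d (T : measurableType d) (R : realType) (P : probability T R).
Variable Y : int -> {RV P >-> R}.
Variable Q : nat -> nat -> R.-pker (pastType Y) ~> (R * R)%type.
Variables i j : nat.

Definition bcoef (w : T) : R := fine (b_coef Q i j w).

Let dist (w : T) (s t : R) : \bar R :=
  `|Q i j w (quadrant s t) - pair_law Y i j (quadrant s t)|%E.

Let finQ w s t : Q i j w (quadrant s t) \is a fin_num.
Proof. by apply: fin_prob; [exact: prob_kernel|exact: measurable_quadrant]. Qed.

Let finP s t : pair_law Y i j (quadrant s t) \is a fin_num.
Proof. by apply: fin_prob; [exact: pair_law_setT|exact: measurable_quadrant]. Qed.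

Let distE w s t : dist w s t =
  (`|fine (Q i j w (quadrant s t)) - fine (pair_law Y i j (quadrant s t))|)%:E.
Proof. by rewrite /dist -(fineK (finQ w s t)) -(fineK (finP s t)). Qed.

Let b_coefE w : b_coef Q i j w = ereal_sup [set dist w st.2 st.1 | st in [set: R * R]].
Proof. by []. Qed.

Let dist_le1 w s t : (dist w s t <= 1)%E.
Proof.
have H (m : {measure set (R * R) -> \bar R}) : m setT = 1%E -> 0 <= fine (m (quadrant s t)) <= 1.
  move=> m1; rewrite fine_ge0//= -lee_fin fineK; last by apply: fin_prob => //; exact: measurable_quadrant.
  by rewrite -m1; apply: le_measure; rewrite ?inE//; exact: measurable_quadrant.
have /andP[? ?] := H _ (@prob_kernel _ _ _ _ _ (Q i j) w).
have /andP[? ?] := H _ (pair_law_setT Y i j).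
by rewrite distE lee_fin ler_norml; apply/andP; split; lra.
Qed.

Let b_coef_ge0 w : (0 <= b_coef Q i j w)%E.
Proof.
rewrite b_coefE; apply: le_trans (_ : dist w 0 0 <= _)%E; first by rewrite distE lee_fin.
by apply: ereal_sup_ubound; exists (0, 0).
Qed.

Let b_coef_le1 w : (b_coef Q i j w <= 1)%E.
Proof. by rewrite b_coefE; apply: ge_ereal_sup => _ [st _ <-]. Qed.

Lemma bcoefE w : (bcoef w)%:E = b_coef Q i j w.
Proof. by rewrite /bcoef fineK// ge0_fin_numE// (le_lt_trans (b_coef_le1 w))// ltry. Qed.

Lemma bcoef_ge0 w : 0 <= bcoef w.
Proof. by rewrite -lee_fin bcoefE. Qed.

Lemma bcoef_le1 w : bcoef w <= 1.
Proof. by rewrite -lee_fin bcoefE. Qed.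

Lemma quadrant_close_bcoef w : quadrant_close (Q i j w) (pair_law Y i j) (bcoef w).
Proof.
move=> s t; rewrite -lee_fin bcoefE -distE b_coefE.
(* In [b_coef] the second component of the index bounds the first variable, hence the swap. *)
by apply: ereal_sup_ubound; exists (t, s).
Qed.

Lemma bounded_bcoef : bounded_measurable (bcoef : pastType Y -> R).
Proof.
split; last by exists 1 => w; rewrite ger0_norm ?bcoef_ge0 ?bcoef_le1.
(* An enumeration of the pairs of rationals. The default 0 at integers that encode no pair leaves
   the supremum unchanged, as the distances are nonnegative. *)
pose F (n : nat) (w : T) : \bar R := if (unpickle n : option (rat * rat)) is Some qr
  then dist w (ratr qr.1) (ratr qr.2) else 0%E.
have FE w : b_coef Q i j w = esups (F ^~ w) 0%N.
  apply/eqP; rewrite eq_le; apply/andP; split; last first.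
    apply: ge_ereal_sup => _ [n _ <-]; rewrite /F.
    case: unpickle => [[q r]|//]; rewrite b_coefE; apply: ereal_sup_ubound.
    by exists (ratr r, ratr q).
  have e0 : (0 <= esups (F ^~ w) 0%N)%E.
    apply: le_trans (_ : F 0%N w <= _)%E; last by apply: ereal_sup_ubound; exists 0%N.
    by rewrite /F; case: unpickle => [[q r]|//]; rewrite distE lee_fin.
  have e1 : (esups (F ^~ w) 0%N <= 1)%E.
    by apply: ge_ereal_sup => _ [n _ <-]; rewrite /F; case: unpickle => [[q r]|]; rewrite ?dist_le1.
  rewrite b_coefE; apply: ge_ereal_sup => _ [[t s] _ <-] /=; rewrite distE.
  rewrite -(@fineK _ (esups _ _)) ?lee_fin; last by rewrite ge0_fin_numE// (le_lt_trans e1)// ltry.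
  apply: quadrant_close_rat; [exact: prob_kernel|exact: pair_law_setT|move=> q r].
  rewrite -lee_fin fineK; last by rewrite ge0_fin_numE// (le_lt_trans e1)// ltry.
  rewrite -distE; apply: ereal_sup_ubound; exists (pickle (q, r)) => //.
  by rewrite /F pickleK.
apply: measurableT_comp => //; rewrite (_ : b_coef Q i j = fun w => esups (F ^~ w) 0%N); last exact/funext.
apply: (@measurable_fun_esups _ (pastType Y)) => n; rewrite /F.
case: unpickle => [[q r]|]; last exact: measurable_cst.
apply: measurableT_comp => //; apply: emeasurable_funB => //.
by apply: measurable_kernel; exact: measurable_quadrant.
Qed.

Lemma Rint_bcoef_le (k : nat) (b : R) : (k <= j <= i)%N -> (beta2 Q k <= b%:E)%E ->
  \int[P]_w bcoef w <= b.
Proof.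
move=> kij kb; rewrite -lee_fin (EFin_Rint (probability_setT P)); last exact/bounded_past/bounded_bcoef.
apply: le_trans kb; under eq_integral do rewrite bcoefE.
by apply: ereal_sup_ubound; exists (i, j).
Qed.

End dependence_coefficient.

(** * From quadrants to functions of bounded variation *)

Section probability_of_mass_one.
Context d (T : measurableType d) (R : realType) (m : {measure set T -> \bar R}).

(** Repackages a measure of mass one, such as [Q i j w], so that results on probabilities, Tonelli's
    theorem in particular, apply to it. *)
Definition probability_of (m1 : m setT = 1%E) : set T -> \bar R := m.

HB.instance Definition _ m1 := isMeasure.Build _ _ _ (probability_of m1)
  (measure0 m) (measure_ge0 m) (@measure_semi_sigma_additive _ _ _ m).

HB.instance Definition _ m1 := Measure_isProbability.Build _ _ _ (probability_of m1) m1.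

End probability_of_mass_one.

Section section_discrepancy.
Context d d' (Z : measurableType d) (W : measurableType d') (R : realType).

Let int_section (m : {measure set Z -> \bar R}) (kap : {finite_measure set W -> \bar R})
    (E : set (Z * W)) : m setT = 1%E -> measurable E ->
  [/\ \int[m]_z fine (kap (xsection E z)) = \int[kap]_v fine (m (ysection E v)),
      measurable_fun setT (fun z => fine (kap (xsection E z))) &
      kap.-integrable setT (EFin \o (fun v => fine (m (ysection E v))))].
Proof.
move=> m1 mE.
pose pm : probability Z R := probability_of m1.
have mG : measurable_fun setT (fun v => m (ysection E v)).
  exact: (@measurable_fun_ysection _ _ _ _ _ pm).
have mF : measurable_fun setT (fun z => kap (xsection E z)) by exact: measurable_fun_xsection.
split; last 2 first.
- exact: measurableT_comp.
- apply: measurable_bounded_integrable => //.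
  + by rewrite -ge0_fin_numE ?fin_num_measure.
  + exact: measurableT_comp.
  + exists 1; split; first exact: num_real.
    move=> K K1 v _ /=; rewrite ger0_norm ?fine_ge0// (le_trans _ (ltW K1))// -lee_fin fineK; last first.
      by apply: fin_prob => //; exact: measurable_ysection.
    by rewrite -m1; apply: le_measure; rewrite ?inE//; exact: measurable_ysection.
have := @indic_fubini_tonelli _ _ _ _ _ pm kap E mE.
under eq_integral do rewrite indic_fubini_tonelli_FE//.
under [X in _ = X -> _]eq_integral do rewrite indic_fubini_tonelli_GE//.
move=> H; rewrite /Rintegral; congr fine.
transitivity (\int[pm]_x (kap \o xsection E) x)%E.
  by apply: eq_integral => z _; rewrite /= fineK// fin_num_measure//; exact: measurable_xsection.
rewrite [LHS]H; apply: eq_integral => v _; rewrite /= fineK//.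
by apply: fin_prob => //; exact: measurable_ysection.
Qed.

(** Tonelli exchanges the integral of kap(E_z) in z for the integral over kap of m(E^v). A
    discrepancy uniform over the sections E^v thus costs only the mass of kap. Here kap will be a
    Jordan part of dK or a product of two of them, with sections that are half-planes or
    quadrants. *)
Lemma section_discrepancy (m1 m2 : {measure set Z -> \bar R})
    (kap : {finite_measure set W -> \bar R}) (E : set (Z * W)) (b : R) :
  m1 setT = 1%E -> m2 setT = 1%E -> measurable E ->
  (forall v, `|fine (m1 (ysection E v)) - fine (m2 (ysection E v))| <= b) ->
  `|\int[m1]_z fine (kap (xsection E z)) - \int[m2]_z fine (kap (xsection E z))|
    <= b * fine (kap setT).
Proof.
move=> m11 m21 mE H.
have [-> _ i1] := int_section kap m11 mE.
have [-> _ i2] := int_section kap m21 mE.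
have iB : kap.-integrable setT (EFin \o (fun v => fine (m1 (ysection E v)) - fine (m2 (ysection E v)))).
  by apply: eq_integrable (integrableB measurableT i1 i2) => // t _.
rewrite -RintegralB//; apply: le_trans (le_normr_Rintegral _ iB) _ => //.
rewrite -Rintegral_cst//; apply: le_Rintegral => //.
- exact: integrable_norm.
- exact: finite_measure_integrable_cst.
Qed.

End section_discrepancy.

Section finite_product.
Context d d' (T1 : measurableType d) (T2 : measurableType d') (R : realType).
Variables (n1 : {finite_measure set T1 -> \bar R}) (n2 : {finite_measure set T2 -> \bar R}).

Definition finite_product : set (T1 * T2) -> \bar R := (n1 \x n2)%E.

HB.instance Definition _ := Measure.on finite_product.

Lemma finite_productE A B : measurable A -> measurable B ->
  finite_product (A `*` B) = (n1 A * n2 B)%E.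
Proof. by move=> mA mB; rewrite /finite_product product_measure1E. Qed.

Let finite_product_fin : fin_num_fun finite_product.
Proof.
move=> A mA; rewrite ge0_fin_numE//; apply: le_lt_trans (_ : finite_product setT < +oo)%E.
  by apply: le_measure; rewrite ?inE.
by rewrite -setXTT finite_productE// -ge0_fin_numE ?mule_ge0// fin_numM// fin_num_measure.
Qed.

HB.instance Definition _ := @Measure_isFinite.Build _ _ _ finite_product finite_product_fin.

End finite_product.

Section bounded_variation_discrepancy.
Context (R : realType).
Local Notation mR := (measurableTypeR R).
Variables (x h b : R).
Hypothesis h0 : 0 < h.
Variables m1 m2 : {measure set (R * R) -> \bar R}.
Hypotheses (m11 : m1 setT = 1%E) (m21 : m2 setT = 1%E).
Hypothesis m12 : quadrant_close m1 m2 b.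

Let cdf (n : {finite_measure set mR -> \bar R}) (y : R) : R :=
  fine (n `]-oo, h^-1 * (x - y)]%classic).

(** Exchanges the roles of y and v: seen from the measure side, the half-line in v becomes a
    half-line in y, as the sections require. *)
Let argE (y v : R) : (v <= h^-1 * (x - y)) = (y <= x - h * v).
Proof. by rewrite ler_pdivlMl// !lerBrDr addrC. Qed.

Let bounded_cdf n : bounded_measurable (cdf n).
Proof.
split; last first.
  exists (fine (n setT)) => y; rewrite ger0_norm ?fine_ge0//; apply: fine_le; rewrite ?fin_num_measure//.
  by apply: le_measure; rewrite ?inE.
apply: (measurableT_comp (measurable_cdf n)).
by apply: measurable_funM => //; exact: measurable_funB.
Qed.

Let bounded_fst (g : R -> R) : bounded_measurable g -> bounded_measurable (fun z : R * R => g z.1).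
Proof. by move=> [mg [M gM]]; split; [exact: measurableT_comp|exists M]. Qed.

Let bounded_snd (g : R -> R) : bounded_measurable g -> bounded_measurable (fun z : R * R => g z.2).
Proof. by move=> [mg [M gM]]; split; [exact: measurableT_comp|exists M]. Qed.

Let mE1 : measurable [set p : (R * R) * mR | p.1.1 <= x - h * p.2].
Proof.
rewrite (_ : mkset _ = setT `&` (fun p : (R * R) * mR => p.1.1 + h * p.2) @^-1` `]-oo, x]%classic); last first.
  by apply/seteqP; split => p /=; rewrite in_itv/= lerBrDr => // -[].
have : measurable_fun setT (fun p : (R * R) * mR => p.1.1 + h * p.2).
  apply: measurable_funD; first exact: measurableT_comp measurable_fst measurable_fst.
  by apply: measurable_funM => //; exact: measurable_snd.
by apply.
Qed.

Let mE2 : measurable [set p : (R * R) * mR | p.1.2 <= x - h * p.2].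
Proof.
rewrite (_ : mkset _ = setT `&` (fun p : (R * R) * mR => p.1.2 + h * p.2) @^-1` `]-oo, x]%classic); last first.
  by apply/seteqP; split => p /=; rewrite in_itv/= lerBrDr => // -[].
have : measurable_fun setT (fun p : (R * R) * mR => p.1.2 + h * p.2).
  apply: measurable_funD; first exact: measurableT_comp measurable_snd measurable_fst.
  by apply: measurable_funM => //; exact: measurable_snd.
by apply.
Qed.

Let disc_fst n : `|\int[m1]_z cdf n z.1 - \int[m2]_z cdf n z.1| <= b * fine (n setT).
Proof.
have := @section_discrepancy _ _ _ _ _ m1 m2 n _ b m11 m21 mE1.
have H (z : R * R) : fine (n (xsection [set p : (R * R) * mR | p.1.1 <= x - h * p.2] z)) = cdf n z.1.
  by congr (fine (n _)); apply/seteqP; split => v; rewrite /xsection/= inE/= in_itv/= argE.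
under eq_Rintegral do rewrite H.
under [X in `|_ - X|]eq_Rintegral do rewrite H.
apply=> v; rewrite (_ : ysection _ _ = [set z | z.1 <= x - h * v]); first exact: quadrant_close_fst.
by apply/seteqP; split => z; rewrite /ysection/= inE.
Qed.

Let disc_snd n : `|\int[m1]_z cdf n z.2 - \int[m2]_z cdf n z.2| <= b * fine (n setT).
Proof.
have := @section_discrepancy _ _ _ _ _ m1 m2 n _ b m11 m21 mE2.
have H (z : R * R) : fine (n (xsection [set p : (R * R) * mR | p.1.2 <= x - h * p.2] z)) = cdf n z.2.
  by congr (fine (n _)); apply/seteqP; split => v; rewrite /xsection/= inE/= in_itv/= argE.
under eq_Rintegral do rewrite H.
under [X in `|_ - X|]eq_Rintegral do rewrite H.
apply=> v; rewrite (_ : ysection _ _ = [set z | z.2 <= x - h * v]); first exact: quadrant_close_snd.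
by apply/seteqP; split => z; rewrite /ysection/= inE.
Qed.

(** A product of two distribution functions is the mass of a rectangle for the product measure, and
    the sections in the other direction are exactly the quadrants of the dependence coefficient. *)
Let disc_pair n n' :
  `|\int[m1]_z (cdf n z.1 * cdf n' z.2) - \int[m2]_z (cdf n z.1 * cdf n' z.2)|
    <= b * (fine (n setT) * fine (n' setT)).
Proof.
pose E := [set p : (R * R) * (mR * mR) | p.1.1 <= x - h * p.2.1 /\ p.1.2 <= x - h * p.2.2].
have mE : measurable E.
  have -> : E = ((fun p : (R * R) * (mR * mR) => (p.1, p.2.1)) @^-1` [set p : (R * R) * mR | p.1.1 <= x - h * p.2]) `&`
     ((fun p : (R * R) * (mR * mR) => (p.1, p.2.2)) @^-1` [set p : (R * R) * mR | p.1.2 <= x - h * p.2]) by [].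
  apply: measurableI.
    have H : measurable_fun setT (fun p : (R * R) * (mR * mR) => (p.1, p.2.1)).
      by apply/measurable_fun_pairP; split; [exact: measurable_fst|exact: (measurableT_comp measurable_fst measurable_snd)].
    by have := H measurableT _ mE1; rewrite setTI.
  have H : measurable_fun setT (fun p : (R * R) * (mR * mR) => (p.1, p.2.2)).
    by apply/measurable_fun_pairP; split; [exact: measurable_fst|exact: (measurableT_comp measurable_snd measurable_snd)].
  by have := H measurableT _ mE2; rewrite setTI.
have := @section_discrepancy _ _ _ _ _ m1 m2 (finite_product n n') _ b m11 m21 mE.
have H (z : R * R) : fine (finite_product n n' (xsection E z)) = cdf n z.1 * cdf n' z.2.
  rewrite (_ : xsection E z = `]-oo, h^-1 * (x - z.1)]%classic `*` `]-oo, h^-1 * (x - z.2)]%classic).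
    by rewrite finite_productE// fineM// fin_num_measure.
  by apply/seteqP; split => v; rewrite /xsection/= inE/= !in_itv/= !argE.
under eq_Rintegral do rewrite H.
under [X in `|_ - X|]eq_Rintegral do rewrite H.
rewrite -[in X in _ -> _ <= X]fineM ?fin_num_measure// -finite_productE// setXTT.
apply=> v; rewrite (_ : ysection _ _ = quadrant (x - h * v.1) (x - h * v.2)); first exact: m12.
by apply/seteqP; split => z; rewrite /ysection/= inE.
Qed.

Variables n1 n2 : {finite_measure set mR -> \bar R}.
Let V := fine (n1 setT) + fine (n2 setT).
Let phi (y : R) : R := cdf_diff n1 n2 (h^-1 * (x - y)).

Let phiE y : phi y = cdf n1 y - cdf n2 y. Proof. by []. Qed.

Let b0 : 0 <= b. Proof. by apply: le_trans (m12 0 0). Qed.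

Let bm_phi : bounded_measurable phi. Proof. exact: bounded_measurableB (bounded_cdf n1) (bounded_cdf n2). Qed.

Let disc_phi_fst : `|\int[m1]_z phi z.1 - \int[m2]_z phi z.1| <= b * V.
Proof.
have H (m : {measure set (R * R) -> \bar R}) : m setT = 1%E ->
    \int[m]_z phi z.1 = \int[m]_z cdf n1 z.1 - \int[m]_z cdf n2 z.1.
  by move=> m_1; rewrite -RintB//; exact: bounded_fst.
rewrite !H//; have := disc_fst n1; have := disc_fst n2.
rewrite /V !ler_norml => /andP[? ?] /andP[? ?]; apply/andP; split; lra.
Qed.

Let disc_phi_snd : `|\int[m1]_z phi z.2 - \int[m2]_z phi z.2| <= b * V.
Proof.
have H (m : {measure set (R * R) -> \bar R}) : m setT = 1%E ->
    \int[m]_z phi z.2 = \int[m]_z cdf n1 z.2 - \int[m]_z cdf n2 z.2.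
  by move=> m_1; rewrite -RintB//; exact: bounded_snd.
rewrite !H//; have := disc_snd n1; have := disc_snd n2.
rewrite /V !ler_norml => /andP[? ?] /andP[? ?]; apply/andP; split; lra.
Qed.

Let disc_phi_pair : `|\int[m1]_z (phi z.1 * phi z.2) - \int[m2]_z (phi z.1 * phi z.2)| <= b * V ^+ 2.
Proof.
pose c n n' (z : R * R) := cdf n z.1 * cdf n' z.2.
have bc n n' : bounded_measurable (c n n').
  by apply: bounded_measurableM; [exact: bounded_fst|exact: bounded_snd].
have H (m : {measure set (R * R) -> \bar R}) : m setT = 1%E ->
    \int[m]_z (phi z.1 * phi z.2) = (\int[m]_z c n1 n1 z - \int[m]_z c n1 n2 z) -
      (\int[m]_z c n2 n1 z - \int[m]_z c n2 n2 z).
  move=> m_1; rewrite -!RintB//; try exact: bounded_measurableB.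
  by apply: eq_Rintegral => z _; rewrite !phiE /c; ring.
rewrite !H//; have := disc_pair n1 n1; have := disc_pair n1 n2; have := disc_pair n2 n1; have := disc_pair n2 n2.
rewrite /V /c !ler_norml => /andP[? ?] /andP[? ?] /andP[? ?] /andP[? ?].
have -> : b * (fine (n1 setT) + fine (n2 setT)) ^+ 2 = b * (fine (n1 setT) * fine (n1 setT)) +
  b * (fine (n1 setT) * fine (n2 setT)) + b * (fine (n2 setT) * fine (n1 setT)) + b * (fine (n2 setT) * fine (n2 setT)) by ring.
by apply/andP; split; lra.
Qed.

Variable e : R.
Hypothesis eV : `|e| <= V.
Let zeta y := phi y - e.

(** The constant e cancels between two measures of mass one. A factor 2 is given away so that 2V
    serves both as the bound of the centered variable and as the constant of the discrepancies. *)
Lemma centered_discrepancy_fst :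
  `|\int[m1]_z zeta z.1 - \int[m2]_z zeta z.1| <= 2 * V * b.
Proof.
have H (m : {measure set (R * R) -> \bar R}) : m setT = 1%E ->
    \int[m]_z zeta z.1 = \int[m]_z phi z.1 - e.
  move=> m_1; rewrite RintB ?Rint_cst//; [exact: bounded_fst bm_phi|exact: bounded_measurable_cst].
rewrite !H// opprB addrA subrK; apply: le_trans disc_phi_fst _.
have V0 : 0 <= V by rewrite addr_ge0 ?fine_ge0.
by rewrite mulrC ler_wpM2r// ler_peMl// ler1n.
Qed.

(** Expanding the product, the uncentered part costs V^2 b and each of the two cross terms V^2 b,
    since |e| <= V; the total 3 V^2 b stays below (2V)^2 b. *)
Lemma centered_discrepancy_pair :
  `|\int[m1]_z (zeta z.1 * zeta z.2) - \int[m2]_z (zeta z.1 * zeta z.2)| <= (2 * V) ^+ 2 * b.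
Proof.
have b1 := bounded_fst bm_phi; have b2 := bounded_snd bm_phi.
have b12 := bounded_measurableM b1 b2.
have be (g : R * R -> R) : bounded_measurable g -> bounded_measurable (fun z => e * g z).
  by move=> bg; exact: bounded_measurableM (bounded_measurable_cst _ e) bg.
have H (m : {measure set (R * R) -> \bar R}) : m setT = 1%E ->
    \int[m]_z (zeta z.1 * zeta z.2) = \int[m]_z (phi z.1 * phi z.2) - e * \int[m]_z phi z.1
      - e * \int[m]_z phi z.2 + e ^+ 2.
  move=> m_1; rewrite -!RintZ// -RintB//; last exact: be.
  have b3 := bounded_measurableB b12 (be _ b1).
  rewrite -RintB//; last exact: be.
  rewrite -[in RHS](Rint_cst m_1 (e ^+ 2)) -RintD//.
  - by apply: eq_Rintegral => z _; rewrite /zeta; ring.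
  - by apply: bounded_measurableB => //; exact: be.
  - exact: bounded_measurable_cst.
rewrite !H//; set I1 := \int[m1]_z (_ * _); set I2 := \int[m2]_z (_ * _).
set J1 := \int[m1]_z _; set J2 := \int[m2]_z _; set L1 := \int[m1]_z _; set L2 := \int[m2]_z _.
have -> : I1 - e * J1 - e * L1 + e ^+ 2 - (I2 - e * J2 - e * L2 + e ^+ 2) =
  (I1 - I2) - e * (J1 - J2) - e * (L1 - L2) by ring.
have V0 : 0 <= V by rewrite addr_ge0 ?fine_ge0.
have e1 (u : R) : `|u| <= b * V -> `|e * u| <= b * V ^+ 2.
  move=> ub; rewrite normrM expr2 mulrA mulrC; exact: ler_pM.
have h1 := e1 _ disc_phi_fst; have h2 := e1 _ disc_phi_snd; have h3 := disc_phi_pair.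
apply: le_trans (ler_normB _ _) _.
apply: le_trans (lerD (ler_normB _ _) h2) _.
have := mulr_ge0 b0 (sqr_ge0 V).
move: h1 h3; rewrite -/I1 -/I2 -/J1 -/J2.
have -> : (2 * V) ^+ 2 * b = 4 * (b * V ^+ 2) by ring.
lra.
Qed.

End bounded_variation_discrepancy.

(** * Iterated integrals over R x Omega *)

Section iterated_integral.
Context d (T : measurableType d) (R : realType) (P : probability T R).
Local Notation mu := (@lebesgue_measure R).
Implicit Types f g : R -> T -> R.

Definition jointly_bm f := bounded_measurable (fun xw : R * T => f xw.1 xw.2).

(** The variable x is outside because conditioning and stationarity act at fixed x; the order is
    exchanged only when a weight depending on w alone has to be pulled out. *)
Definition iter_int f : \bar R := (\int[mu]_x \int[P]_w (f x w)%:E)%E.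

Let P1 := probability_setT P.

Lemma jointly_bm_section f x : jointly_bm f -> bounded_measurable (f x).
Proof.
move=> [mf [M fM]]; split; last by exists M => w; exact: (fM (x, w)).
exact: measurableT_comp mf (measurable_pair1 x).
Qed.

Lemma iter_int_prod f : jointly_bm f -> (forall x w, 0 <= f x w) ->
  iter_int f = (\int[(mu \x P)%E]_xw (f xw.1 xw.2)%:E)%E.
Proof.
move=> [mf _] f0; rewrite fubini_tonelli1//; first exact/measurable_EFinP.
by move=> xw; rewrite lee_fin.
Qed.

Lemma iter_int_swap f : jointly_bm f -> (forall x w, 0 <= f x w) ->
  iter_int f = (\int[P]_w \int[mu]_x (f x w)%:E)%E.
Proof.
move=> [mf _] f0; rewrite /iter_int (@fubini_tonelli _ _ _ _ _ mu P (fun xw => (f xw.1 xw.2)%:E))//; first exact/measurable_EFinP.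
by move=> xw; rewrite lee_fin.
Qed.

Lemma iter_intE f : jointly_bm f -> iter_int f = (\int[mu]_x (\int[P]_w f x w)%R%:E)%E.
Proof.
by move=> bf; apply: eq_integral => x _; rewrite EFin_Rint//; exact: jointly_bm_section.
Qed.

Lemma bounded_measurable_Rint f : jointly_bm f ->
  bounded_measurable (fun x => \int[P]_w f x w).
Proof.
move=> bf; have [mf [M fM]] := bf; split; last first.
  by exists M => x; apply: Rint_bound => // [|w]; [exact: jointly_bm_section|exact: (fM (x, w))].
rewrite (_ : (fun x => \int[P]_w f x w) = (fun x => fine (\int[P]_w (f x w + M)%:E)%E - M)); last first.
  apply/funext => x; have bx := jointly_bm_section x bf.
  rewrite -EFin_Rint//; last exact: bounded_measurableD bx (bounded_measurable_cst _ M).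
  by rewrite /= RintD ?Rint_cst ?addrK//; exact: bounded_measurable_cst.
apply: measurable_funB => //; apply: measurableT_comp => //.
apply: (@measurable_fun_fubini_tonelli_F _ _ _ _ _ P (fun xw : R * T => (f xw.1 xw.2 + M)%:E)).
  by apply/measurable_EFinP; exact: measurable_funD.
by move=> xw; rewrite lee_fin; have := fM xw; rewrite ler_norml => /andP[]; lra.
Qed.

Lemma jointly_bm_cst1 (c : R -> R) : bounded_measurable c -> jointly_bm (fun x _ => c x).
Proof. by move=> [mc [M cM]]; split; [exact: measurableT_comp mc measurable_fst|exists M => -[x w]]. Qed.

Lemma jointly_bm_cst2 (c : T -> R) : bounded_measurable c -> jointly_bm (fun _ w => c w).
Proof. by move=> [mc [M cM]]; split; [exact: measurableT_comp mc measurable_snd|exists M => -[x w]]. Qed.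

Lemma iter_int_le f g : jointly_bm f -> jointly_bm g -> (forall x w, 0 <= f x w) ->
  (forall x, \int[P]_w f x w <= \int[P]_w g x w) -> (iter_int f <= iter_int g)%E.
Proof.
move=> bf bg f0 fg; rewrite !iter_intE//; have f00 x : 0 <= \int[P]_w f x w by exact: Rintegral_ge0.
have [mf _] := bounded_measurable_Rint bf; have [mg _] := bounded_measurable_Rint bg.
apply: ge0_le_integral => //.
- by move=> x _; rewrite lee_fin.
- exact/measurable_EFinP.
- exact/measurable_EFinP.
- by move=> x _; rewrite lee_fin.
Qed.

Lemma iter_int_mono f g : jointly_bm f -> jointly_bm g -> (forall x w, 0 <= f x w) ->
  (forall x w, f x w <= g x w) -> (iter_int f <= iter_int g)%E.
Proof. by move=> bf bg f0 fg; apply: iter_int_le => // x; apply: Rint_le => //; exact: jointly_bm_section. Qed.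

Lemma iter_intD f g : jointly_bm f -> jointly_bm g ->
  (forall x w, 0 <= f x w) -> (forall x w, 0 <= g x w) ->
  iter_int (fun x w => f x w + g x w) = (iter_int f + iter_int g)%E.
Proof.
move=> bf bg f0 g0; rewrite !iter_int_prod//; last 2 first.
- exact: bounded_measurableD.
- by move=> x w; rewrite addr_ge0.
rewrite -ge0_integralD//.
- by move=> xw _; rewrite lee_fin.
- by apply/measurable_EFinP; case: bf.
- by move=> xw _; rewrite lee_fin.
- by apply/measurable_EFinP; case: bg.
Qed.

Lemma iter_intZ f (k : R) : 0 <= k -> jointly_bm f -> (forall x w, 0 <= f x w) ->
  iter_int (fun x w => k * f x w) = (k%:E * iter_int f)%E.
Proof.
move=> k0 bf f0; rewrite !iter_int_prod//; last 2 first.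
- exact: bounded_measurableM (bounded_measurable_cst _ k) bf.
- by move=> x w; rewrite mulr_ge0.
rewrite -ge0_integralZl_EFin//; first by move=> xw _; rewrite lee_fin.
by apply/measurable_EFinP; case: bf.
Qed.

Lemma iter_int_sum (I : Type) (s : seq I) (F : I -> R -> T -> R) :
  (forall i, jointly_bm (F i)) -> (forall i x w, 0 <= F i x w) ->
  iter_int (fun x w => \sum_(i <- s) F i x w) = (\sum_(i <- s) iter_int (F i))%E.
Proof.
move=> bF F0; elim: s => [|i s IH].
  rewrite big_nil; apply: integral0_eq => x _; apply: integral0_eq => w _.
  by rewrite big_nil.
rewrite big_cons -IH -(iter_intD (bF i) _ (F0 i)).
- by apply: eq_integral => x _; apply: eq_integral => w _; rewrite big_cons.
- exact: (bounded_measurable_sum s (F := fun i xw => F i xw.1 xw.2)).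
- by move=> x w; apply: sumr_ge0.
Qed.

Lemma iter_int_hoelder f g (a b U X : R) :
  jointly_bm f -> jointly_bm g -> (forall x w, 0 <= f x w) -> (forall x w, 0 <= g x w) ->
  0 < a -> 0 < b -> a^-1 + b^-1 = 1 -> 0 <= U -> 0 <= X ->
  (iter_int (fun x w => ((f x w) `^ a)%R) <= U%:E)%E ->
  (iter_int (fun x w => ((g x w) `^ b)%R) <= X%:E)%E ->
  (iter_int (fun x w => f x w * g x w)%R <= (U `^ a^-1 * X `^ b^-1)%:E)%E.
Proof.
move=> bf bg f0 g0 a0 b0 ab U0 X0.
have bp h (r : R) : jointly_bm h -> (forall x w, 0 <= h x w) -> 0 < r -> jointly_bm (fun x w => (h x w) `^ r).
  move=> bh h0 r0; rewrite /jointly_bm.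
  rewrite (_ : (fun xw : R * T => _) = (fun xw : R * T => `|h xw.1 xw.2| `^ r)).
    exact: (bounded_measurable_powR (ltW r0) bh).
  by apply/funext => xw; rewrite ger0_norm.
rewrite !iter_int_prod//; try exact: bp; try exact: bounded_measurableM;
  try (by move=> x w; rewrite ?powR_ge0 ?mulr_ge0).
move=> HU HX; apply: (@hoelder_bound _ _ _ (mu \x P)%E (fun xw => f xw.1 xw.2) (fun xw => g xw.1 xw.2)) => //.
- by case: bf.
- by case: bg.
Qed.

(** As the weight does not depend on x, integrate in x first: a uniform bound L remains, times the
    expectation of b. This is how only the mean of a dependence coefficient enters the estimates. *)
Lemma iter_int_weight (b : T -> R) g (L : R) :
  bounded_measurable b -> (forall w, 0 <= b w) -> jointly_bm g -> (forall x w, 0 <= g x w) ->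
  (forall w, \int[mu]_x (g x w)%:E <= L%:E)%E -> 
  (iter_int (fun x w => b w * g x w)%R <= (\int[P]_w b w * L)%:E)%E.
Proof.
move=> bb b0 bg g0 gL.
have L0 : 0 <= L.
  by have := le_trans (@integral_ge0 _ _ _ mu setT (fun x => (g x point)%:E) _) (gL point); rewrite lee_fin; apply=> x _; rewrite lee_fin.
have [mb _] := bb; have [mg _] := bg.
rewrite iter_int_swap//; last 2 first.
- exact: bounded_measurableM (jointly_bm_cst2 bb) bg.
- by move=> x w; rewrite mulr_ge0.
have mgw w : measurable_fun setT (fun x => g x w) by exact: measurableT_comp mg (measurable_pair2 w).
apply: le_trans (_ : \int[P]_w ((b w * L)%:E) <= _)%E.
  apply: ge0_le_integral => //.
  - by move=> w _; apply: integral_ge0 => x _; rewrite lee_fin mulr_ge0.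
  - apply: (@measurable_fun_fubini_tonelli_G _ _ _ _ _ mu (fun xw : R * T => (b xw.2 * g xw.1 xw.2)%:E)).
      apply/measurable_EFinP; apply: measurable_funM => //; exact: measurableT_comp mb measurable_snd.
    by move=> xw; rewrite lee_fin mulr_ge0.
  - by apply/measurable_EFinP; exact: measurable_funM.
  - move=> w _; under eq_integral do rewrite EFinM.
    rewrite ge0_integralZl_EFin//.
    + by rewrite EFinM lee_wpmul2l// lee_fin.
    + by move=> x _; rewrite lee_fin.
    + by have mE : measurable_fun setT (EFin \o (fun x => g x w)) by apply/measurable_EFinP; exact: mgw.
rewrite -EFin_Rint//; last exact: bounded_measurableM bb (bounded_measurable_cst _ L).
rewrite lee_fin RintegralZr//; exact: bounded_measurable_integrable.
Qed.

End iterated_integral.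

(** The case of weight one in [iter_int_weight]: a bound uniform in y survives averaging over any
    law of y, conditional or not. *)
Lemma avg_section_bound d (S : measurableType d) (R : realType) (m : probability S R)
    (pi : S -> R) (g : R -> R -> R) (L : R) :
  measurable_fun setT pi -> bounded_measurable (fun xy : R * R => g xy.1 xy.2) ->
  (forall x y, 0 <= g x y) ->
  (forall y, \int[@lebesgue_measure R]_x (g x y)%:E <= L%:E)%E ->
  (\int[@lebesgue_measure R]_x (\int[m]_z g x (pi z))%R%:E <= L%:E)%E.
Proof.
move=> mpi bg g0 gL.
have bgpi : jointly_bm (fun x z => g x (pi z)).
  have [mg [M gM]] := bg; split; last by exists M => xz; exact: (gM (xz.1, pi xz.2)).
  have mpi2 : measurable_fun setT (fun xz : R * S => (xz.1, pi xz.2)).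
    by apply/measurable_fun_pairP; split; [exact: measurable_fst|exact: measurableT_comp mpi measurable_snd].
  exact: measurableT_comp mg mpi2.
have := @iter_int_weight _ S R m (fun=> 1) (fun x z => g x (pi z)) L (bounded_measurable_cst _ 1) (fun=> ler01) bgpi.
rewrite (Rint_cst (probability_setT m)) mul1r -iter_intE// => H.
rewrite (_ : iter_int _ _ = iter_int m (fun x w => (1 * g x (pi w))%R)); first by apply: H => //.
by apply: eq_integral => x _; apply: eq_integral => z _; rewrite mul1r.
Qed.

(** * Conditional moment estimates *)

Section rosenthal_step.
Context d (T : measurableType d) (R : realType) (P : probability T R).
Local Notation mu := (@lebesgue_measure R).
Variable Y : int -> {RV P >-> R}.
Hypothesis statY : stationary Y.
Variable Q : nat -> nat -> R.-pker (pastType Y) ~> (R * R)%type.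
Hypothesis condQ : forall i j : nat, (0 < i)%N -> (0 < j)%N -> is_conditional_law i j (Q i j).
Variable zeta : R -> R -> R.
Hypothesis mzeta : measurable_fun setT (fun xy : R * R => zeta xy.1 xy.2).
(** For the estimator, up to constants in p: V is the norm of dK, L is h times the integral of
    |K|^(p-2), l1 is h times that of |K|, and s is ||f||_oo times l1. *)
Variables (p V L s l1 : R) (beta : nat -> R).
Hypotheses (p4 : 4 <= p) (s0 : 0 <= s).
Hypothesis zetaV : forall x y, `|zeta x y| <= V.
Hypothesis zetaL : forall y, (\int[mu]_x ((`|zeta x y| `^ (p - 2))%R%:E) <= L%:E)%E.
Hypothesis zetas : forall x, \int[P]_w `|zeta x (Y 0 w)| <= s.
Hypothesis zetal : forall y, (\int[mu]_x `|zeta x y|%:E <= l1%:E)%E.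
Hypothesis disc1 : forall x i w, (0 < i)%N ->
  `|\int[Q i i w]_z zeta x z.1| <= V * bcoef Q i i w.
Hypothesis disc2 : forall x i j w, (0 < i)%N -> (0 < j)%N ->
  `|\int[Q i j w]_z (zeta x z.1 * zeta x z.2) -
    \int[P]_w' (zeta x (Y i%:Z w') * zeta x (Y j%:Z w'))| <= V ^+ 2 * bcoef Q i j w.
Hypothesis bcoef_beta : forall i j, (0 < j <= i)%N -> \int[P]_w bcoef Q i j w <= beta j.
Hypothesis beta0 : 1 <= beta 0%N.
Hypothesis beta_ge0 : forall j, 0 <= beta j.

Let P1 := probability_setT P.
Let V0 : 0 <= V. Proof. exact: le_trans (normr_ge0 _) (zetaV 0 0). Qed.

Let nonneg_integral_bound (g : R -> R) (M : R) : (forall x, 0 <= g x) ->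
  (\int[mu]_x (g x)%:E <= M%:E)%E -> 0 <= M.
Proof.
by move=> g0 gM; rewrite -lee_fin (le_trans _ gM)// integral_ge0// => x _; rewrite lee_fin.
Qed.

Let L0 : 0 <= L.
Proof. by apply: nonneg_integral_bound (zetaL 0) => x; exact: powR_ge0. Qed.

Let l10 : 0 <= l1.
Proof. exact: nonneg_integral_bound (zetal 0). Qed.

Let jbm := @jointly_bm d T R.
(** Joint measurability with F_0 on the second factor, required of anything multiplied by a variable
    that is then replaced by its conditional expectation. *)
Let jbp (f : R -> T -> R) := @jointly_bm _ (pastType Y) R f.
Let II := @iter_int d T R P.

Let jbp_jbm f : jbp f -> jbm f.
Proof.
move=> [mf bf]; split=> //.
have mid : measurable_fun (setT : set (R * T)) (fun xw : R * T => (xw.1, xw.2) : R * pastType Y).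
  apply/measurable_fun_pairP; split; first exact: measurable_fst.
  have : measurable_fun (setT : set T) (id : T -> pastType Y).
    by move=> _ B mB; rewrite setTI; have := past_measurable mB.
  by move/measurableT_comp; apply; exact: measurable_snd.
exact: (measurableT_comp mf mid).
Qed.

Let jM f g : jbm f -> jbm g -> jbm (fun x w => f x w * g x w).
Proof. by move=> bf bg; exact: bounded_measurableM. Qed.
Let jD f g : jbm f -> jbm g -> jbm (fun x w => f x w + g x w).
Proof. by move=> bf bg; exact: bounded_measurableD. Qed.
Let jN f : jbm f -> jbm (fun x w => `|f x w|).
Proof. by move=> bf; exact: bounded_measurable_norm. Qed.
Let jP f r : 0 <= r -> jbm f -> jbm (fun x w => `|f x w| `^ r).
Proof. by move=> r0 bf; exact: (bounded_measurable_powR r0 bf). Qed.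
Let jc (k : R) : jbm (fun _ _ => k).
Proof. exact: bounded_measurable_cst. Qed.
Let pM f g : jbp f -> jbp g -> jbp (fun x w => f x w * g x w).
Proof. by move=> bf bg; exact: bounded_measurableM. Qed.
Let pN f : jbp f -> jbp (fun x w => `|f x w|).
Proof. by move=> bf; exact: bounded_measurable_norm. Qed.
Let pP f r : 0 <= r -> jbp f -> jbp (fun x w => `|f x w| `^ r).
Proof. by move=> r0 bf; exact: (bounded_measurable_powR r0 bf). Qed.

Let bz x (d' : measure_display) (S : measurableType d') (f : S -> R) :
  measurable_fun setT f -> bounded_measurable (fun v => zeta x (f v)).
Proof.
move=> mf; split; last by exists V.
have mp : measurable_fun setT (fun v : S => (x, f v)).
  by apply/measurable_fun_pairP; split; [exact: measurable_cst|].
exact: measurableT_comp mzeta mp.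
Qed.

Definition summand (k : int) (x : R) (w : T) : R := zeta x (Y k w).
Definition window_sum (t : seq int) (x : R) (w : T) : R := \sum_(k <- t) summand k x w.

Let jZ_gen d' (S : measurableType d') (f : S -> R) : measurable_fun setT f ->
  @jointly_bm _ S R (fun x v => zeta x (f v)).
Proof.
move=> mf; split; last by exists V.
have mp : measurable_fun setT (fun xv : R * S => (xv.1, f xv.2)).
  apply/measurable_fun_pairP; split; first exact: measurable_fst.
  exact: measurableT_comp mf measurable_snd.
exact: measurableT_comp mzeta mp.
Qed.

Let jZ k : jbm (summand k).
Proof. by apply: jZ_gen; exact: measurable_funPT. Qed.

Let pZ k : k <= 0 -> jbp (summand k).
Proof. by move=> k0; apply: (@jZ_gen _ (pastType Y)); exact: measurable_past. Qed.

Let jS t : jbm (window_sum t).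
Proof. exact: (bounded_measurable_sum t (F := fun k xw => summand k xw.1 xw.2)). Qed.

Let pS t : all (fun k => k <= 0) t -> jbp (window_sum t).
Proof.
elim: t => [_|k t IH /= /andP[k0 /IH pt]].
  rewrite /jbp /jointly_bm /window_sum; under eq_fun do rewrite big_nil.
  exact: bounded_measurable_cst.
rewrite /jbp /jointly_bm /window_sum; under eq_fun do rewrite big_cons.
exact: bounded_measurableD (pZ k0) pt.
Qed.

(* The conditional means E(zeta(Y_i) | F_0), in absolute value. *)
Let om (i : nat) (x : R) (w : T) : R := `|\int[Q i i w]_z zeta x z.1|.

Let mz1 : measurable_fun setT (fun v : R * pastType Y * (R * R) => zeta v.1.1 v.2.1).
Proof.
have mp : measurable_fun setT (fun v : R * pastType Y * (R * R) => (v.1.1, v.2.1)).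
  apply/measurable_fun_pairP; split; first exact: measurableT_comp measurable_fst measurable_fst.
  exact: measurableT_comp measurable_fst measurable_snd.
exact: measurableT_comp mzeta mp.
Qed.

Let mz2 : measurable_fun setT (fun v : R * pastType Y * (R * R) => zeta v.1.1 v.2.2).
Proof.
have mp : measurable_fun setT (fun v : R * pastType Y * (R * R) => (v.1.1, v.2.2)).
  apply/measurable_fun_pairP; split; first exact: measurableT_comp measurable_fst measurable_fst.
  exact: measurableT_comp measurable_snd measurable_snd.
exact: measurableT_comp mzeta mp.
Qed.

Let bz1 : bounded_measurable (fun v : R * pastType Y * (R * R) => zeta v.1.1 v.2.1).
Proof. by split; [exact: mz1|exists V]. Qed.

Let bz2 : bounded_measurable (fun v : R * pastType Y * (R * R) => zeta v.1.1 v.2.2).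
Proof. by split; [exact: mz2|exists V]. Qed.

Let pcond i j (f : R * pastType Y * (R * R) -> R) : bounded_measurable f ->
  jbp (fun x w => \int[Q i j w]_z f ((x, w), z)).
Proof.
move=> bf; have [mf [M fM]] := bf; split.
  rewrite (_ : (fun xw : R * pastType Y => _) = (fun xw => \int[Q i j xw.2]_z f (xw, z))).
    exact: (@measurable_Rintegral_kernel_snd _ _ _ _ _ _ R (Q i j) f bf).
  by apply/funext => -[x w].
exists M => -[x w] /=; apply: Rint_bound => //; first exact: prob_kernel.
split; first exact: measurableT_comp mf (measurable_pair1 (x, w)).
by exists M.
Qed.

Let pom i : jbp (om i).
Proof. by apply: pN; exact: (@pcond i i _ bz1). Qed.

Let om_ge0 i x w : 0 <= om i x w. Proof. exact: normr_ge0. Qed.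

Let Q1 i j w : Q i j w setT = 1%E. Proof. exact: prob_kernel. Qed.

Let om_pow i (r : R) x w : 1 <= r -> om i x w `^ r <= \int[Q i i w]_z `|zeta x z.1| `^ r.
Proof. by move=> r1; apply: powR_Rint_le => //; apply: bz; exact: measurable_fst. Qed.

Let p2_ge0 : 0 <= p - 2. Proof. by have := p4; lra. Qed.
Let p2_ge1 : 1 <= p - 2. Proof. by have := p4; lra. Qed.

Let bcoef_nat i j : bounded_measurable (bcoef Q i j : T -> R).
Proof. exact/bounded_past/bounded_bcoef. Qed.

Let bzp : bounded_measurable (fun xy : R * R => `|zeta xy.1 xy.2| `^ (p - 2)).
Proof. by apply: bounded_measurable_powR => //; split; [exact: mzeta|exists V]. Qed.

Let avgQ i j (pi : R * R -> R) w : measurable_fun setT pi ->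
  (\int[mu]_x (\int[Q i j w]_z `|zeta x (pi z)| `^ (p - 2))%R%:E <= L%:E)%E.
Proof.
move=> mpi; apply: (@avg_section_bound _ _ _ (probability_of (Q1 i j w)) pi (fun x y => `|zeta x y| `^ (p - 2))) => //.
Qed.

Let avgP k : (\int[mu]_x (\int[P]_w `|zeta x (Y k w)| `^ (p - 2))%R%:E <= L%:E)%E.
Proof.
apply: (@avg_section_bound _ _ _ P (Y k) (fun x y => `|zeta x y| `^ (p - 2))) => //.
Qed.

Let jcondp i j (pi : R * R -> R) : measurable_fun setT pi ->
  jbm (fun x w => \int[Q i j w]_z `|zeta x (pi z)| `^ (p - 2)).
Proof.
move=> mpi; apply: jbp_jbm; apply: (@pcond i j (fun v => `|zeta v.1.1 (pi v.2)| `^ (p - 2))).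
apply: bounded_measurable_powR => //; split; last by exists V.
have mp : measurable_fun setT (fun v : R * pastType Y * (R * R) => (v.1.1, pi v.2)).
  apply/measurable_fun_pairP; split; first exact: measurableT_comp measurable_fst measurable_fst.
  exact: measurableT_comp mpi measurable_snd.
exact: measurableT_comp mzeta mp.
Qed.

Let weight_bound i j (g : R -> T -> R) (M : R) : (0 < j <= i)%N -> jbm g ->
  (forall x w, 0 <= g x w) -> 0 <= M -> (forall w, \int[mu]_x (g x w)%:E <= M%:E)%E ->
  (II (fun x w => bcoef Q i j w * g x w)%R <= (M * beta j)%:E)%E.
Proof.
move=> ij bg g0 M0 gM; apply: le_trans (iter_int_weight P (bcoef_nat i j) _ bg g0 gM) _.
  exact: bcoef_ge0.
by rewrite lee_fin mulrC ler_wpM2l// bcoef_beta.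
Qed.

(** Two of the p factors are bounded by V b, and b^2 <= b. The other p - 2 pass inside the
    conditional expectation by Jensen, where integration in x costs L uniformly. *)
Lemma iter_int_cond_mean i : (0 < i)%N ->
  (II (fun x w => (om i x w `^ p)%R) <= (V ^+ 2 * L * beta i)%:E)%E.
Proof.
move=> i0; set g := fun x w => \int[Q i i w]_z `|zeta x z.1| `^ (p - 2).
have jg : jbm g by exact: (jcondp i i measurable_fst).
have g0 x w : 0 <= g x w by apply: Rintegral_ge0 => z _; exact: powR_ge0.
have jb : jbm (fun x w => bcoef Q i i w * g x w) by apply: jM => //; exact: jointly_bm_cst2.
have jo : jbm (fun x w => om i x w `^ p).
  have := jP (_ : 0 <= p) (jbp_jbm (pom i)).
  rewrite /jbm /jointly_bm; under eq_fun do rewrite ger0_norm ?om_ge0//; apply; have := p4; lra.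
apply: le_trans (iter_int_mono (g := fun x w => V ^+ 2 * (bcoef Q i i w * g x w)) _ _ _ _ _) _ => //.
- exact: (jM (jc (V ^+ 2)) jb).
- by move=> x w; exact: powR_ge0.
- move=> x w; have b0 := bcoef_ge0 Q i i w; have b1 := bcoef_le1 Q i i w.
  have -> : om i x w `^ p = om i x w ^+ 2 * om i x w `^ (p - 2).
    rewrite -powR_mulrn// -powRD; first by congr (_ `^ _); ring.
    by rewrite (_ : 2 + (p - 2) = p); [rewrite gt_eqF//; have := p4; lra|ring].
  apply: le_trans (_ : V ^+ 2 * bcoef Q i i w * om i x w `^ (p - 2) <= _).
    rewrite ler_wpM2r ?powR_ge0//.
    apply: le_trans (_ : (V * bcoef Q i i w) ^+ 2 <= _).
      by rewrite lerXn2r ?nnegrE ?mulr_ge0// disc1.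
    by rewrite exprMn ler_wpM2l ?sqr_ge0// expr2 ler_piMl.
  rewrite -mulrA ler_wpM2l ?sqr_ge0// ler_wpM2l//; exact: om_pow.
rewrite iter_intZ// ?sqr_ge0//; last by move=> x w; rewrite mulr_ge0// bcoef_ge0.
rewrite -[V ^+ 2 * L * _]mulrA (EFinM (V ^+ 2)) lee_wpmul2l// ?lee_fin ?sqr_ge0//.
by apply: weight_bound; rewrite ?i0 ?leqnn// => w; exact: avgQ.
Qed.

(** A power p/2 is split as 1 + q: one factor is controlled by the dependence coefficient, while the
    power q of a product has moments of order 2q = p - 2. The inequality q >= 1, from p >= 4, allows
    Jensen at order q. *)
Let q := p / 2 - 1.

Let q_ge1 : 1 <= q. Proof. by rewrite /q; have := p4; lra. Qed.

Let mul_powR_le (a b : R) : 0 <= a -> 0 <= b ->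
  (a * b) `^ q <= (a `^ (p - 2) + b `^ (p - 2)) / 2.
Proof.
move=> a0 b0; rewrite powRM//.
have E c : 0 <= c -> c `^ (p - 2) = (c `^ q) ^+ 2.
  by move=> c0; rewrite -powR_mulrn ?powR_ge0// -powRrM; congr (_ `^ _); rewrite /q; lra.
rewrite !E//; set u := a `^ q; set v := b `^ q.
by have := sqr_ge0 (u - v); nra.
Qed.

Let addr_powR_le (a b : R) : 0 <= a -> 0 <= b ->
  (a + b) `^ q <= 2 `^ q * (a `^ q + b `^ q).
Proof.
move=> a0 b0; have q0 : 0 <= q by have := q_ge1; lra.
wlog ab : a b a0 b0 / a <= b.
  move=> H; have [ab|/ltW ba] := leP a b; first exact: H.
  by rewrite addrC [X in _ * X]addrC; exact: H.
apply: le_trans (_ : (2 * b) `^ q <= _).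
  by apply: (ge0_ler_powR q0); rewrite ?nnegrE ?addr_ge0 ?mulr_ge0// mulr_natl mulr2n lerD2r.
by rewrite powRM// ler_wpM2l ?powR_ge0// lerDr powR_ge0.
Qed.

Let half_powR (c : R) : 0 <= c -> c `^ (p / 2) = c * c `^ q.
Proof. by move=> c0; rewrite /q mulr_powRB1//; have := p4; lra. Qed.

Let sec_add (g1 g2 : R -> T -> R) (M1 M2 : R) w : jbm g1 -> jbm g2 ->
  (forall x w, 0 <= g1 x w) -> (forall x w, 0 <= g2 x w) ->
  (\int[mu]_x (g1 x w)%:E <= M1%:E)%E -> (\int[mu]_x (g2 x w)%:E <= M2%:E)%E ->
  (\int[mu]_x (g1 x w + g2 x w)%:E <= (M1 + M2)%:E)%E.
Proof.
move=> [m1 _] [m2 _] g10 g20 h1 h2.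
have mE (g : R -> T -> R) : measurable_fun setT (fun xw : R * T => g xw.1 xw.2) ->
    measurable_fun setT (EFin \o (fun x => g x w)).
  by move=> mg; apply/measurable_EFinP; exact: measurableT_comp mg (measurable_pair2 w).
under eq_integral do rewrite EFinD.
rewrite ge0_integralD//; [|by move=> x _; rewrite lee_fin|exact: (mE _ m1)|by move=> x _; rewrite lee_fin|exact: (mE _ m2)].
by rewrite EFinD leeD.
Qed.

Let jZp k : jbm (fun x w => `|summand k x w| `^ (p - 2)).
Proof. exact: (jP p2_ge0 (jZ k)). Qed.

Let iter_int_scaled_weight i j (k M : R) (g f : R -> T -> R) : (0 < j <= i)%N -> 0 <= k -> 0 <= M ->
  jbm g -> (forall x w, 0 <= g x w) -> (forall w, \int[mu]_x (g x w)%:E <= M%:E)%E ->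
  jbm f -> (forall x w, 0 <= f x w) ->
  (forall x w, f x w <= k * (bcoef Q i j w * g x w)) ->
  (II f <= (k * (M * beta j))%:E)%E.
Proof.
move=> ij k0 M0 jg g0 gM jf f0 fg.
have jb : jbm (fun x w => bcoef Q i j w * g x w) by apply: jM => //; exact: jointly_bm_cst2.
apply: le_trans (iter_int_mono (g := fun x w => k * (bcoef Q i j w * g x w)) _ _ _ _ _) _ => //.
  exact: (jM (jc k) jb).
rewrite iter_intZ//; last by move=> x w; rewrite mulr_ge0// bcoef_ge0.
by rewrite EFinM lee_wpmul2l// ?lee_fin//; exact: weight_bound.
Qed.

(** One factor is at most V times V b. The remaining power q is split by the arithmetic-geometric
    inequality into two terms of order p - 2, each integrating to at most L. *)
Lemma iter_int_gap l : (0 < l)%N ->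
  (II (fun x w => ((`|summand 0 x w| * om l x w) `^ (p / 2))%R) <= (V ^+ 2 * L * beta l)%:E)%E.
Proof.
move=> l0; set h := fun x w => \int[Q l l w]_z `|zeta x z.1| `^ (p - 2).
have jh : jbm h by exact: (jcondp l l measurable_fst).
have h0 x w : 0 <= h x w by apply: Rintegral_ge0 => z _; exact: powR_ge0.
set g := fun x w => `|summand 0 x w| `^ (p - 2) + h x w.
have jg : jbm g by exact: (jD (jZp 0) jh).
have -> : V ^+ 2 * L * beta l = V ^+ 2 / 2 * ((L + L) * beta l) by field.
apply: (@iter_int_scaled_weight l l _ _ g) => //.
- by rewrite l0 leqnn.
- by rewrite divr_ge0// sqr_ge0.
- by rewrite addr_ge0.
- by move=> x w; rewrite addr_ge0// powR_ge0.
- move=> w; apply: (@sec_add (fun x w => `|summand 0 x w| `^ (p - 2)) h) => //; [exact: zetaL|exact: avgQ].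
- have := jP (_ : 0 <= p / 2) (jM (jN (jZ 0)) (jbp_jbm (pom l))).
  rewrite /jbm /jointly_bm; under eq_fun do rewrite ger0_norm ?mulr_ge0 ?om_ge0//.
  by apply; have := p4; lra.
- by move=> x w; exact: powR_ge0.
- move=> x w; have b0 := bcoef_ge0 Q l l w.
  rewrite half_powR ?mulr_ge0//.
  have -> : V ^+ 2 / 2 * (bcoef Q l l w * g x w) = (V * (V * bcoef Q l l w)) * (g x w / 2) by field.
  apply: ler_pM; rewrite ?mulr_ge0 ?powR_ge0//.
    by apply: ler_pM => //; [exact: zetaV|exact: disc1].
  apply: le_trans (mul_powR_le _ _) _ => //.
  by rewrite ler_wpM2r ?invr_ge0// /g lerD2l; exact: om_pow.
Qed.

Let cov i j x : R := \int[P]_w (summand i%:Z x w * summand j%:Z x w).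

Let Wij i j (x : R) (w : T) : R := `|\int[Q i j w]_z (zeta x z.1 * zeta x z.2) - cov i j x|.

Let pcov i j : jbp (fun x _ => cov i j x).
Proof. by apply: jointly_bm_cst1; apply: bounded_measurable_Rint; exact: (jM (jZ _) (jZ _)). Qed.

Let pzz i j : jbp (fun x w => \int[Q i j w]_z (zeta x z.1 * zeta x z.2)).
Proof. exact: (@pcond i j _ (bounded_measurableM bz1 bz2)). Qed.

Let pW i j : jbp (Wij i j).
Proof. by apply: pN; exact: bounded_measurableB (pzz i j) (pcov i j). Qed.

Let bzz x : bounded_measurable (fun z : R * R => zeta x z.1 * zeta x z.2).
Proof. by apply: bounded_measurableM; apply: bz; [exact: measurable_fst|exact: measurable_snd]. Qed.

(** One factor of the difference is at most V^2 b. For the power q, the conditional and the plain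
    covariance are separated at the cost of 2^q, and each is bounded by Jensen and the
    arithmetic-geometric inequality; four terms integrating to at most L then turn 2^q / 2 into
    2^(p/2). *)
Lemma iter_int_cond_cov i j : (0 < j <= i)%N ->
  (II (fun x w => (Wij i j x w `^ (p / 2))%R) <= (2 `^ (p / 2) * V ^+ 2 * L * beta j)%:E)%E.
Proof.
move=> /[dup] ij /andP[j0 jlei]; have i0 : (0 < i)%N by exact: leq_trans jlei.
set h1 := fun x w => \int[Q i j w]_z `|zeta x z.1| `^ (p - 2).
set h2 := fun x w => \int[Q i j w]_z `|zeta x z.2| `^ (p - 2).
set k1 := fun (x : R) (_ : T) => \int[P]_w `|summand i%:Z x w| `^ (p - 2).
set k2 := fun (x : R) (_ : T) => \int[P]_w `|summand j%:Z x w| `^ (p - 2).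
have jh1 : jbm h1 by exact: (jcondp i j measurable_fst).
have jh2 : jbm h2 by exact: (jcondp i j measurable_snd).
have jk1 : jbm k1 by apply: jointly_bm_cst1; exact: bounded_measurable_Rint (jZp _).
have jk2 : jbm k2 by apply: jointly_bm_cst1; exact: bounded_measurable_Rint (jZp _).
have h10 x w : 0 <= h1 x w by apply: Rintegral_ge0 => z _; exact: powR_ge0.
have h20 x w : 0 <= h2 x w by apply: Rintegral_ge0 => z _; exact: powR_ge0.
have k10 x w : 0 <= k1 x w by apply: Rintegral_ge0 => z _; exact: powR_ge0.
have k20 x w : 0 <= k2 x w by apply: Rintegral_ge0 => z _; exact: powR_ge0.
set g := fun x w => (h1 x w + h2 x w) + (k1 x w + k2 x w).
have jg : jbm g by exact: (jD (jD jh1 jh2) (jD jk1 jk2)).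
have -> : 2 `^ (p / 2) * V ^+ 2 * L * beta j = V ^+ 2 * 2 `^ q / 2 * (((L + L) + (L + L)) * beta j).
  by rewrite half_powR//; field.
have jW : jbm (Wij i j) by exact/jbp_jbm/pW.
apply: (@iter_int_scaled_weight i j _ _ g) => //.
- by rewrite divr_ge0// mulr_ge0 ?sqr_ge0// powR_ge0.
- by rewrite !addr_ge0.
- by move=> x w; exact: addr_ge0 (addr_ge0 (h10 x w) (h20 x w)) (addr_ge0 (k10 x w) (k20 x w)).
- move=> w; apply: (@sec_add (fun x w => h1 x w + h2 x w) (fun x w => k1 x w + k2 x w)).
  + exact: (jD jh1 jh2).
  + exact: (jD jk1 jk2).
  + by move=> x w'; exact: addr_ge0 (h10 x w') (h20 x w').
  + by move=> x w'; exact: addr_ge0 (k10 x w') (k20 x w').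
  + exact: (@sec_add h1 h2 L L w jh1 jh2 h10 h20 (avgQ i j w measurable_fst) (avgQ i j w measurable_snd)).
  + exact: (@sec_add k1 k2 L L w jk1 jk2 k10 k20 (avgP _) (avgP _)).
- have := jP (_ : 0 <= p / 2) jW.
  rewrite /jbm /jointly_bm; under eq_fun do rewrite normr_id.
  by apply; have := p4; lra.
- by move=> x w; exact: powR_ge0.
move=> x w; have b0 := bcoef_ge0 Q i j w.
rewrite half_powR; last exact: normr_ge0.
have -> : V ^+ 2 * 2 `^ q / 2 * (bcoef Q i j w * g x w) =
  (V ^+ 2 * bcoef Q i j w) * (2 `^ q * ((h1 x w + h2 x w) / 2 + (k1 x w + k2 x w) / 2)) by rewrite /g; field.
apply: ler_pM; [exact: normr_ge0|exact: powR_ge0|exact: disc2|].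
have bsum : bounded_measurable (fun w : T => summand i%:Z x w * summand j%:Z x w).
  by apply: bounded_measurableM; apply: bz; exact: measurable_funPT.
have q0 : 0 <= q by have := q_ge1; lra.
have K (d' : measure_display) (S : measurableType d') (m : {measure set S -> \bar R}) (f1 f2 : S -> R) :
    m setT = 1%E -> bounded_measurable f1 -> bounded_measurable f2 ->
    `|\int[m]_v (f1 v * f2 v)| `^ q <=
      (\int[m]_v `|f1 v| `^ (p - 2) + \int[m]_v `|f2 v| `^ (p - 2)) / 2.
  move=> m1 b1 b2; have b12 := bounded_measurableM b1 b2.
  apply: le_trans (powR_Rint_le m1 q_ge1 b12) _.
  have b1p := bounded_measurable_powR p2_ge0 b1; have b2p := bounded_measurable_powR p2_ge0 b2.
  rewrite -(RintD m1 b1p b2p) mulrC -RintZ//; last exact: bounded_measurableD.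
  apply: Rint_le => //.
  - exact: bounded_measurable_powR.
  - exact: bounded_measurableM (bounded_measurable_cst _ _) (bounded_measurableD b1p b2p).
  - by move=> v; rewrite normrM [X in _ <= X]mulrC; exact: mul_powR_le.
have k1' := K _ _ _ _ _ (Q1 i j w) (bz x measurable_fst) (bz x measurable_snd).
have k2' := K _ _ _ _ _ P1 (bz x (@measurable_funPT _ _ _ _ (Y i%:Z))) (bz x (@measurable_funPT _ _ _ _ (Y j%:Z))).
apply: le_trans (_ : (`|\int[Q i j w]_z (zeta x z.1 * zeta x z.2)| + `|cov i j x|) `^ q <= _).
  apply: ge0_ler_powR => //; rewrite ?nnegrE; [exact: normr_ge0|exact: addr_ge0|exact: ler_normB].
apply: le_trans (addr_powR_le _ _) _ => //.
by rewrite ler_wpM2l ?powR_ge0// lerD.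
Qed.

(** At gap 0 the covariance is a variance and there is nothing to condition: the weight 1 lets the
    same formula cover this case, in accordance with 1 <= [beta 0]. *)
Let bl (l : nat) (w : T) : R := if l == 0%N then 1 else bcoef Q l l w.

Let bl_bm l : bounded_measurable (bl l).
Proof. by rewrite /bl; case: eqP => _; [exact: bounded_measurable_cst|exact: bcoef_nat]. Qed.

Let bl_ge0 l w : 0 <= bl l w. Proof. by rewrite /bl; case: eqP => // _; exact: bcoef_ge0. Qed.

Let bl_le1 l w : bl l w <= 1. Proof. by rewrite /bl; case: eqP => // _; exact: bcoef_le1. Qed.

Let bl_beta l : \int[P]_w bl l w <= beta l.
Proof.
rewrite /bl; case: eqP => [->|/eqP l0]; first by rewrite Rint_cst.
by apply: bcoef_beta; rewrite lt0n l0 leqnn.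
Qed.

Let cl (l : nat) (x : R) : R := V * \int[P]_w (bl l w * `|summand 0 x w|).

Let jcl l : bounded_measurable (cl l).
Proof.
apply: bounded_measurableM (bounded_measurable_cst _ V) _.
exact: bounded_measurable_Rint (jM (jointly_bm_cst2 (bl_bm l)) (jN (jZ 0))).
Qed.

Let cl_ge0 l x : 0 <= cl l x.
Proof. by rewrite mulr_ge0//; apply: Rintegral_ge0 => w _; rewrite mulr_ge0. Qed.

(** Of the p/2 factors E(b |zeta_0|), q are bounded by s, uniformly in x. The last one is kept,
    since integrating it in x still yields the decay beta l, with the factor l1. *)
Lemma iter_int_variance l :
  (II (fun x _ => (cl l x `^ (p / 2))%R) <= (V `^ (p / 2) * s `^ q * l1 * beta l)%:E)%E.
Proof.
have q0 : 0 <= q by have := q_ge1; lra.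
have jb : jbm (fun x w => bl l w * `|summand 0 x w|).
  exact: (jM (jointly_bm_cst2 (bl_bm l)) (jN (jZ 0))).
have k0 : 0 <= V `^ (p / 2) * s `^ q by rewrite mulr_ge0 ?powR_ge0.
apply: le_trans (iter_int_le (g := fun x w => (V `^ (p / 2) * s `^ q) * (bl l w * `|summand 0 x w|)) _ _ _ _) _ => //.
- have := jP (_ : 0 <= p / 2) (jointly_bm_cst1 T (jcl l)).
  rewrite /jbm /jointly_bm; under eq_fun do rewrite ger0_norm ?cl_ge0//.
  by apply; have := p4; lra.
- exact: (jM (jc _) jb).
- by move=> x w; exact: powR_ge0.
- move=> x; have bx := jointly_bm_section x jb.
  rewrite (Rint_cst P1) RintZ// /cl; set J := \int[P]_w _.
  have J0 : 0 <= J by apply: Rintegral_ge0 => w _; rewrite mulr_ge0.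
  rewrite powRM// -mulrA ler_wpM2l ?powR_ge0// half_powR// mulrC ler_wpM2r//.
  rewrite ge0_ler_powR ?nnegrE//; apply: le_trans (zetas x).
  apply: Rint_le => //; first exact: jointly_bm_section (jN (jZ 0)).
  by move=> w; rewrite ler_piMl.
rewrite iter_intZ//; last by move=> x w; rewrite mulr_ge0.
rewrite -[_ * l1 * _]mulrA (EFinM (V `^ (p / 2) * s `^ q)) lee_wpmul2l ?lee_fin//.
apply: le_trans (iter_int_weight P (bl_bm l) (bl_ge0 l) (jN (jZ 0)) _ _) _.
- by move=> x w; exact: normr_ge0.
- by move=> w; exact: zetal.
by rewrite lee_fin mulrC ler_wpM2l.
Qed.

Lemma window_sum_le (t : seq int) x w : `|window_sum t x w| <= (size t)%:R * V.
Proof.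
elim: t => [|k t IH]; first by rewrite /window_sum big_nil normr0 mul0r.
rewrite /window_sum big_cons; apply: le_trans (ler_normD _ _) _.
by rewrite /= -natr1 mulrDl mul1r addrC lerD//; exact: zetaV.
Qed.

Let mzx x : measurable_fun setT (zeta x).
Proof. by have [] := bz x (@measurable_id _ R setT). Qed.

Lemma iter_int_window_shift (t : seq int) (m : int) (r : R) :
  II (fun x w => `|window_sum (map (fun k => k + m) t) x w| `^ r) =
  II (fun x w => `|window_sum t x w| `^ r).
Proof.
apply: eq_integral => x _.
have := @ge0_integral_stationary _ _ _ _ Y statY (zeta x) (mzx x) t 0 0 m
  (fun v => (`|v.1.1| `^ r)%:E).
rewrite /window_sum; under [in X in _ -> X = _]eq_integral do rewrite big_map.
apply; last by move=> v; rewrite lee_fin powR_ge0.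
apply/measurable_EFinP; apply: (@measurableT_comp _ _ _ _ _ _ (@powR R ^~ r)) => //.
apply: measurableT_comp => //; exact: measurableT_comp measurable_fst measurable_fst.
Qed.

Let p0 : 0 < p. Proof. by have := p4; lra. Qed.

Let hoelder_D a' (t : seq int) (g : R -> T -> R) (UB X : R) : 
  0 < a' < p -> jbm g -> (forall x w, 0 <= g x w) -> 0 <= UB -> 0 <= X ->
  (II (fun x w => (`|window_sum t x w| `^ p)%R) <= UB%:E)%E ->
  (II (fun x w => (g x w `^ (p / (p - a')))%R) <= X%:E)%E ->
  (II (fun x w => `|window_sum t x w| `^ a' * g x w)%R <=
   (UB `^ (a' / p) * X `^ ((p - a') / p))%:E)%E.
Proof.
move=> /andP[a0 ap] jg g0 U0 X0 HU HX; rewrite -[a' / p]invf_div -[(p - a') / p]invf_div.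
have jf : jbm (fun x w => `|window_sum t x w| `^ a') by exact: (jP (ltW a0) (jS t)).
have f0 x w : 0 <= `|window_sum t x w| `^ a' by exact: powR_ge0.
have e1 : 0 < p / a' by rewrite divr_gt0.
have e2 : 0 < p / (p - a') by rewrite divr_gt0// subr_gt0.
have e3 : (p / a')^-1 + (p / (p - a'))^-1 = 1.
  by rewrite !invf_div -mulrDl addrC subrK divff// gt_eqF.
have HU' : (II (fun x w => ((`|window_sum t x w| `^ a') `^ (p / a'))%R) <= UB%:E)%E.
  rewrite (_ : (fun x w => _) = (fun x w => `|window_sum t x w| `^ p))//.
  by apply/funext => x; apply/funext => w; rewrite -powRrM mulrC divfK// gt_eqF.
exact: (iter_int_hoelder jf jg f0 g0 e1 e2 e3 U0 X0 HU' HX).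
Qed.

Let shift_psi (t : seq int) (i j m : int) (a' : R) x : 0 <= a' ->
  \int[P]_w (`|window_sum (map (fun k => k + m) t) x w| `^ a' * (summand (i + m) x w * summand (j + m) x w)) =
  \int[P]_w (`|window_sum t x w| `^ a' * (summand i x w * summand j x w)).
Proof.
move=> a0; set M : R := (size t)%:R * V; have M0 : 0 <= M by rewrite mulr_ge0.
(* Stationarity is available for bounded functions; truncating the sum at the bound M that it never
   exceeds changes nothing. *)
pose psi (v : R * R * R) := `|Num.min `|v.1.1| M| `^ a' * (zeta x v.1.2 * zeta x v.2).
have bpsi : bounded_measurable psi.
  apply: bounded_measurableM.
    apply: bounded_measurable_powR => //; split.
      apply: (@measurable_minr _ _ _ setT (fun v : R * R * R => `|v.1.1|) (cst M)) => //.
      apply: measurableT_comp => //; exact: measurableT_comp measurable_fst measurable_fst.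
    by exists M => v; rewrite ger0_norm ?le_min ?normr_ge0//= ge_min lexx orbT.
  apply: bounded_measurableM; apply: bz.
    exact: measurableT_comp measurable_snd measurable_fst.
  exact: measurable_snd.
have psiE (t' : seq int) i' j' w : (size t' <= size t)%N ->
    `|window_sum t' x w| `^ a' * (summand i' x w * summand j' x w) = psi (window_sum t' x w, Y i' w, Y j' w).
  move=> st; rewrite /psi/= min_l ?normr_id//.
  by apply: le_trans (window_sum_le _ _ _) _; rewrite ler_wpM2r// ler_nat.
have := @Rint_stationary _ _ _ _ Y statY (zeta x) (mzx x) t i j m psi bpsi.
under [in X in X -> _]eq_Rintegral => w _.
  rewrite (_ : \sum_(k <- t) _ = window_sum (map (fun k => k + m) t) x w); last by rewrite /window_sum big_map.
  rewrite -psiE ?size_map//; over.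
move=> ->; apply: eq_Rintegral => w _; by rewrite -psiE.
Qed.

Let cov_shift (i j : nat) x : (j <= i)%N ->
  cov i j x = \int[P]_w (summand (i - j)%N x w * summand 0 x w).
Proof.
move=> ji; have := @shift_psi [::] (i - j)%N 0 j 0 x (lexx _).
rewrite -PoszD subnK// add0r /cov.
by under eq_Rintegral do rewrite powRr0 mul1r; under [in X in _ = X -> _]eq_Rintegral do rewrite powRr0 mul1r.
Qed.

Let past_section f x : jbp f -> bounded_measurable (f x : pastType Y -> R).
Proof. exact: (@jointly_bm_section _ (pastType Y) R f x). Qed.

Let cond1 i (D : R -> T -> R) x : (0 < i)%N -> jbp D ->
  \int[P]_w (D x w * summand i x w) = \int[P]_w (D x w * \int[Q i i w]_z zeta x z.1).
Proof.
move=> i0 bD; apply: (@cond_Rint _ _ _ _ Y i i (Q i i) (condQ i0 i0) (D x) (fun z => zeta x z.1)).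
  exact: past_section.
by apply: bz; exact: measurable_fst.
Qed.

(** Shifted to times l and 0, the earlier variable belongs to the past and the later one is replaced
    by its conditional mean, at most V b. At gap 0 the bound |zeta| <= V is enough. *)
Lemma cov_le (i j : nat) x : (j <= i)%N -> `|cov i j x| <= cl (i - j)%N x.
Proof.
move=> ji; rewrite cov_shift// /cl; set l := (i - j)%N.
have jb : bounded_measurable (fun w => bl l w * `|summand 0 x w|).
  exact: (jointly_bm_section x (jM (jointly_bm_cst2 (bl_bm l)) (jN (jZ 0)))).
have [l0|l0] := posnP l.
  apply: le_trans (Rint_norm P1 (jointly_bm_section x (jM (jZ l) (jZ 0)))) _.
  rewrite -RintZ//; apply: Rint_le => //.
  - exact: (jointly_bm_section x (jN (jM (jZ l) (jZ 0)))).
  - exact: bounded_measurableM (bounded_measurable_cst _ _) jb.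
  - by move=> w; rewrite normrM /bl l0 eqxx mul1r ler_wpM2r//; exact: zetaV.
under eq_Rintegral do rewrite mulrC.
rewrite (cond1 x l0 (pZ (lexx 0))).
have jc1 := jbp_jbm (@pcond l l _ bz1).
apply: le_trans (Rint_norm P1 (jointly_bm_section x (jM (jZ 0) jc1))) _.
rewrite -RintZ//; apply: Rint_le => //.
- exact: (jointly_bm_section x (jN (jM (jZ 0) jc1))).
- exact: bounded_measurableM (bounded_measurable_cst _ _) jb.
- move=> w; rewrite normrM mulrC mulrA ler_wpM2r// /bl gtn_eqF//; exact: disc1.
Qed.

Let Aw : R := V `^ (p / 2) * s `^ q * l1.
Let Bw : R := V ^+ 2 * L.

Let Aw0 : 0 <= Aw. Proof. by rewrite !mulr_ge0// powR_ge0. Qed.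
Let Bw0 : 0 <= Bw. Proof. by rewrite mulr_ge0// sqr_ge0. Qed.

(* For a pair (i, j) with gap l = i - j. As beta decays, beta (maxn l j) `^ (2 / p) is at
   most a product of a function of l and one of j, so that summing the second term over
   the pairs costs the square of a single sum. *)
Definition pair_bound (l j : nat) : R :=
  (Aw * beta l) `^ (2 / p) + (2 `^ (p / 2) * Bw * beta (maxn l j)) `^ (2 / p).

Let past_shift (t : seq int) (j : nat) : all (fun k => k <= 0) t ->
  all (fun k => k <= 0) (map (fun k => k - j%:Z) t).
Proof. by rewrite all_map; apply: sub_all => k /= k0; rewrite lerBlDr add0r (le_trans k0). Qed.

(** The expectation on the left has no sign, whereas the rules for [iter_int] concern nonnegative
    functions. A nonnegative H is therefore produced that dominates it in mean for every x and can
    be summed over pairs before integrating in x. *)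
Lemma pair_estimate (t : seq int) (i j : nat) (UB : R) : (0 < j <= i)%N -> 0 <= UB ->
  all (fun k => k <= 0) t ->
  (II (fun x w => (`|window_sum t x w| `^ p)%R) <= UB%:E)%E ->
  exists H : R -> T -> R, [/\ jbm H, forall x w, 0 <= H x w,
    forall x, \int[P]_w (`|window_sum t x w| `^ (p - 2) * (summand i x w * summand j x w)) <= \int[P]_w H x w &
    (II H <= (UB `^ ((p - 2) / p) * pair_bound (i - j) j)%:E)%E].
Proof.
move=> /[dup] ij /andP[j0 ji] U0 tp HU; set l := (i - j)%N.
have i0 : (0 < i)%N by exact: leq_trans ji.
have p2p : 0 < p - 2 < p by apply/andP; have := p4; split; lra.
have e2 : p - (p - 2) = 2 by ring.
have half X : X = p / 2 -> 0 <= X by move=> ->; have := p0; lra.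
(* When the gap dominates, shift the pair to (l, 0): summand 0 is then part of the past,
   and the decay comes from the conditional mean of summand l. *)
have [jl|lj] := leqP j l.
  have l0 : (0 < l)%N by exact: leq_trans jl.
  set t' := map (fun k => k - j%:Z) t; have t'p : all (fun k => k <= 0) t' by exact: past_shift.
  set g := fun x w => `|summand 0 x w| * om l x w.
  have jg : jbm g by exact: (jM (jN (jZ 0)) (jbp_jbm (pom l))).
  have g0 x w : 0 <= g x w by rewrite mulr_ge0.
  have pD : jbp (fun x w => `|window_sum t' x w| `^ (p - 2)) by exact: (pP p2_ge0 (pS t'p)).
  exists (fun x w => `|window_sum t' x w| `^ (p - 2) * g x w); split.
  - exact: (jM (jbp_jbm pD) jg).
  - by move=> x w; rewrite mulr_ge0 ?powR_ge0.
  - move=> x; rewrite -(@shift_psi t i j (- j%:Z) (p - 2) x)// subzn// subrr.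
    have pDz : jbp (fun x w => `|window_sum t' x w| `^ (p - 2) * summand 0 x w) by exact: (pM pD (pZ (lexx 0))).
    under eq_Rintegral do rewrite [summand (i - j)%N _ _ * _]mulrC mulrA.
    rewrite (cond1 x l0 pDz).
    apply: Rint_le => //.
    + exact: (jointly_bm_section x (jM (jbp_jbm pDz) (jbp_jbm (@pcond l l _ bz1)))).
    + exact: (jointly_bm_section x (jM (jbp_jbm pD) jg)).
    + move=> w; rewrite -mulrA ler_wpM2l ?powR_ge0//.
      by apply: le_trans (ler_norm _) _; rewrite normrM.
  have HX := iter_int_gap l0.
  have X0 : 0 <= V ^+ 2 * L * beta l by rewrite mulr_ge0.
  apply: le_trans (@hoelder_D (p - 2) t' g UB _ p2p jg g0 U0 X0 _ _) _.
  - by rewrite iter_int_window_shift.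
  - by rewrite e2.
  rewrite lee_fin ler_wpM2l ?powR_ge0// e2 /pair_bound (maxn_idPl jl).
  apply: le_trans (_ : (2 `^ (p / 2) * Bw * beta l) `^ (2 / p) <= _); last by rewrite lerDr powR_ge0.
  apply: ge0_ler_powR; rewrite ?nnegrE ?divr_ge0 ?(ltW p0)//.
    by rewrite mulr_ge0// mulr_ge0// powR_ge0.
  rewrite ler_wpM2r// ler_peMl// -[X in X <= _](powRr0 2) ler_powR//; first by rewrite ler1n.
  by have := p0; lra.
(* Otherwise replace the conditional covariance by the covariance: the error decays in j,
   and the covariance, of size s, in the gap. *)
have jD' : jbm (fun x w => `|window_sum t x w| `^ (p - 2)) by exact: (jP p2_ge0 (jS t)).
have pD : jbp (fun x w => `|window_sum t x w| `^ (p - 2)) by exact: (pP p2_ge0 (pS tp)).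
have jcl' : jbm (fun x _ => cl l x) by exact: jointly_bm_cst1.
have jW : jbm (Wij i j) by exact/jbp_jbm/pW.
have W0 x w : 0 <= Wij i j x w by exact: normr_ge0.
have jDc := jM jD' jcl'; have jDW := jM jD' jW.
have Dc0 x w : 0 <= `|window_sum t x w| `^ (p - 2) * cl l x by rewrite mulr_ge0 ?powR_ge0.
have DW0 x w : 0 <= `|window_sum t x w| `^ (p - 2) * Wij i j x w by rewrite mulr_ge0 ?powR_ge0.
exists (fun x w => `|window_sum t x w| `^ (p - 2) * cl l x + `|window_sum t x w| `^ (p - 2) * Wij i j x w); split.
- exact: (jD jDc jDW).
- by move=> x w; rewrite addr_ge0.
- move=> x; rewrite (@cond_Rint _ _ _ _ Y i j (Q i j) (condQ i0 j0) (fun w => `|window_sum t x w| `^ (p - 2)) (fun z => zeta x z.1 * zeta x z.2) (past_section x pD) (bzz x)).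
  apply: Rint_le => //.
  + exact: (jointly_bm_section x (jM jD' (jbp_jbm (pzz i j)))).
  + exact: (jointly_bm_section x (jD jDc jDW)).
  + move=> w; rewrite -mulrDr ler_wpM2l ?powR_ge0//.
    rewrite -(subrK (cov i j x) (\int[Q i j w]_z _)) addrC lerD ?ler_norm//.
    by apply: le_trans (ler_norm _) _; exact: cov_le.
rewrite /II iter_intD// mulrDr EFinD leeD//.
- have X0 : 0 <= Aw * beta l by rewrite mulr_ge0.
  have := @hoelder_D (p - 2) t (fun x _ => cl l x) UB _ p2p jcl' (fun x _ => cl_ge0 l x) U0 X0 HU.
  by rewrite e2; apply; exact: iter_int_variance.
- have X0 : 0 <= 2 `^ (p / 2) * V ^+ 2 * L * beta j by rewrite mulr_ge0// mulr_ge0// mulr_ge0 ?powR_ge0 ?sqr_ge0.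
  have := @hoelder_D (p - 2) t (Wij i j) UB _ p2p jW W0 U0 X0 HU.
  rewrite e2 (maxn_idPr (ltnW lj)) /Bw [2 `^ _ * (_ * _)]mulrA; apply; exact: iter_int_cond_cov.
Qed.

(** The factor before the summand is F_0-measurable and of size |S|^(p-1), so the summand becomes
    its conditional mean; Hoelder's inequality with exponents p/(p-1) and p concludes. *)
Lemma linear_estimate (t : seq int) (i : nat) (UB : R) : (0 < i)%N -> 0 <= UB ->
  all (fun k => k <= 0) t ->
  (II (fun x w => (`|window_sum t x w| `^ p)%R) <= UB%:E)%E ->
  exists H : R -> T -> R, [/\ jbm H, forall x w, 0 <= H x w,
    forall x, \int[P]_w (window_sum t x w * `|window_sum t x w| `^ (p - 2) * summand i x w) <= \int[P]_w H x w &
    (II H <= (UB `^ ((p - 1) / p) * (Bw * beta i) `^ p^-1)%:E)%E].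
Proof.
move=> i0 U0 tp HU; have p11 : 0 < p - 1 < p by apply/andP; have := p4; split; lra.
have p10 : 0 <= p - 1 by have := p4; lra.
have e1 : p - (p - 1) = 1 by ring.
have jo : jbm (om i) by exact/jbp_jbm/pom.
exists (fun x w => `|window_sum t x w| `^ (p - 1) * om i x w); split.
- exact: (jM (jP p10 (jS t)) jo).
- by move=> x w; rewrite mulr_ge0 ?powR_ge0.
- move=> x; have pD : jbp (fun x w => window_sum t x w * `|window_sum t x w| `^ (p - 2)).
    exact: (pM (pS tp) (pP p2_ge0 (pS tp))).
  rewrite (cond1 x i0 pD); apply: Rint_le => //.
  + exact: (jointly_bm_section x (jM (jbp_jbm pD) (jbp_jbm (@pcond i i _ bz1)))).
  + exact: (jointly_bm_section x (jM (jP p10 (jS t)) jo)).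
  move=> w; apply: le_trans (ler_norm _) _; rewrite !normrM ler_wpM2r//.
  rewrite (ger0_norm (powR_ge0 _ _)) (_ : p - 2 = (p - 1) - 1); last by ring.
  by rewrite mulr_powRB1// ?normr_ge0//; case/andP: p11.
have X0 : 0 <= Bw * beta i by rewrite mulr_ge0.
have := @hoelder_D (p - 1) t (om i) UB _ p11 jo (om_ge0 i) U0 X0 HU.
rewrite e1 divr1 div1r; apply; exact: iter_int_cond_mean.
Qed.

End rosenthal_step.

(** * Adding two blocks *)

(** Reindex the pairs by their gap and smaller element, then enlarge the triangle to a square. The
    factor 2 accounts for the two orders, the diagonal being counted twice. *)
Lemma sum_gap_le (R : realDomainType) (F : nat -> nat -> R) (n N : nat) :
  (forall l j, 0 <= F l j) -> (n <= N)%N ->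
  \sum_(i < n) \sum_(j < n) F (maxn i j - minn i j)%N (minn i j) <=
  2 * \sum_(l < N) \sum_(j < N) F l j.
Proof.
move=> F0 nN.
set S := \sum_(i < n) \sum_(j < n | (j <= i)%N) F (i - j)%N j.
have SN : S <= \sum_(l < N) \sum_(j < N) F l j.
  rewrite /S (exchange_big_dep predT)//= exchange_big/=.
  rewrite (big_ord_widen N (fun j : nat => \sum_(i < n | (j <= i)%N) F (i - j)%N j) nN).
  rewrite big_mkcond/=; apply: ler_sum => j _; case: ifP => _; last exact: sumr_ge0.
  rewrite -(big_mkord (fun i => (j <= i)%N) (fun i => F (i - j)%N j)).
  rewrite (_ : \sum_(0 <= i < n | _) _ = \sum_(j <= i < n) F (i - j)%N j); last by rewrite (big_nat_widenl j 0).
  rewrite -{1}(add0n j) big_addn.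
  under eq_bigr do rewrite addnK.
  rewrite big_mkord (big_ord_widen N (F ^~ j)) ?(leq_trans (leq_subr _ _))//.
  by rewrite big_mkcond; apply: ler_sum => l _; case: ifP.
apply: le_trans (_ : S + S <= _); last by rewrite mulr_natl mulr2n lerD.
have {2}-> : S = \sum_(i < n) \sum_(j < n | (i <= j)%N) F (j - i)%N i.
  by rewrite /S (exchange_big_dep predT).
rewrite -big_split; apply: ler_sum => i _ /=.
rewrite [X in _ <= X + _]big_mkcond/= [X in _ <= _ + X]big_mkcond/= -big_split/=; apply: ler_sum => j _.
case: leqP => ij; first by rewrite lerDl; case: ifP.
by rewrite ltnW// add0r.
Qed.

Section block_step.
Context d (T : measurableType d) (R : realType) (P : probability T R).
Local Notation mu := (@lebesgue_measure R).
Variable Y : int -> {RV P >-> R}.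
Hypothesis statY : stationary Y.
Variable zeta : R -> R -> R.
Hypothesis mzeta : measurable_fun setT (fun xy : R * R => zeta xy.1 xy.2).
Variables (p V : R) (F : nat -> nat -> R) (G : nat -> R).
Hypothesis p4 : 4 <= p.
Hypothesis zetaV : forall x y, `|zeta x y| <= V.
Hypothesis F0 : forall l j, 0 <= F l j.
Hypothesis G0 : forall i, 0 <= G i.

Local Notation jbm := (@jointly_bm d T R).
Local Notation II := (@iter_int d T R P).
Local Notation summand := (summand Y zeta).
Local Notation window_sum := (window_sum Y zeta).

Hypothesis pairs : forall (t : seq int) (i j : nat) (UB : R), (0 < j <= i)%N -> 0 <= UB ->
  all (fun k => k <= 0) t ->
  (II (fun x w => (`|window_sum t x w| `^ p)%R) <= UB%:E)%E ->
  exists H : R -> T -> R, [/\ jbm H, forall x w, 0 <= H x w,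
    forall x, \int[P]_w (`|window_sum t x w| `^ (p - 2) * (summand i x w * summand j x w)) <= \int[P]_w H x w &
    (II H <= (UB `^ ((p - 2) / p) * F (i - j) j)%:E)%E].

Hypothesis singles : forall (t : seq int) (i : nat) (UB : R), (0 < i)%N -> 0 <= UB ->
  all (fun k => k <= 0) t ->
  (II (fun x w => (`|window_sum t x w| `^ p)%R) <= UB%:E)%E ->
  exists H : R -> T -> R, [/\ jbm H, forall x w, 0 <= H x w,
    forall x, \int[P]_w (window_sum t x w * `|window_sum t x w| `^ (p - 2) * summand i x w) <= \int[P]_w H x w &
    (II H <= (UB `^ ((p - 1) / p) * G i)%:E)%E].

Let P1 := probability_setT P.

Definition block (n : nat) : seq int := [seq k.+1%:Z | k <- iota 0 n].

Let block_cat n1 n2 : map (fun k => k - n1%:Z) (block (n1 + n2)) =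
  map (fun k => k - n1%:Z) (block n1) ++ block n2.
Proof.
rewrite /block iotaD !map_cat add0n; congr (_ ++ _).
rewrite -[X in iota X _]addn0 iotaDl -!map_comp; apply: eq_map => k /=.
by rewrite -addnS PoszD addrAC subrr add0r.
Qed.

Let past_block n : all (fun k => k <= 0) (map (fun k => k - n%:Z) (block n)).
Proof.
rewrite /block -map_comp all_map; apply/allP => k; rewrite mem_iota add0n => /= kn.
by rewrite lerBlDr add0r lez_nat.
Qed.

Let window_sum_cat t1 t2 x w : window_sum (t1 ++ t2) x w = window_sum t1 x w + window_sum t2 x w.
Proof. exact: big_cat. Qed.

Let window_sum_block n x w : window_sum (block n) x w = \sum_(k < n) summand k.+1 x w.
Proof.
by rewrite /window_sum/block big_map -(big_mkord predT (fun k => summand k.+1 x w)) /index_iota subn0.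
Qed.

Let jM (f g : R -> T -> R) : jbm f -> jbm g -> jbm (fun x w => f x w * g x w).
Proof. by move=> bf bg; exact: bounded_measurableM. Qed.
Let jD (f g : R -> T -> R) : jbm f -> jbm g -> jbm (fun x w => f x w + g x w).
Proof. by move=> bf bg; exact: bounded_measurableD. Qed.
Let jP (f : R -> T -> R) r : 0 <= r -> jbm f -> jbm (fun x w => `|f x w| `^ r).
Proof. by move=> r0 bf; exact: (bounded_measurable_powR r0 bf). Qed.
Let jc (k : R) : jbm (fun _ _ => k).
Proof. exact: bounded_measurable_cst. Qed.
Let jsum (I : Type) (s : seq I) (f : I -> R -> T -> R) : (forall i, jbm (f i)) ->
  jbm (fun x w => \sum_(i <- s) f i x w).
Proof. by move=> jf; exact: (bounded_measurable_sum s (F := fun i xw => f i xw.1 xw.2)). Qed.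

Let jZ k : jbm (summand k).
Proof.
split; last by exists V => xw; exact: zetaV.
have mp : measurable_fun setT (fun xv : R * T => (xv.1, Y k xv.2)).
  apply/measurable_fun_pairP; split; first exact: measurable_fst.
  exact: measurableT_comp (@measurable_funPT _ _ _ _ (Y k)) measurable_snd.
exact: measurableT_comp mzeta mp.
Qed.

Let jS t : jbm (window_sum t).
Proof. exact: jsum. Qed.

Let sec x f : jbm f -> bounded_measurable (f x). Proof. exact: jointly_bm_section. Qed.

Let linear_block t n (UB : R) : 0 <= UB -> all (fun k => k <= 0) t ->
  (II (fun x w => (`|window_sum t x w| `^ p)%R) <= UB%:E)%E ->
  exists H : R -> T -> R, [/\ jbm H, forall x w, 0 <= H x w,
    forall x, \int[P]_w (window_sum t x w * `|window_sum t x w| `^ (p - 2) * window_sum (block n) x w) <= \int[P]_w H x w &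
    (II H <= (UB `^ ((p - 1) / p) * \sum_(k < n) G k.+1)%:E)%E].
Proof.
move=> U0 tp HU.
have [H HP] := choice (fun k : nat => @singles t k.+1 UB isT U0 tp HU).
have jH k : jbm (H k) by have [] := HP k.
have H0 k x w : 0 <= H k x w by have [_ + _ _] := HP k; apply.
have jD1 : jbm (fun x w => window_sum t x w * `|window_sum t x w| `^ (p - 2)).
  by apply: (jM (jS t) (jP _ (jS t))); have := p4; lra.
exists (fun x w => \sum_(k < n) H k x w); split.
- by apply: jsum => k; exact: jH.
- by move=> x w; apply: sumr_ge0.
- move=> x; rewrite Rint_sum//; last by move=> k; exact: sec (jH k).
  under eq_Rintegral do rewrite window_sum_block mulr_sumr.
  rewrite Rint_sum//; last by move=> k; exact: (sec x (jM jD1 (jZ k.+1))).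
  by apply: ler_sum => k _; have [_ _ + _] := HP k; apply.
- rewrite (iter_int_sum P _ (F := fun (k : 'I_n) => H k))//.
  by rewrite mulr_sumr -sumEFin; apply: lee_sum => k _; have [] := HP k.
Qed.

Let quadratic_block t n N (UB : R) : (n <= N)%N -> 0 <= UB -> all (fun k => k <= 0) t ->
  (II (fun x w => (`|window_sum t x w| `^ p)%R) <= UB%:E)%E ->
  exists H : R -> T -> R, [/\ jbm H, forall x w, 0 <= H x w,
    forall x, \int[P]_w (`|window_sum t x w| `^ (p - 2) * window_sum (block n) x w ^+ 2) <= \int[P]_w H x w &
    (II H <= (UB `^ ((p - 2) / p) * (2 * \sum_(l < N) \sum_(j < N) F l j.+1))%:E)%E].
Proof.
move=> nN U0 tp HU.
(* [pairs] is stated for ordered indices, so a general pair is sorted. The successor appears because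
   a block starts at index 1 while the sums start at 0. *)
have sym (ij : nat * nat) : exists H : R -> T -> R, [/\ jbm H, forall x w, 0 <= H x w,
    forall x, \int[P]_w (`|window_sum t x w| `^ (p - 2) * (summand ij.1.+1 x w * summand ij.2.+1 x w)) <= \int[P]_w H x w &
    (II H <= (UB `^ ((p - 2) / p) * F (maxn ij.1 ij.2 - minn ij.1 ij.2) (minn ij.1 ij.2).+1)%:E)%E].
  move: ij => [i j]; have [ij|ij] := leqP i j => /=.
    have [|H [jH H0 HP HU']] := @pairs t j.+1 i.+1 UB _ U0 tp HU; first by rewrite /= ltnS.
    by exists H; split => // x; under eq_Rintegral do rewrite [summand _ _ _ * _]mulrC; exact: HP.
  have [|H [jH H0 HP HU']] := @pairs t i.+1 j.+1 UB _ U0 tp HU; first by rewrite /= ltnS ltnW.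
  by exists H; split.
have [H HP] := choice sym.
have jH k : jbm (H k) by have [] := HP k.
have H0 k x w : 0 <= H k x w by have [_ + _ _] := HP k; apply.
have jA : jbm (fun x w => `|window_sum t x w| `^ (p - 2)).
  by apply: jP (jS t); have := p4; lra.
have jHi (i : 'I_n) : jbm (fun x w => \sum_(j < n) H (nat_of_ord i, nat_of_ord j) x w).
  by apply: jsum => j; exact: jH.
have jAZ (i j : nat) : jbm (fun x w => `|window_sum t x w| `^ (p - 2) * (summand i x w * summand j x w)).
  exact: (jM jA (jM (jZ i) (jZ j))).
have jAZi (i : 'I_n) : jbm (fun x w => \sum_(j < n) `|window_sum t x w| `^ (p - 2) * (summand i.+1 x w * summand j.+1 x w)).
  by apply: jsum => j; exact: jAZ.
exists (fun x w => \sum_(i < n) \sum_(j < n) H (nat_of_ord i, nat_of_ord j) x w); split.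
- by apply: jsum => i; exact: jHi.
- by move=> x w; apply: sumr_ge0 => i _; exact: sumr_ge0.
- move=> x; rewrite Rint_sum//; last by move=> i; exact: sec (jHi i).
  rewrite (_ : \int[P]_w _ = \int[P]_w \sum_(i < n) \sum_(j < n) `|window_sum t x w| `^ (p - 2) * (summand i.+1 x w * summand j.+1 x w)); last first.
    apply: eq_Rintegral => w _; rewrite window_sum_block expr2 mulr_suml mulr_sumr.
    by apply: eq_bigr => i _; rewrite !mulr_sumr.
  rewrite Rint_sum//; last by move=> i; exact: sec (jAZi i).
  apply: ler_sum => i _; rewrite !Rint_sum//; last 2 first.
  + by move=> j; exact: sec (jH _).
  + by move=> j; exact: (sec x (jAZ _ _)).
  by apply: ler_sum => j _; have [_ _ + _] := HP (nat_of_ord i, nat_of_ord j); apply.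
- rewrite (iter_int_sum P _ (F := fun (i : 'I_n) x w => \sum_(j < n) H (nat_of_ord i, nat_of_ord j) x w))//; last first.
    by move=> i x w; exact: sumr_ge0.
  apply: le_trans (_ : (UB `^ ((p - 2) / p) * \sum_(i < n) \sum_(j < n) F (maxn i j - minn i j)%N (minn i j).+1)%:E <= _)%E; last first.
    by rewrite lee_fin ler_wpM2l ?powR_ge0// (@sum_gap_le R (fun l j => F l j.+1)).
  rewrite mulr_sumr -sumEFin; apply: lee_sum => i _.
  rewrite (iter_int_sum P _ (F := fun (j : 'I_n) => H (nat_of_ord i, nat_of_ord j)))//.
  rewrite mulr_sumr -sumEFin; apply: lee_sum => j _.
  by have [_ _ _] := HP (nat_of_ord i, nat_of_ord j).
Qed.

(** M bounds the linear term of the expansion and J the quadratic one. Both pass from the second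
    block to sums up to N, which are larger since their terms are nonnegative. The last product is
    the remainder, interpolated between J and the p-th moment of the second block. *)
Lemma block_step n1 n2 N (UB : R) : (n2 <= N)%N -> 0 <= UB ->
  (II (fun x w => (`|window_sum (block n1) x w| `^ p)%R) <= UB%:E)%E ->
  (II (fun x w => (`|window_sum (block n2) x w| `^ p)%R) <= UB%:E)%E ->
  let M := UB `^ ((p - 1) / p) * \sum_(k < N) G k.+1 in
  let J := UB `^ ((p - 2) / p) * (2 * \sum_(l < N) \sum_(j < N) F l j.+1) in
  is_true (II (fun x w => (`|window_sum (block (n1 + n2)) x w| `^ p)%R) <=
   (2 * UB + (p * M + rosenthal_const p * (J + J `^ (p - 2)^-1 * UB `^ ((p - 3) / (p - 2)))))%:E)%E.
Proof.
move=> nN U0 HU1 HU2 M J; set t := map (fun k => k - n1%:Z) (block n1).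
have tp : all (fun k => k <= 0) t by exact: past_block.
have HUt : (II (fun x w => (`|window_sum t x w| `^ p)%R) <= UB%:E)%E.
  by rewrite (iter_int_window_shift statY mzeta zetaV).
have [Hl [jHl Hl0 Hlx HlU]] := @linear_block t n2 UB U0 tp HUt.
have [Hq [jHq Hq0 Hqx HqU]] := @quadratic_block t n2 N UB nN U0 tp HUt.
have C0 : 0 <= rosenthal_const p by rewrite addr_ge0 ?taylor_const_ge0//; have := p4; lra.
rewrite -(iter_int_window_shift statY mzeta zetaV _ (- n1%:Z)) block_cat -/t.
have p2 : 0 < p - 2 by have := p4; lra.
have p3 : 0 < p - 3 by have := p4; lra.
have p0 : 0 <= p by have := p4; lra.
set x1 := window_sum t; set y := window_sum (block n2).
have jx : jbm x1 by exact: jS.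
have jy : jbm y by exact: jS.
set E3 := fun x w => `|x1 x w| * `|y x w| `^ (p - 1).
have jy1 : jbm (fun x w => `|y x w| `^ (p - 1)) by apply: jP jy; have := p4; lra.
have jx1 : jbm (fun x w => `|x1 x w|) by exact: bounded_measurable_norm.
have jE3 : jbm E3 by exact: (jM jx1 jy1).
have E30 x w : 0 <= E3 x w by rewrite mulr_ge0 ?powR_ge0.
have jxp : jbm (fun x w => `|x1 x w| `^ p) by exact: jP.
have jyp : jbm (fun x w => `|y x w| `^ p) by exact: jP.
have jxp2 : jbm (fun x w => `|x1 x w| `^ (p - 2)) by exact: (jP (ltW p2) jx).
have jl : jbm (fun x w => x1 x w * `|x1 x w| `^ (p - 2) * y x w) by exact: (jM (jM jx jxp2) jy).
have jq : jbm (fun x w => `|x1 x w| `^ (p - 2) * y x w ^+ 2) by exact: (jM jxp2 (jM jy jy)).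
have q0 x w : 0 <= `|x1 x w| `^ (p - 2) * y x w ^+ 2 by rewrite mulr_ge0 ?powR_ge0 ?sqr_ge0.
have J0 : 0 <= J.
  by rewrite mulr_ge0 ?powR_ge0// mulr_ge0//; apply: sumr_ge0 => l _; exact: sumr_ge0.
have HqJ : (II (fun x w => `|x1 x w| `^ (p - 2) * y x w ^+ 2)%R <= J%:E)%E.
  by apply: le_trans HqU; exact: iter_int_le.
have HE3 : (II E3 <= (J `^ (p - 2)^-1 * UB `^ ((p - 3) / (p - 2)))%:E)%E.
  (* The exponent 1/(p-2) is forced by the single power of |x1| in the remainder. The power of |y|
     left over is p (p-3)/(p-2), exactly the p-th moment under the conjugate exponent
     (p-2)/(p-3). *)
  pose f x w := (`|x1 x w| `^ (p - 2) * y x w ^+ 2) `^ (p - 2)^-1.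
  pose g x w := `|y x w| `^ (p * (p - 3) / (p - 2)).
  have e0 : 0 <= p * (p - 3) / (p - 2) by rewrite divr_ge0 ?mulr_ge0// ltW.
  have i0 : 0 <= (p - 2)^-1 by rewrite invr_ge0 ltW.
  have -> : E3 = (fun x w => f x w * g x w).
    apply/funext => x; apply/funext => w; rewrite /f /g /E3.
    rewrite powRM ?powR_ge0 ?sqr_ge0// -powRrM divff ?gt_eqF// powRr1// -mulrA; congr (_ * _).
    have e : 2 / (p - 2) + p * (p - 3) / (p - 2) = p - 1 by field; rewrite gt_eqF.
    rewrite -[y x w ^+ 2]real_normK ?num_real// -powR_mulrn// -powRrM -powRD e//.
    by apply/implyP => /eqP; have := p4; lra.
  have jf : jbm f.
    rewrite (_ : f = (fun x w => `|(`|x1 x w| `^ (p - 2) * y x w ^+ 2)| `^ (p - 2)^-1)); first exact: jP.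
    by apply/funext => x; apply/funext => w; rewrite /f [in RHS]ger0_norm.
  have jg : jbm g by exact: jP.
  have f0 x w : 0 <= f x w by exact: powR_ge0.
  have g0 x w : 0 <= g x w by exact: powR_ge0.
  have b0 : 0 < (p - 2) / (p - 3) by rewrite divr_gt0.
  have ab : (p - 2)^-1 + ((p - 2) / (p - 3))^-1 = 1 by rewrite invf_div; field; rewrite gt_eqF.
  have fE : (fun x w => f x w `^ (p - 2)) = (fun x w => `|x1 x w| `^ (p - 2) * y x w ^+ 2).
    by apply/funext => x; apply/funext => w; rewrite /f -powRrM mulVf ?gt_eqF// powRr1.
  have gE : (fun x w => g x w `^ ((p - 2) / (p - 3))) = (fun x w => `|y x w| `^ p).
    apply/funext => x; apply/funext => w; rewrite /g -powRrM; congr (_ `^ _).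
    by field; rewrite !gt_eqF.
  rewrite -[(p - 3) / _]invf_div.
  have fJ : (II (fun x w => (f x w `^ (p - 2))%R) <= J%:E)%E.
    rewrite fE; exact: HqJ.
  have gU : (II (fun x w => (g x w `^ ((p - 2) / (p - 3)))%R) <= UB%:E)%E.
    rewrite gE; exact: HU2.
  exact: (iter_int_hoelder jf jg f0 g0 p2 b0 ab J0 U0 fJ gU).
set C := rosenthal_const p in C0 *.
have jA := jD jxp jyp; have jM1 := jM (jc p) jl; have jN1 := jM (jc p) jHl.
have jM2 := jM (jc C) (jD jq jE3); have jN2 := jM (jc C) (jD jHq jE3).
pose lhs x w := (`|x1 x w| `^ p + `|y x w| `^ p) + (p * (x1 x w * `|x1 x w| `^ (p - 2) * y x w) + C * (`|x1 x w| `^ (p - 2) * y x w ^+ 2 + E3 x w)).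
pose rhs x w := (`|x1 x w| `^ p + `|y x w| `^ p) + (p * Hl x w + C * (Hq x w + E3 x w)).
have jlhs : jbm lhs by exact: (jD jA (jD jM1 jM2)).
have jrhs : jbm rhs by exact: (jD jA (jD jN1 jN2)).
have lr x : \int[P]_w lhs x w <= \int[P]_w rhs x w.
  rewrite /lhs /rhs (RintD P1 (sec x jA) (sec x (jD jM1 jM2))) (RintD P1 (sec x jA) (sec x (jD jN1 jN2))).
  rewrite (RintD P1 (sec x jM1) (sec x jM2)) (RintD P1 (sec x jN1) (sec x jN2)).
  rewrite (RintZ P1 _ (sec x jl)) (RintZ P1 _ (sec x jHl)).
  rewrite (RintZ P1 _ (sec x (jD jq jE3))) (RintZ P1 _ (sec x (jD jHq jE3))).
  rewrite (RintD P1 (sec x jq) (sec x jE3)) (RintD P1 (sec x jHq) (sec x jE3)).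
  rewrite lerD2l lerD//; first by rewrite ler_wpM2l.
  by rewrite ler_wpM2l// lerD2r.
have n1' x w : 0 <= `|x1 x w| `^ p by exact: powR_ge0.
have n2' x w : 0 <= `|y x w| `^ p by exact: powR_ge0.
have n3 x w : 0 <= p * Hl x w by rewrite mulr_ge0.
have n4 x w : 0 <= Hq x w + E3 x w by rewrite addr_ge0.
have n5 x w : 0 <= C * (Hq x w + E3 x w) by rewrite mulr_ge0.
have n6 x w : 0 <= `|x1 x w| `^ p + `|y x w| `^ p by rewrite addr_ge0.
have n7 x w : 0 <= p * Hl x w + C * (Hq x w + E3 x w) by rewrite addr_ge0.
have jSc : jbm (fun x w => `|window_sum (t ++ block n2) x w| `^ p) by exact: (jP p0 (jS _)).
apply: le_trans (iter_int_le (g := rhs) jSc jrhs _ _) _.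
- by move=> x w; exact: powR_ge0.
- move=> x; apply: le_trans (lr x); apply: Rint_le => //; [exact: (sec x jSc)|exact: (sec x jlhs)|].
  move=> w; rewrite window_sum_cat; apply: le_trans (powR_addr_le _ _ _) _; first by have := p4; lra.
  by rewrite /lhs /E3 -/C -/x1 -/y -!addrA !mulrA.
rewrite /rhs (iter_intD P jA (jD jN1 jN2) n6 n7) (iter_intD P jxp jyp n1' n2') (iter_intD P jN1 jN2 n3 n5).
rewrite (iter_intZ P p0 jHl Hl0) (iter_intZ P C0 (jD jHq jE3) n4) (iter_intD P jHq jE3 Hq0 E30).
rewrite (EFinD (2 * UB)); apply: leeD.
  rewrite mulr_natl mulr2n (EFinD UB); apply: leeD; [exact: HUt|exact: HU2].
rewrite (EFinD (p * M)); apply: leeD.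
  rewrite (EFinM p) lee_wpmul2l ?lee_fin//; apply: le_trans HlU _.
  rewrite lee_fin ler_wpM2l ?powR_ge0//.
  rewrite (big_ord_widen N (fun k => G k.+1) nN) big_mkcond/=.
  by apply: ler_sum => k _; case: ifP.
rewrite (EFinM C) lee_wpmul2l ?lee_fin// (EFinD J); apply: leeD; [exact: HqU|exact: HE3].
Qed.

End block_step.

(** * The Rosenthal inequality *)

Section power_interpolation.
Context {R : realType}.
Implicit Types p U X J M C : R.

(** When X <= U the smallest exponent on X gives the largest product; otherwise the product is at
    most X. This brings error terms with different exponents to a single one. *)
Lemma powR_interpolation_le U X (t t' : R) : 0 <= U -> 0 <= X -> 0 < t < 1 -> t <= t' <= 1 ->
  U `^ (1 - t') * X `^ t' <= U `^ (1 - t) * X `^ t + X.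
Proof.
move=> U0 X0 /andP[t0 t1] /andP[tt' t'1]; have t'0 : 0 < t' by exact: lt_le_trans tt'.
have [XU|/ltW UX] := leP X U.
  apply: le_trans (_ : U `^ (1 - t) * X `^ t <= _); last by rewrite lerDl.
  have -> : X `^ t' = X `^ (t' - t) * X `^ t by rewrite -powRD ?subrK// gt_eqF.
  rewrite mulrA ler_wpM2r ?powR_ge0//.
  have -> : U `^ (1 - t) = U `^ (1 - t') * U `^ (t' - t).
    have e : 1 - t' + (t' - t) = 1 - t by ring.
    by rewrite -powRD e// gt_eqF// subr_gt0.
  by rewrite ler_wpM2l ?powR_ge0// ge0_ler_powR ?nnegrE ?subr_ge0.
apply: le_trans (_ : X <= _); last by rewrite lerDr mulr_ge0 ?powR_ge0.
apply: le_trans (_ : X `^ (1 - t') * X `^ t' <= _).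
  by rewrite ler_wpM2r ?powR_ge0// ge0_ler_powR ?nnegrE ?subr_ge0.
by rewrite -powRD ?subrK ?oner_eq0// powRr1.
Qed.

(** The exponents of X are 1/p in the linear term, 2/p in the quadratic one and 2/(p(p-2)) in the
    remainder, the smallest. With 8^(1/(p-2)) <= 8, the last two contribute 8 + 8, whence
    [16 * C]. *)
Lemma block_step_le p U X M J C : 4 <= p -> 0 <= U -> 0 <= X -> 0 <= C ->
  M <= U `^ ((p - 1) / p) * X `^ p^-1 ->
  0 <= J <= U `^ ((p - 2) / p) * (8 * X `^ (2 / p)) ->
  p * M + C * (J + J `^ (p - 2)^-1 * U `^ ((p - 3) / (p - 2))) <=
  (p + 16 * C) * (U `^ (1 - 2 / (p * (p - 2))) * X `^ (2 / (p * (p - 2))) + X).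
Proof.
move=> p4 U0 X0 C0 HM /andP[J0 HJ].
have p0 : 0 < p by lra.
have p2 : 0 < p - 2 by lra.
have p22 : 0 < p * (p - 2) by exact: mulr_gt0.
set t := 2 / (p * (p - 2)); set Z := U `^ (1 - t) * X `^ t + X.
have t0 : 0 < t by rewrite divr_gt0.
have t1 : t < 1 by rewrite ltr_pdivrMr// mul1r; nra.
have tp : t <= p^-1.
  by rewrite /t invfM mulrCA ler_piMr ?invr_ge0 ?(ltW p0)// ler_pdivrMr// mul1r; lra.
have p1 : p^-1 <= 1 by rewrite invf_le1//; lra.
have HZ t' : t <= t' <= 1 -> U `^ (1 - t') * X `^ t' <= Z.
  by move=> ht'; apply: powR_interpolation_le => //; rewrite t0.
have h1 : M <= Z.
  apply: le_trans HM _; rewrite (_ : (p - 1) / p = 1 - p^-1); last by field; rewrite gt_eqF.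
  by apply: HZ; rewrite tp.
have h2 : J <= 8 * Z.
  apply: le_trans HJ _; rewrite mulrCA ler_wpM2l//.
  rewrite (_ : (p - 2) / p = 1 - 2 / p); last by field; rewrite gt_eqF.
  apply: HZ; apply/andP; split; last by rewrite ler_pdivrMr// mul1r; lra.
  by apply: le_trans tp _; rewrite -[X in X <= _]mul1r ler_pM2r ?invr_gt0// ler1n.
have h3 : J `^ (p - 2)^-1 * U `^ ((p - 3) / (p - 2)) <= 8 * Z.
  have e0 : 0 <= (p - 2)^-1 by rewrite invr_ge0 ltW.
  apply: le_trans (_ : (U `^ ((p - 2) / p) * (8 * X `^ (2 / p))) `^ (p - 2)^-1 * U `^ ((p - 3) / (p - 2)) <= _).
    by rewrite ler_wpM2r ?powR_ge0// ge0_ler_powR ?nnegrE// mulr_ge0 ?powR_ge0// mulr_ge0 ?powR_ge0.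
  rewrite powRM ?powR_ge0 ?mulr_ge0 ?powR_ge0// powRM ?powR_ge0// -!powRrM.
  have -> : (p - 2) / p * (p - 2)^-1 = p^-1 by field; rewrite !gt_eqF.
  have -> : 2 / p * (p - 2)^-1 = t by rewrite /t; field; rewrite !gt_eqF.
  have -> : U `^ p^-1 * (8 `^ (p - 2)^-1 * X `^ t) * U `^ ((p - 3) / (p - 2)) =
     8 `^ (p - 2)^-1 * ((U `^ p^-1 * U `^ ((p - 3) / (p - 2))) * X `^ t) by ring.
  have e : p^-1 + (p - 3) / (p - 2) = 1 - t by rewrite /t; field; rewrite !gt_eqF.
  rewrite -powRD e; last by rewrite gt_eqF// subr_gt0.
  apply: ler_pM; rewrite ?powR_ge0 ?mulr_ge0 ?powR_ge0//; last by rewrite /Z lerDl.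
  rewrite -[X in _ <= X]powRr1// ler_powR ?ler1n// invf_le1//; lra.
have Z0 : 0 <= Z by rewrite addr_ge0// mulr_ge0 ?powR_ge0.
rewrite [X in _ <= X]mulrDl; apply: lerD; first by rewrite ler_wpM2l// ltW.
by rewrite -mulrA mulrCA ler_wpM2l//; lra.
Qed.

End power_interpolation.

Section mixing_sums.
Context {R : realType}.
Variables (p eta cc V L s l1 : R).
Hypotheses (p4 : 4 <= p) (eta0 : 0 < eta) (eta1 : eta <= 1 / 2) (cc1 : 1 <= cc).
Hypotheses (V0 : 0 <= V) (L0 : 0 <= L) (l10 : 0 <= l1).

(** The shift by one gives a meaning to the rate at 0, where it equals cc >= 1, as the convention
    for gap 0 demands. *)
Definition mixing_rate (k : nat) : R := cc * k.+1%:R `^ (- (p - 1 + eta)).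

Let a := V `^ (p / 2) * s `^ (p / 2 - 1) * l1.
Let b := V ^+ 2 * L.

(** p / (1 - eta) is 1 / (1 - sigma) with sigma = (p - 1 + eta) / p, the constant in the sum of
    k^(-sigma). The factor 2^(p/2) comes from the conditional covariances. *)
Definition mixing_const : R := cc * 2 `^ (p / 2) * (p / (1 - eta)) `^ p.

Let X (N : nat) := mixing_const * (N%:R `^ (p / 2) * a + N%:R `^ (1 - eta) * b).

Let p0 : 0 < p. Proof. by have := p4; lra. Qed.
Let a0 : 0 <= a. Proof. by rewrite !mulr_ge0// powR_ge0. Qed.
Let b0 : 0 <= b. Proof. by rewrite mulr_ge0// sqr_ge0. Qed.
Let cc0 : 0 <= cc. Proof. by have := cc1; lra. Qed.
Let sigma := (p - 1 + eta) / p.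

Let sigma01 : 0 < sigma < 1.
Proof.
apply/andP; split; first by rewrite divr_gt0//; have := p4; have := eta0; lra.
by rewrite ltr_pdivrMr// mul1r; have := eta1; lra.
Qed.

Let K1 : 1 <= p / (1 - eta).
Proof. by rewrite ler_pdivlMr ?mul1r; have := p4; have := eta0; have := eta1; lra. Qed.

Let K0 : 0 <= p / (1 - eta). Proof. by have := K1; lra. Qed.

Let m2 : 1 <= 2 `^ (p / 2) :> R.
Proof.
by rewrite -[X in X <= _](powRr0 2) ler_powR ?ler1n//; have := p0; lra.
Qed.

Let mK : 1 <= (p / (1 - eta)) `^ p.
Proof. by rewrite -[X in X <= _](powRr0 (p / (1 - eta))) ler_powR// ltW. Qed.

Lemma mixing_const_ge0 : 0 <= mixing_const.
Proof. by rewrite !mulr_ge0 ?powR_ge0. Qed.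

Let N0 (N : nat) : 0 <= N%:R :> R. Proof. exact: ler0n. Qed.

Let rate_pow (k : nat) (u r : R) : 0 <= u ->
  (u * mixing_rate k) `^ r = (u * cc) `^ r * k.+1%:R `^ (- (p - 1 + eta) * r).
Proof. by move=> u0; rewrite mulrA powRM ?mulr_ge0 ?powR_ge0// -powRrM. Qed.

Let M (N : nat) : R := \sum_(k < N) k.+1%:R `^ (- sigma).

Let M_le N : M N <= p / (1 - eta) * N%:R `^ (1 - sigma).
Proof.
apply: le_trans (sum_powR_neg_le N sigma01) _; rewrite ler_wpM2r ?powR_ge0//.
rewrite (_ : p / (1 - eta) = (1 - sigma)^-1)// /sigma; field.
by rewrite !gt_eqF//; have := eta1; lra.
Qed.

Let M0 N : 0 <= M N. Proof. by apply: sumr_ge0 => k _; exact: powR_ge0. Qed.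

Let KN N : (p / (1 - eta)) `^ p * N%:R `^ (1 - eta) = (p / (1 - eta) * N%:R `^ (1 - sigma)) `^ p.
Proof.
rewrite (powRM _ K0 (powR_ge0 _ _)) -powRrM; congr (_ * _ `^ _).
by rewrite /sigma; field; rewrite gt_eqF.
Qed.

Let X_ge_a N : N%:R `^ (p / 2) * (a * cc) <= X N.
Proof.
rewrite /X /mixing_const mulrDr; apply: le_trans (_ : cc * 2 `^ (p / 2) * (p / (1 - eta)) `^ p * (N%:R `^ (p / 2) * a) <= _); last first.
  by rewrite lerDl mulr_ge0 ?mixing_const_ge0// mulr_ge0 ?powR_ge0.
rewrite mulrA [X in X <= _]mulrC ler_wpM2r//; first by rewrite mulr_ge0 ?powR_ge0.
by rewrite -mulrA ler_peMr// mulr_ege1.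
Qed.

Let X_ge_b N : (2 `^ (p / 2) * b * cc) * (p / (1 - eta) * N%:R `^ (1 - sigma)) `^ p <= X N.
Proof.
rewrite -KN /X /mixing_const mulrDr.
apply: le_trans (_ : cc * 2 `^ (p / 2) * (p / (1 - eta)) `^ p * (N%:R `^ (1 - eta) * b) <= _).
  by rewrite le_eqVlt; apply/orP; left; apply/eqP; ring.
by rewrite lerDr mulr_ge0 ?mixing_const_ge0// mulr_ge0 ?powR_ge0.
Qed.

Let X0 N : 0 <= X N.
Proof. by rewrite mulr_ge0 ?mixing_const_ge0// addr_ge0// mulr_ge0 ?powR_ge0. Qed.

Lemma mixing_rate_ge0 k : 0 <= mixing_rate k.
Proof. by rewrite mulr_ge0 ?powR_ge0. Qed.

Let decr (k l : nat) (r : R) : 0 <= r -> (k <= l)%N -> l.+1%:R `^ (- r) <= k.+1%:R `^ (- r) :> R.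
Proof.
move=> r0 kl; rewrite !powRN lef_pV2 ?posrE ?powR_gt0 ?ltr0n//.
by rewrite ge0_ler_powR ?nnegrE ?ler0n// ler_nat.
Qed.

Lemma sum_single_rates N :
  \sum_(k < N) (b * mixing_rate k.+1) `^ p^-1 <= X N `^ p^-1.
Proof.
have s0 : 0 <= sigma by case/andP: sigma01 => /ltW.
apply: le_trans (_ : (b * cc) `^ p^-1 * M N <= _).
  rewrite mulr_sumr; apply: ler_sum => k _; rewrite rate_pow// ler_wpM2l ?powR_ge0//.
  by rewrite (_ : _ * p^-1 = - sigma); [exact: decr|rewrite mulNr].
apply: le_trans (_ : (b * cc) `^ p^-1 * (p / (1 - eta) * N%:R `^ (1 - sigma)) <= _).
  by rewrite ler_wpM2l ?powR_ge0.
have Y0 : 0 <= p / (1 - eta) * N%:R `^ (1 - sigma) by rewrite mulr_ge0 ?powR_ge0.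
set Z := p / (1 - eta) * N%:R `^ (1 - sigma) in Y0 *.
have -> : Z = (Z `^ p) `^ p^-1 by rewrite -powRrM mulfV ?gt_eqF// powRr1.
rewrite -powRM ?mulr_ge0 ?powR_ge0//.
apply: ge0_ler_powR; rewrite ?nnegrE ?invr_ge0 ?(ltW p0)//; first by rewrite mulr_ge0 ?powR_ge0// mulr_ge0.
apply: le_trans (X_ge_b N); apply: ler_wpM2r; first exact: powR_ge0.
apply: ler_wpM2r; first exact: cc0.
by apply: ler_peMl; [exact: b0|exact: m2].
Qed.

Let e2p : 0 <= 2 / p. Proof. by rewrite divr_ge0// ltW. Qed.

(** In the part with a, the sum over gaps converges because (p - 1 + eta) 2/p >= 3/2 for p >= 4, and
    the free index gives N, the power 2/p of N^(p/2). In the part with b, the rate at the maximum is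
    at most k^(-sigma) for the gap times the same for the index, so the double sum is at most a
    square. The two parts give 8 = 2 (3 + 1). *)
Lemma sum_pair_rates N :
  2 * \sum_(l < N) \sum_(j < N) pair_bound p V L s l1 mixing_rate l j.+1 <= 8 * X N `^ (2 / p).
Proof.
have s0 : 0 <= sigma by case/andP: sigma01 => /ltW.
have S1 : \sum_(l < N) \sum_(j < N) (a * mixing_rate l) `^ (2 / p) <= 3 * X N `^ (2 / p).
  have -> : \sum_(l < N) \sum_(j < N) (a * mixing_rate l) `^ (2 / p) =
      (a * cc) `^ (2 / p) * (\sum_(l < N) l.+1%:R `^ (- (p - 1 + eta) * (2 / p))) * N%:R.
    rewrite mulr_sumr mulr_suml; apply: eq_bigr => l _.
    by rewrite sumr_const card_ord rate_pow// mulr_natr.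
  apply: le_trans (_ : (a * cc) `^ (2 / p) * 3 * N%:R <= _).
    rewrite ler_wpM2r// ler_wpM2l ?powR_ge0//.
    rewrite mulNr; apply: sum_powR_neg_bounded; rewrite mulrA ler_pdivlMr//.
    by have := p4; have := eta0; lra.
  rewrite mulrAC mulrC ler_wpM2l//.
  have -> : N%:R = (N%:R `^ (p / 2)) `^ (2 / p) :> R.
    by rewrite -powRrM (_ : _ * _ = 1) ?powRr1//; field; rewrite gt_eqF.
  rewrite mulrC -powRM; [|exact: powR_ge0|exact: mulr_ge0 a0 cc0].
  apply: ge0_ler_powR; [exact: e2p|rewrite nnegrE|exact: X0|exact: X_ge_a].
  by apply: mulr_ge0 (powR_ge0 _ _) (mulr_ge0 a0 cc0).
have S2 : \sum_(l < N) \sum_(j < N) (2 `^ (p / 2) * b * mixing_rate (maxn l j.+1)) `^ (2 / p) <= X N `^ (2 / p).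
  set B := 2 `^ (p / 2) * b; have B0 : 0 <= B by rewrite mulr_ge0 ?powR_ge0.
  apply: le_trans (_ : (B * cc) `^ (2 / p) * (M N * M N) <= _).
    rewrite /M mulr_suml mulr_sumr; apply: ler_sum => l _; rewrite !mulr_sumr.
    apply: ler_sum => j _; rewrite rate_pow// ler_wpM2l ?powR_ge0//.
    rewrite (_ : _ * (2 / p) = - sigma + - sigma); last by rewrite /sigma; field; rewrite gt_eqF.
    rewrite powRD; last by rewrite pnatr_eq0 implybT.
    apply: ler_pM; rewrite ?powR_ge0//; apply: decr => //; first exact: leq_maxl.
    by rewrite (leq_trans _ (leq_maxr _ _)).
  set Y := p / (1 - eta) * N%:R `^ (1 - sigma).
  have Y0 : 0 <= Y by rewrite mulr_ge0 ?powR_ge0.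
  apply: le_trans (_ : (B * cc) `^ (2 / p) * Y ^+ 2 <= _).
    by rewrite ler_wpM2l ?powR_ge0// expr2 ler_pM.
  have -> : Y ^+ 2 = (Y `^ p) `^ (2 / p).
    by rewrite -powR_mulrn// -powRrM; congr (_ `^ _); field; rewrite gt_eqF.
  rewrite -powRM ?powR_ge0 ?mulr_ge0//.
  by apply: ge0_ler_powR; rewrite ?nnegrE// ?mulr_ge0 ?powR_ge0//; exact: X_ge_b.
have -> : \sum_(l < N) \sum_(j < N) pair_bound p V L s l1 mixing_rate l j.+1 =
  \sum_(l < N) \sum_(j < N) (a * mixing_rate l) `^ (2 / p) +
  \sum_(l < N) \sum_(j < N) (2 `^ (p / 2) * b * mixing_rate (maxn l j.+1)) `^ (2 / p).
  by rewrite -big_split; apply: eq_bigr => l _; rewrite -big_split.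
have E (u v w : R) : u <= 3 * w -> v <= w -> 2 * (u + v) <= 8 * w.
  by move=> h1 h2; rewrite (_ : 8 * w = 2 * (3 * w + w)); [rewrite ler_pM2l// lerD|ring].
exact: E S1 S2.
Qed.

End mixing_sums.

(** A single sequence u bounds all blocks of length at most 2^r at once, so arbitrary lengths need
    no monotonicity of the moments in n. The constant is fixed before the probability space and
    depends only on p, eta and cc. *)
Lemma rosenthal_inequality (R : realType) (p eta cc : R) :
  4 <= p -> 0 < eta -> eta <= 1 / 2 -> 1 <= cc ->
  exists2 A : R, 0 < A &
  forall d (T : measurableType d) (P : probability T R) (Y : int -> {RV P >-> R})
    (Q : nat -> nat -> R.-pker (pastType Y) ~> (R * R)%type) (zeta : R -> R -> R)
    (V L s l1 : R),
  stationary Y ->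
  (forall i j : nat, (0 < i)%N -> (0 < j)%N -> is_conditional_law i j (Q i j)) ->
  measurable_fun setT (fun xy : R * R => zeta xy.1 xy.2) ->
  0 <= s ->
  (forall x y, `|zeta x y| <= V) ->
  (forall y, (\int[@lebesgue_measure R]_x ((`|zeta x y| `^ (p - 2))%R%:E) <= L%:E)%E) ->
  (forall x, \int[P]_w `|zeta x (Y 0 w)| <= s) ->
  (forall y, (\int[@lebesgue_measure R]_x `|zeta x y|%:E <= l1%:E)%E) ->
  (forall x i w, (0 < i)%N -> `|\int[Q i i w]_z zeta x z.1| <= V * bcoef Q i i w) ->
  (forall x i j w, (0 < i)%N -> (0 < j)%N ->
    `|\int[Q i j w]_z (zeta x z.1 * zeta x z.2) -
      \int[P]_w' (zeta x (Y i%:Z w') * zeta x (Y j%:Z w'))| <= V ^+ 2 * bcoef Q i j w) ->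
  (forall i j, (0 < j <= i)%N -> \int[P]_w bcoef Q i j w <= mixing_rate p eta cc j) ->
  forall n, (0 < n)%N ->
  (iter_int P (fun x w => (`|window_sum Y zeta (block n) x w| `^ p)%R) <=
    (A * (n%:R `^ (p / 2) * (V `^ (p / 2) * s `^ (p / 2 - 1) * l1) + n%:R * (V ^+ 2 * L)))%:E)%E.
Proof.
move=> p4 eta0 eta1 cc1; have p0 : 0 < p by lra.
set D := mixing_const p eta cc; have D0 : 0 <= D by exact: mixing_const_ge0.
set C := rosenthal_const p.
have C0 : 0 <= C by rewrite addr_ge0 ?taylor_const_ge0//; lra.
have c0 : 0 <= p + 16 * C by lra.
have eta01 : 0 < eta <= 1 by apply/andP; split => //; lra.
have [A A0 HA] := dyadic_recursion p4 eta01 c0 D0.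
(* The extra factor pays for rounding n up to a power of two: 2^r <= 2n, and 2 <= 2^(p/2). *)
exists (A * 2 `^ (p / 2)); first by rewrite mulr_gt0// powR_gt0.
move=> d T P Y Q zeta V L s l1 statY condQ mzeta s0 zetaV zetaL zetas zetal disc1 disc2 bcoefM n n0.
have V0 : 0 <= V by exact: le_trans (normr_ge0 _) (zetaV 0 0).
have nonneg (g : R -> R) (M : R) : (forall x, 0 <= g x) ->
    (\int[@lebesgue_measure R]_x (g x)%:E <= M%:E)%E -> 0 <= M.
  by move=> g0 gM; rewrite -lee_fin (le_trans _ gM)// integral_ge0// => x _; rewrite lee_fin.
have L0 : 0 <= L by apply: nonneg (zetaL 0) => x; exact: powR_ge0.
have l10 : 0 <= l1 by exact: nonneg (zetal 0).
set a := V `^ (p / 2) * s `^ (p / 2 - 1) * l1; have a0 : 0 <= a by rewrite !mulr_ge0// powR_ge0.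
set b := V ^+ 2 * L; have b0 : 0 <= b by rewrite mulr_ge0// sqr_ge0.
pose x (r : nat) : R := D * ((2 ^+ r) `^ (p / 2) * a + (2 ^+ r) `^ (1 - eta) * b).
have x0 r : 0 <= x r by rewrite mulr_ge0// addr_ge0// mulr_ge0 ?powR_ge0.
pose t : R := 2 / (p * (p - 2)).
(* The recursion taken with equality. It starts at b, which bounds a single summand because |zeta|^p
   <= V^2 |zeta|^(p-2). *)
pose u r := iteri r (fun k v => 2 * v + (p + 16 * C) * (v `^ (1 - t) * x k `^ t + x k)) b.
have u0 r : 0 <= u r.
  elim: r => //= r IH; apply: addr_ge0; first by rewrite mulr_ge0.
  by rewrite mulr_ge0// addr_ge0// mulr_ge0 ?powR_ge0.
have beta0 : 1 <= mixing_rate p eta cc 0 by rewrite /mixing_rate powR1 mulr1.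
have beta_ge0 k : 0 <= mixing_rate p eta cc k by apply: mixing_rate_ge0.
have bound r m : (m <= 2 ^ r)%N ->
    (iter_int P (fun x w => (`|window_sum Y zeta (block m) x w| `^ p)%R) <= (u r)%:E)%E.
  elim: r m => [|r IH] m mr.
    have [m0|m1] : m = 0%N \/ m = 1%N by move: m mr => [|[|]]//; [left|right].
      rewrite /iter_int (_ : integral _ _ _ = 0%E) ?lee_fin ?u0//.
      apply: integral0_eq => y _; apply: integral0_eq => w _.
      by rewrite m0 /window_sum big_nil normr0 powR0// gt_eqF.
    have bzp : bounded_measurable (fun xy : R * R => `|zeta xy.1 xy.2| `^ (p - 2)).
      apply: bounded_measurable_powR; first by lra.
      by split; [exact: mzeta|exists V => xy; exact: zetaV].
    have jz : jointly_bm (fun y w => zeta y (Y 1 w)).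
      split; last by exists V => yw; exact: zetaV.
      have mp : measurable_fun setT (fun xv : R * T => (xv.1, Y 1 xv.2)).
        apply/measurable_fun_pairP; split; first exact: measurable_fst.
        exact: measurableT_comp (@measurable_funPT _ _ _ _ (Y 1)) measurable_snd.
      exact: measurableT_comp mzeta mp.
    have jzp (q : R) : 0 <= q -> jointly_bm (fun y w => `|zeta y (Y 1 w)| `^ q).
      by move=> q0; exact: (bounded_measurable_powR q0 jz).
    have p2 : 0 <= p - 2 by lra.
    have jp := jzp _ (ltW p0); have jp2 := jzp _ p2.
    have jVp2 : jointly_bm (fun y w => V ^+ 2 * `|zeta y (Y 1 w)| `^ (p - 2)).
      exact: bounded_measurableM (bounded_measurable_cst _ _) jp2.
    rewrite (_ : (fun y w => _) = (fun y w => `|zeta y (Y 1 w)| `^ p)); last first.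
      by apply/funext => y; apply/funext => w; rewrite m1 /window_sum /block/= big_seq1.
    apply: le_trans (iter_int_mono P jp jVp2 _ _) _.
    - by move=> y w; exact: powR_ge0.
    - move=> y w; have e : 2 + (p - 2) = p by ring.
      have -> : `|zeta y (Y 1 w)| `^ p = `|zeta y (Y 1 w)| ^+ 2 * `|zeta y (Y 1 w)| `^ (p - 2).
        by rewrite -powR_mulrn// -powRD e// gt_eqF.
      by rewrite ler_wpM2r ?powR_ge0// lerXn2r ?nnegrE.
    rewrite (iter_intZ P (sqr_ge0 V) jp2); last by move=> y w; exact: powR_ge0.
    rewrite /u/= /b (EFinM (V ^+ 2)) lee_wpmul2l ?lee_fin ?sqr_ge0//.
    rewrite (iter_intE P jp2).
    exact: (@avg_section_bound _ _ _ P (Y 1) (fun x y => `|zeta x y| `^ (p - 2))).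
  (* Cut after at most 2^r terms: both pieces are covered by the induction hypothesis, the second
     being possibly empty. *)
  have m1 : (minn m (2 ^ r) <= 2 ^ r)%N by exact: geq_minr.
  have m2 : (m - 2 ^ r <= 2 ^ r)%N by rewrite leq_subLR addnn -mul2n -expnS.
  have mE : (minn m (2 ^ r) + (m - 2 ^ r))%N = m.
    by have [h|h] := leqP m (2 ^ r); [rewrite (eqP h) addn0|rewrite subnKC// ltnW].
  have F0 l j : 0 <= pair_bound p V L s l1 (mixing_rate p eta cc) l j by rewrite addr_ge0 ?powR_ge0.
  have G0 i : 0 <= (b * mixing_rate p eta cc i) `^ p^-1 by exact: powR_ge0.
  have := @block_step _ _ _ P Y statY zeta mzeta p V _ _ p4 zetaV F0 G0
    (pair_estimate statY condQ mzeta p4 s0 zetaV zetaL zetas zetal disc1 disc2 bcoefM beta0 beta_ge0)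
    (linear_estimate condQ mzeta p4 zetaV zetaL disc1 bcoefM beta_ge0)
    _ _ _ _ m2 (u0 r) (IH _ m1) (IH _ m2).
  rewrite mE => /le_trans; apply; rewrite lee_fin /u [in X in _ <= X]/= -/(u r) lerD2l.
  have xE : x r = D * ((2 ^ r)%:R `^ (p / 2) * a + (2 ^ r)%:R `^ (1 - eta) * b) by rewrite natrX.
  apply: block_step_le => //.
  - rewrite ler_wpM2l ?powR_ge0// xE; exact: sum_single_rates.
  - apply/andP; split; last by rewrite ler_wpM2l ?powR_ge0// xE; exact: sum_pair_rates.
    rewrite mulr_ge0 ?powR_ge0// mulr_ge0//; apply: sumr_ge0 => l _; exact: sumr_ge0.
have {}HA := HA a b u a0 b0 u0 (lexx _) (fun r => lexx _).
have [r nr r2] : exists2 r, (n <= 2 ^ r)%N & (2 ^ r <= 2 * n)%N.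
  exists (up_log 2 n); first exact: up_logP.
  have [->|n1] := eqVneq n 1%N; first by rewrite up_log1.
  have n2 : (1 < n)%N by rewrite ltn_neqAle eq_sym n1.
  have := up_log_bounds (isT : 1 < 2)%N n2 => /andP[/ltnW + _].
  rewrite -(leq_pmul2l (isT : 0 < 2)%N) -expnS prednK// up_log_gt0//.
apply: le_trans (bound r n nr) _; rewrite lee_fin; apply: le_trans (HA r) _.
rewrite -mulrA ler_wpM2l ?(ltW A0)// mulrDr.
have r2' : 2 ^+ r <= 2 * n%:R :> R by rewrite -natrX -natrM ler_nat.
have n0' : 0 <= n%:R :> R by exact: ler0n.
apply: lerD; rewrite mulrA ler_wpM2r//.
  rewrite -powRM//; apply: ge0_ler_powR; rewrite ?nnegrE ?exprn_ge0 ?mulr_ge0//.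
  exact: ltW.
apply: le_trans r2' _; rewrite ler_wpM2r// -[X in X <= _]powRr1// ler_powR ?ler1n//; move: p4; clear; lra.
Qed.

(** * The kernel estimator *)

Section affine_change_of_variables.
Context {R : realType}.
Local Notation mu := (@lebesgue_measure R).
Local Notation mR := (measurableTypeR R).

Definition affine (H c t : R) : R := H^-1 * (t - c).

Lemma measurable_affine (H c : R) : measurable_fun [set: mR] (affine H c : mR -> mR).
Proof. by apply: measurable_funM => //; exact: measurable_funB. Qed.

(** Lebesgue measure is determined by its values on half-open intervals. Both signs of H occur: (x -
    y)/h is increasing in x and decreasing in y. *)
Lemma pushforward_affine (H c : R) (A : set R) : H != 0 -> measurable A ->
  mu (affine H c @^-1` A) = (`|H|%:E * mu A)%E.
Proof.
move=> H0 mA; have nH : 0 < `|H| by rewrite normr_gt0.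
pose k : {nonneg R} := NngNum (normr_ge0 H^-1).
have -> : mu A = (k%:num%:E * mu (affine H c @^-1` A))%E.
  apply: (lebesgue_measure_unique (mu := mscale k (pushforward mu (affine H c : mR -> mR)))) => //.
    exact: measurable_affine.
  move=> maff _ [[a b]] _ <-.
  change (mu `]a, b]%classic = (k%:num%:E * mu (affine H c @^-1` `]a, b]%classic))%E).
  rewrite lebesgue_measure_itv/= lte_fin.
  have memE t : (affine H c @^-1` `]a, b]) t = (a < H^-1 * (t - c) <= b) :> Prop.
    by rewrite /affine/preimage/= in_itv.
  case: (ltP H 0) => [Hn|Hp].
    have -> : affine H c @^-1` `]a, b] = `[H * b + c, H * a + c[%classic.
      apply/seteqP; split => t; rewrite memE /= in_itv/= ler_ndivrMl// ltr_ndivlMl//;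
        by rewrite lerBrDr ltrBlDr andbC.
    rewrite lebesgue_measure_itv/= lte_fin ltrD2r ltr_nM2l//.
    case: ifP => ab; last by rewrite mule0.
    rewrite -EFinD -EFinM normfV ltr0_norm//; congr (_%:E); field; lra.
  have {Hp}Hp : 0 < H by rewrite lt_neqAle eq_sym H0.
  have -> : affine H c @^-1` `]a, b] = `]H * a + c, H * b + c]%classic.
    apply/seteqP; split => t; rewrite memE /= in_itv/= ler_pdivrMl// ltr_pdivlMl//;
      by rewrite lerBlDr ltrBrDr.
  rewrite lebesgue_measure_itv/= lte_fin ltrD2r ltr_pM2l//.
  case: ifP => ab; last by rewrite mule0.
  rewrite -EFinD -EFinM normfV gtr0_norm//; congr (_%:E); field; lra.
rewrite muleA/= -EFinM normfV divff ?gt_eqF// mul1e//.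
Qed.

Lemma integral_affine (H c : R) (g : R -> \bar R) : H != 0 -> measurable_fun [set: R] g ->
  (forall u, 0 <= g u)%E ->
  (\int[mu]_t g (H^-1 * (t - c))%R = `|H|%:E * \int[mu]_u g u)%E.
Proof.
move=> H0; have nH : 0 <= `|H| by [].
have mg (f : R -> \bar R) : measurable_fun [set: R] f -> measurable_fun [set: R] (fun t => f (H^-1 * (t - c))).
  by move=> mf; exact: measurableT_comp mf (measurable_affine H c).
move: g; apply: ge0_measurable_ind.
- move=> B mB; have mHB : measurable (affine H c @^-1` B).
    by rewrite -[X in measurable X]setTI; exact: measurable_affine.
  have -> : (\int[mu]_u (\1_B u)%:E = mu B)%E by rewrite integral_indic// setIT.
  rewrite -(pushforward_affine c H0 mB).
  by have := @integral_indic _ _ _ mu setT measurableT (affine H c @^-1` B) mHB; rewrite setIT => <-.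
- move=> k f k0 mf f0 e; rewrite !ge0_integralZl_EFin ?e//; last exact: mg.
  by rewrite muleCA.
- move=> f1 f2 mf1 f10 mf2 f20 e1 e2; rewrite !ge0_integralD ?e1 ?e2//; try exact: mg.
  have i0 (f : R -> \bar R) : (forall x, 0 <= f x)%E -> (0 <= \int[mu]_u f u)%E by move=> f0; exact: integral_ge0.
  by rewrite (ge0_muleDr _ (i0 _ f10) (i0 _ f20)).
- move=> f_ mf_ f_0 ndf_ e_.
  rewrite !monotone_convergence//; try (by move=> n; exact: mg); try (by move=> w _; exact: ndf_).
  rewrite -limeMl//; last first.
    apply: ereal_nondecreasing_is_cvgn => a b ab.
    by apply: ge0_le_integral => //; try exact: mf_; move=> x _; exact: ndf_.
  by congr (limn _); apply/funext => n; exact: e_.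
Qed.

End affine_change_of_variables.

(** Turns the bounded density into E g(Y) <= ||f||_oo times the integral of g; the domination of
    measures extends from sets to functions. *)
Lemma integral_comp_le d d' (T : measurableType d) (S : measurableType d') (R : realType)
    (P : {measure set T -> \bar R}) (m : {measure set S -> \bar R}) (X : T -> S) (c : R)
    (g : S -> \bar R) :
  measurable_fun setT X -> 0 <= c ->
  (forall B, measurable B -> P (X @^-1` B) <= c%:E * m B)%E ->
  measurable_fun setT g -> (forall t, 0 <= g t)%E ->
  (\int[P]_w g (X w) <= c%:E * \int[m]_t g t)%E.
Proof.
move=> mX c0 Xm.
have mg (f : S -> \bar R) : measurable_fun setT f -> measurable_fun setT (fun w => f (X w)).
  by move=> mf; exact: measurableT_comp mf mX.
move: g; apply: ge0_measurable_ind.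
- move=> B mB; have mXB : measurable (X @^-1` B) by rewrite -[X in measurable X]setTI; exact: mX.
  have := @integral_indic _ _ _ P setT measurableT (X @^-1` B) mXB; rewrite setIT => eP.
  have := @integral_indic _ _ _ m setT measurableT B mB; rewrite setIT => em.
  by rewrite em; apply: le_trans (Xm B mB); rewrite -eP.
- move=> k f k0 mf f0 e; rewrite !ge0_integralZl_EFin//; last exact: mg.
  by rewrite muleCA lee_wpmul2l// lee_fin.
- move=> f1 f2 mf1 f10 mf2 f20 e1 e2; rewrite !ge0_integralD//; try exact: mg.
  by rewrite ge0_muleDr ?integral_ge0// leeD.
- move=> f_ mf_ f_0 ndf_ e_.
  have nd : nondecreasing_seq (fun n => \int[m]_t f_ n t)%E.
    by move=> a b ab; apply: ge0_le_integral => // x _; exact: ndf_.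
  rewrite !monotone_convergence//; try (by move=> n; exact: mg); try (by move=> w _; exact: ndf_).
  rewrite -limeMl//; last exact: ereal_nondecreasing_is_cvgn.
  apply: lee_lim.
  + apply: ereal_nondecreasing_is_cvgn => a b ab; apply: ge0_le_integral => //.
    * exact: mg.
    * exact: mg.
    * by move=> x _; exact: ndf_.
  + apply: ereal_nondecreasing_is_cvgn => a b ab; rewrite lee_wpmul2l ?lee_fin//; exact: nd.
  + by apply: nearW => n; exact: e_.
Qed.

Lemma limn_esup_le_eventually (R : realType) (u : nat -> \bar R) (l : \bar R) :
  (forall e : R, 0 < e -> \forall n \near \oo, (u n <= l + e%:E)%E) -> (limn_esup u <= l)%E.
Proof.
move=> ul; apply/lee_addgt0Pr => e e0.
rewrite /limn_esup limf_esupE; apply: le_trans (_ : ereal_sup [set u n | n in [set n | u n <= l + e%:E]%E] <= _)%E.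
  by apply: ereal_inf_lbound; exists [set n | (u n <= l + e%:E)%E] => //; exact: ul.
by apply: ge_ereal_sup => _ [n un <-].
Qed.

Section kernel_deviation.
Context d (T : measurableType d) (R : realType) (P : probability T R).
Local Notation mu := (@lebesgue_measure R).
Local Notation mR := (measurableTypeR R).
Variable Y : int -> {RV P >-> R}.
Hypothesis statY : stationary Y.
Variable F : R.
Hypothesis F0 : 0 <= F.
Hypothesis YF : forall B : set R, measurable B -> (distribution P (Y 0) B <= F%:E * mu B)%E.
Variables m1 m2 : {finite_measure set mR -> \bar R}.
Local Notation G := (cdf_diff m1 m2).
Let V : R := fine (m1 setT) + fine (m2 setT).
Variables (p A1 Ip : R).
Hypothesis p4 : 4 <= p.
Hypothesis GA1 : (\int[mu]_u `|G u|%:E = A1%:E)%E.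
Hypothesis GIp : (\int[mu]_u (`|G u| `^ (p - 2))%R%:E = Ip%:E)%E.
Variable H : R.
Hypothesis H0 : 0 < H.

Let P1 := probability_setT P.
Let V0 : 0 <= V. Proof. by rewrite addr_ge0 ?fine_ge0. Qed.
Let p2 : 1 <= p - 2. Proof. by have := p4; lra. Qed.
Let p20 : 0 <= p - 2. Proof. exact: le_trans p2. Qed.

Let phi (x y : R) : R := G (H^-1 * (x - y)).
Let e (x : R) : R := \int[P]_w phi x (Y 0 w).

Definition deviation (x y : R) : R := phi x y - e x.

Let phiV x y : `|phi x y| <= V. Proof. exact: cdf_diff_le. Qed.

Let bphi d' (S : measurableType d') (a b : S -> R) : measurable_fun setT a -> measurable_fun setT b ->
  bounded_measurable (fun v => phi (a v) (b v)).
Proof.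
move=> ma mb; split; last by exists V.
apply: (measurableT_comp (measurable_cdf_diff m1 m2)).
by apply: measurable_funM => //; exact: measurable_funB.
Qed.

Let jphi k : jointly_bm (fun x w => phi x (Y k w)).
Proof.
apply: bphi; first exact: measurable_fst.
exact: measurableT_comp (@measurable_funPT _ _ _ _ (Y k)) measurable_snd.
Qed.

Lemma bounded_mean_kernel : bounded_measurable e.
Proof. exact: bounded_measurable_Rint (jphi 0). Qed.

Lemma bounded_deviation : bounded_measurable (fun xy : R * R => deviation xy.1 xy.2).
Proof.
apply: bounded_measurableB; first by apply: bphi; [exact: measurable_fst|exact: measurable_snd].
by have [me [M eM]] := bounded_mean_kernel; split; [exact: measurableT_comp me measurable_fst|exists M => xy; exact: eM].
Qed.

Let eV x : `|e x| <= V.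
Proof. by apply: Rint_bound => //; exact: (jointly_bm_section x (jphi 0)). Qed.

Let section_integral (r : R) (C : R) : 0 <= r -> (\int[mu]_u (`|G u| `^ r)%R%:E = C%:E)%E ->
  (forall y, \int[mu]_x (`|phi x y| `^ r)%R%:E = (H * C)%:E)%E /\
  (forall x, \int[mu]_y (`|phi x y| `^ r)%R%:E = (H * C)%:E)%E.
Proof.
move=> r0 GC; pose g u : \bar R := (`|G u| `^ r)%R%:E.
have mg : measurable_fun [set: R] g.
  have bG : bounded_measurable G by split; [exact: measurable_cdf_diff|exists V => u; exact: cdf_diff_le].
  by apply/measurable_EFinP; have [] := bounded_measurable_powR r0 bG.
have g0 u : (0 <= g u)%E by rewrite lee_fin powR_ge0.
have Hn : H != 0 by rewrite gt_eqF.
split => [y|x].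
  by rewrite (integral_affine y Hn mg g0) GC gtr0_norm.
have NHn : - H != 0 by rewrite oppr_eq0.
rewrite -[in RHS](gtr0_norm H0) EFinM -GC -normrN -(integral_affine x NHn mg g0).
by apply: eq_integral => y _; rewrite /g /phi invrN mulNr -mulrN opprB.
Qed.

Let A1E : (\int[mu]_u (`|G u| `^ 1)%R%:E = A1%:E)%E.
Proof. by rewrite -GA1; apply: eq_integral => u _; rewrite powRr1. Qed.

Let A10 : 0 <= A1.
Proof. by rewrite -lee_fin -GA1 integral_ge0// => u _; rewrite lee_fin. Qed.

Let Ip0 : 0 <= Ip.
Proof. by rewrite -lee_fin -GIp integral_ge0// => u _; rewrite lee_fin powR_ge0. Qed.

Lemma deviation_le x y : `|deviation x y| <= 2 * V.
Proof. by rewrite mulr_natl mulr2n; apply: le_trans (ler_normB _ _) _; rewrite lerD. Qed.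

(** By Jensen |e(x)|^r is at most the mean of |phi(x, Y_0)|^r, and the integral in x of the latter
    does not depend on the value of Y_0. *)
Let e_pow (r C : R) : 1 <= r -> (\int[mu]_u (`|G u| `^ r)%R%:E = C%:E)%E ->
  (\int[mu]_x (`|e x| `^ r)%R%:E <= (H * C)%:E)%E.
Proof.
move=> r1 GC; have r0 : 0 <= r by exact: le_trans r1.
have [s1 _] := section_integral r0 GC.
have bp : bounded_measurable (fun xy : R * R => `|phi xy.1 xy.2| `^ r).
  by apply: bounded_measurable_powR => //; apply: bphi; [exact: measurable_fst|exact: measurable_snd].
apply: le_trans (@avg_section_bound _ _ _ P (Y 0) (fun x y => `|phi x y| `^ r) (H * C) _ bp _ _) => //; last first.
- by move=> y; rewrite s1.
have jr : jointly_bm (fun x w => `|phi x (Y 0 w)| `^ r) by exact: (bounded_measurable_powR r0 (jphi 0)).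
apply: ge0_le_integral => //.
- by apply/measurable_EFinP; have [] := bounded_measurable_powR r0 bounded_mean_kernel.
- by apply/measurable_EFinP; have [] := bounded_measurable_Rint P jr.
- move=> x _; rewrite lee_fin; apply: powR_Rint_le => //.
  exact: (jointly_bm_section x (jphi 0)).
Qed.

Let mphi_y y r : 0 <= r -> measurable_fun [set: R] (fun x => (`|phi x y| `^ r)%R%:E).
Proof.
move=> r0; apply/measurable_EFinP.
by have [] := bounded_measurable_powR r0 (@bphi _ R id (cst y) (@measurable_id _ _ _) (@measurable_cst _ _ _ _ _ _)).
Qed.

Let me_pow r : 0 <= r -> measurable_fun [set: R] (fun x => (`|e x| `^ r)%R%:E).
Proof. by move=> r0; apply/measurable_EFinP; have [] := bounded_measurable_powR r0 bounded_mean_kernel. Qed.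

Lemma integral_deviation y : (\int[mu]_x `|deviation x y|%:E <= (2 * (H * A1))%:E)%E.
Proof.
have [s1 _] := section_integral ler01 A1E.
have n1 x : (0 <= (`|phi x y| `^ 1)%R%:E)%E by rewrite lee_fin powR_ge0.
have n2 x : (0 <= (`|e x| `^ 1)%R%:E)%E by rewrite lee_fin powR_ge0.
apply: le_trans (_ : \int[mu]_x ((`|phi x y| `^ 1)%R%:E + (`|e x| `^ 1)%R%:E) <= _)%E.
  apply: ge0_le_integral => //.
  - apply/measurable_EFinP; have [mf _] := bounded_measurable_norm bounded_deviation.
    exact: measurableT_comp mf (measurable_pair2 y).
  - by apply: emeasurable_funD; [exact: mphi_y|exact: me_pow].
  - by move=> x _; rewrite -EFinD lee_fin !powRr1// ler_normB.
rewrite ge0_integralD//; [|exact: mphi_y|exact: me_pow].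
by rewrite s1 mulr_natl mulr2n EFinD leeD// e_pow.
Qed.

Lemma integral_deviation_pow y :
  (\int[mu]_x (`|deviation x y| `^ (p - 2))%R%:E <= (2 `^ (p - 2) * (2 * (H * Ip)))%:E)%E.
Proof.
have [s1 _] := section_integral p20 GIp.
have n1 x : (0 <= (`|phi x y| `^ (p - 2))%R%:E)%E by rewrite lee_fin powR_ge0.
have n2 x : (0 <= (`|e x| `^ (p - 2))%R%:E)%E by rewrite lee_fin powR_ge0.
have c0 : (0 <= (2 `^ (p - 2) : R)%:E)%E by rewrite lee_fin powR_ge0.
apply: le_trans (_ : \int[mu]_x ((2 `^ (p - 2))%:E * ((`|phi x y| `^ (p - 2))%R%:E + (`|e x| `^ (p - 2))%R%:E)) <= _)%E.
  apply: ge0_le_integral => //.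
  - apply/measurable_EFinP; have [mf _] := bounded_measurable_powR p20 bounded_deviation.
    exact: measurableT_comp mf (measurable_pair2 y).
  - by apply: measurable_funeM; apply: emeasurable_funD; [exact: mphi_y|exact: me_pow].
  - move=> x _; rewrite -EFinD -EFinM lee_fin.
    apply: le_trans (_ : (2 * Num.max `|phi x y| `|e x|) `^ (p - 2) <= _).
      apply: ge0_ler_powR; rewrite ?nnegrE ?mulr_ge0 ?le_max ?normr_ge0//.
      apply: le_trans (ler_normB _ _) _; rewrite mulr_natl mulr2n lerD// le_max lexx ?orbT//.
    rewrite powRM ?le_max ?normr_ge0// ler_wpM2l ?powR_ge0//.
    by case: (leP `|phi x y| `|e x|) => _; [rewrite lerDr powR_ge0|rewrite lerDl powR_ge0].
rewrite ge0_integralZl//; last 2 first.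
- by apply: emeasurable_funD; [exact: mphi_y|exact: me_pow].
- by move=> x _; rewrite adde_ge0.
rewrite EFinM lee_wpmul2l// ge0_integralD//; [|exact: mphi_y|exact: me_pow].
by rewrite s1 mulr_natl mulr2n EFinD leeD// e_pow.
Qed.

Let mean_phi x : \int[P]_w `|phi x (Y 0 w)| <= F * (H * A1).
Proof.
have [_ s2] := section_integral ler01 A1E.
have bx : bounded_measurable (fun w => `|phi x (Y 0 w)|).
  exact: (@jointly_bm_section _ _ _ (fun x w => `|phi x (Y 0 w)|) x (bounded_measurable_norm (jphi 0))).
have bg : bounded_measurable (fun y : R => `|phi x y| `^ 1).
  by apply: bounded_measurable_powR => //; apply: bphi => //; exact: measurable_id.
have mg : measurable_fun [set: R] (fun y => (`|phi x y| `^ 1)%R%:E) by apply/measurable_EFinP; have [] := bg.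
rewrite -lee_fin EFin_Rint//.
rewrite (_ : (\int[P]_w _ = \int[P]_w (`|phi x (Y 0 w)| `^ 1)%R%:E)%E); last first.
  by apply: eq_integral => w _; rewrite powRr1.
rewrite (EFinM F) -(s2 x).
have mY0 := @measurable_funPT _ _ _ _ (Y 0).
have mY : measurable_fun setT (Y 0 : T -> mR) by exact: mY0.
have g0 (y : R) : (0 <= (`|phi x y| `^ 1)%R%:E)%E by rewrite lee_fin powR_ge0.
exact: (@integral_comp_le _ _ T mR R P mu (Y 0) F (fun y => (`|phi x y| `^ 1)%R%:E) mY F0 YF mg g0).
Qed.

Lemma mean_deviation x : \int[P]_w `|deviation x (Y 0 w)| <= 2 * (F * (H * A1)).
Proof.
have bx : bounded_measurable (fun w => `|phi x (Y 0 w)|).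
  exact: (@jointly_bm_section _ _ _ (fun x w => `|phi x (Y 0 w)|) x (bounded_measurable_norm (jphi 0))).
have bc := bounded_measurable_cst T `|e x|.
apply: le_trans (_ : \int[P]_w (`|phi x (Y 0 w)| + `|e x|) <= _).
  apply: Rint_le => //.
  - apply: bounded_measurable_norm; apply: bounded_measurableB; last exact: bounded_measurable_cst.
    exact: (jointly_bm_section x (jphi 0)).
  - exact: bounded_measurableD.
  - by move=> w; exact: ler_normB.
rewrite RintD// Rint_cst// mulr_natl mulr2n; apply: lerD; first exact: mean_phi.
apply: le_trans (mean_phi x); exact: (Rint_norm P1 (f := fun w => phi x (Y 0 w)) (jointly_bm_section x (jphi 0))).
Qed.

Variable Q : nat -> nat -> R.-pker (pastType Y) ~> (R * R)%type.

Let bdev x : bounded_measurable (deviation x).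
Proof.
apply: bounded_measurableB; last exact: bounded_measurable_cst.
by apply: bphi => //; exact: measurable_id.
Qed.

Let shift0 (g : R -> R) k : bounded_measurable g -> \int[P]_w g (Y k w) = \int[P]_w g (Y 0 w).
Proof.
move=> [mg [M gM]].
have := @Rint_stationary _ _ _ _ Y statY (fun=> 0) (measurable_cst _) [::] 0 0 k (fun v => g v.2).
rewrite !add0r; apply; split; last by exists M => v.
exact: measurableT_comp mg measurable_snd.
Qed.

Let centered x k : \int[P]_w deviation x (Y k w) = 0.
Proof.
rewrite (shift0 k (bdev x)) RintB//; last exact: bounded_measurable_cst.
  by rewrite Rint_cst// subrr.
exact: (jointly_bm_section x (jphi 0)).
Qed.

(** The deviation is centered under the marginal law, so its conditional mean is itself a
    discrepancy between [Q i i w] and the law of the pair. *)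
Lemma cond_mean_deviation x i w : 
  `|\int[Q i i w]_z deviation x z.1| <= 2 * V * bcoef Q i i w.
Proof.
have Q1 : Q i i w setT = 1%E by exact: prob_kernel.
have := @centered_discrepancy_fst R x H _ H0 _ _ Q1 (pair_law_setT Y i i) (quadrant_close_bcoef Q i i w) m1 m2 (e x).
have bd1 : bounded_measurable (fun z : R * R => deviation x z.1).
  by have [md [M dM]] := bdev x; split; [exact: measurableT_comp md measurable_fst|exists M => z; exact: dM].
by rewrite (Rint_pair_law Y i i bd1) /pair_map/= (centered x i) subr0.
Qed.

Lemma cond_cov_deviation x i j w :
  `|\int[Q i j w]_z (deviation x z.1 * deviation x z.2) -
    \int[P]_w' (deviation x (Y i%:Z w') * deviation x (Y j%:Z w'))| <= (2 * V) ^+ 2 * bcoef Q i j w.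
Proof.
have Q1 : Q i j w setT = 1%E by exact: prob_kernel.
have := @centered_discrepancy_pair R x H _ H0 _ _ Q1 (pair_law_setT Y i j) (quadrant_close_bcoef Q i j w) m1 m2 (e x) (eV x).
have bd2 : bounded_measurable (fun z : R * R => deviation x z.1 * deviation x z.2).
  have [md [M dM]] := bdev x; apply: bounded_measurableM.
    by split; [exact: measurableT_comp md measurable_fst|exists M => z; exact: dM].
  by split; [exact: measurableT_comp md measurable_snd|exists M => z; exact: dM].
by rewrite (Rint_pair_law Y i j bd2).
Qed.

Lemma mean_kernel_sum x n : \int[P]_w (\sum_(1 <= k < n.+1) phi x (Y k%:Z w)) = n%:R * e x.
Proof.
rewrite Rint_sum//; last by move=> k; exact: (jointly_bm_section x (jphi k)).
under eq_bigr => k _.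
  rewrite (shift0 (g := phi x) k); first over.
  by apply: bphi => //; exact: measurable_id.
by rewrite big_const_nat subSS subn0 iter_addr_0 mulr_natl.
Qed.

Lemma window_sum_deviation x n w :
  window_sum Y deviation (block n) x w = \sum_(1 <= k < n.+1) phi x (Y k%:Z w) - n%:R * e x.
Proof.
rewrite /window_sum /block big_map big_add1/= /index_iota subn0 /summand /deviation.
by rewrite big_split/= sumrN big_const_seq count_predT size_iota iter_addr_0 mulr_natl.
Qed.

End kernel_deviation.

(** * The risk as an integrated moment of a centered sum *)

Section risk_of_the_estimator.
Context d (T : measurableType d) (R : realType) (P : probability T R).
Local Notation mu := (@lebesgue_measure R).
Local Notation mR := (measurableTypeR R).
Variable Y : int -> {RV P >-> R}.
Hypothesis statY : stationary Y.
Variable F : R.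
Hypothesis YF : forall B : set R, measurable B -> (distribution P (Y 0) B <= F%:E * mu B)%E.
Variables m1 m2 : {finite_measure set mR -> \bar R}.
Local Notation G := (cdf_diff m1 m2).
Variables (K : R -> R) (D : set R).
Hypotheses (mK : measurable_fun [set: R] K) (cD : countable D).
Hypothesis KG : forall u, ~ D u -> K u = G u.
Variables (h : nat -> R) (p : R) (n : nat).
Hypotheses (p4 : 4 <= p) (h0 : 0 < h n).

Local Notation H := (h n).
Local Notation N := (n%:R * h n).

Let P1 := probability_setT P.

Lemma law_shift k (B : set R) : measurable B -> P (Y k @^-1` B) = P (Y 0 @^-1` B).
Proof.
move=> mB; have mB' : measurable ([set v | B (tnth v ord0)] : set (1.-tuple R)).
  by rewrite -[X in measurable X]setTI; exact: measurable_tnth.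
have := statY [tuple 0] k mB'.
rewrite [X in P X = _](_ : _ = Y k @^-1` B); last first.
  by apply/seteqP; split => w /=; rewrite tnth_mktuple (tnth_nth 0)/= add0r.
rewrite [X in _ = P X](_ : _ = Y 0 @^-1` B)//.
by apply/seteqP; split => w /=; rewrite tnth_mktuple (tnth_nth 0)/=.
Qed.

Let countable_preimage (f : R -> R) (a : R -> R) : (forall x, a (f x) = x) -> countable [set x | D (f x)].
Proof.
move=> af; have cim := sub_countable (card_image_le a D) cD.
apply: sub_countable cim; apply: subset_card_le => x /= Dx; by exists (f x) => //; exact: af.
Qed.

Let Hn : H != 0. Proof. by rewrite gt_eqF. Qed.

(** The points y where the two kernels may differ are countable, hence null for a law dominated by
    Lebesgue measure. This version, at fixed x, is the one for the expectation of the estimator. *)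
Let ae_kernel x : \forall w \ae P, forall k : nat, K (H^-1 * (x - Y k%:Z w)) = G (H^-1 * (x - Y k%:Z w)).
Proof.
apply: ae_foralln => k; set B := [set y | D (H^-1 * (x - y))].
have cB : countable B.
  apply: (@countable_preimage (fun y => H^-1 * (x - y)) (fun u => x - H * u)) => y.
  by rewrite mulrA mulfV// mul1r opprB addrC subrK.
have mB : measurable B by apply: countable_measurable cB => t; exact: measurable_set1.
exists (Y k%:Z @^-1` B); split.
- by rewrite -[X in measurable X]setTI; exact: (@measurable_funPT _ _ _ _ (Y k%:Z)).
- apply: (etrans (law_shift k%:Z mB)); apply/eqP; rewrite -measure_le0.
  have := YF mB; rewrite /distribution /pushforward => /le_trans; apply.
  by rewrite (countable_lebesgue_measure0 cB) mule0.
- by move=> w /= Kw; apply: contrapT => Bw; apply: Kw; exact: KG.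
Qed.

(** The counterpart at fixed w, for the integral in x inside the risk: the exceptional x are
    countable whatever the values Y_k(w). *)
Let ae_kernel_x w : \forall x \ae mu, forall k : nat, K (H^-1 * (x - Y k%:Z w)) = G (H^-1 * (x - Y k%:Z w)).
Proof.
apply: ae_foralln => k; set B := [set x | D (H^-1 * (x - Y k%:Z w))].
have cB : countable B.
  apply: (@countable_preimage (fun x => H^-1 * (x - Y k%:Z w)) (fun u => H * u + Y k%:Z w)) => x.
  by rewrite mulrA mulfV// mul1r subrK.
have mB : measurable (B : set mR) by apply: countable_measurable cB => t; exact: measurable_set1.
exists B; split => //; first exact: countable_lebesgue_measure0.
by move=> x /= Kx; apply: contrapT => Bx; apply: Kx; exact: KG.
Qed.

Let phi (x y : R) : R := G (H^-1 * (x - y)).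
Let e (x : R) : R := \int[P]_w phi x (Y 0 w).
Let dev := deviation Y m1 m2 H.

Let bphi x k : bounded_measurable (fun w => phi x (Y k w)).
Proof.
split; last by exists (fine (m1 setT) + fine (m2 setT)) => w; exact: cdf_diff_le.
apply: (measurableT_comp (measurable_cdf_diff m1 m2)).
by apply: measurable_funM => //; apply: measurable_funB => //; exact: measurable_funPT.
Qed.

Let expectation_estimator x : ('E_P[density_estimator Y K h n x] = (N^-1 * (n%:R * e x))%:E)%E.
Proof.
have mKx k : measurable_fun setT (fun w => K (H^-1 * (x - Y k w))).
  apply: (measurableT_comp mK).
  by apply: measurable_funM => //; apply: measurable_funB => //; exact: measurable_funPT.
rewrite unlock (@ae_eq_integral _ _ _ P setT (fun w => (N^-1 * \sum_(1 <= k < n.+1) phi x (Y k%:Z w))%:E))//.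
- have bS : bounded_measurable (fun w => \sum_(1 <= k < n.+1) phi x (Y k%:Z w)).
    by apply: (bounded_measurable_sum _ (F := fun (k : nat) w => phi x (Y k%:Z w))) => k; exact: bphi.
  rewrite -EFin_Rint//; last exact: bounded_measurableM (bounded_measurable_cst _ _) bS.
  by rewrite RintZ// mean_kernel_sum.
- by apply/measurable_EFinP; apply: measurable_funM => //; apply: measurable_sum.
- apply/measurable_EFinP; apply: measurable_funM => //; apply: measurable_sum => k.
  by have [] := bphi x k%:Z.
- apply: filterS (ae_kernel x) => w Kw _; rewrite /density_estimator; congr (_ * _)%:E.
  by apply: eq_bigr => k _; exact: Kw.
Qed.

Lemma Lp_risk_window_sum :
  Lp_risk Y K h p n = ((N^-1 `^ p)%:E * iter_int P (fun x w => `|window_sum Y dev (block n) x w| `^ p)%R)%E.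
Proof.
have p0 : 0 <= p by have := p4; lra.
have N0 : 0 <= N^-1 by rewrite invr_ge0 mulr_ge0// ltW.
have jS : jointly_bm (window_sum Y dev (block n)).
  have jd k : jointly_bm (fun x w => dev x (Y k w)).
    have [md [M dM]] := @bounded_deviation _ T R P Y m1 m2 H.
    split; last by exists M => xw; exact: (dM (xw.1, Y k xw.2)).
    have mp : measurable_fun setT (fun xv : R * T => (xv.1, Y k xv.2)).
      apply/measurable_fun_pairP; split; first exact: measurable_fst.
      exact: measurableT_comp (@measurable_funPT _ _ _ _ (Y k)) measurable_snd.
    exact: measurableT_comp md mp.
  exact: (bounded_measurable_sum _ (F := fun k xw => dev xw.1 (Y k xw.2))).
have jSp : jointly_bm (fun x w => `|window_sum Y dev (block n) x w| `^ p) by exact: (bounded_measurable_powR p0 jS).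
have Sp0 x w : 0 <= `|window_sum Y dev (block n) x w| `^ p by exact: powR_ge0.
have Np0 : 0 <= N^-1 `^ p by exact: powR_ge0.
rewrite -(iter_intZ P Np0 jSp Sp0) iter_int_swap; last 2 first.
- exact: bounded_measurableM (bounded_measurable_cst _ _) jSp.
- by move=> x w; rewrite mulr_ge0.
have [me _] := @bounded_mean_kernel _ T R P Y m1 m2 H.
apply: eq_integral => w _.
under eq_integral => x _ do rewrite expectation_estimator -EFinB abse_EFin poweR_EFin.
apply: ge0_ae_eq_integral => //.
- apply/measurable_EFinP; apply: (measurableT_comp (measurable_powR p)).
  apply: measurableT_comp => //; apply: measurable_funB.
    apply: measurable_funM => //; apply: measurable_sum => k.
    by apply: (measurableT_comp mK); apply: measurable_funM => //; exact: measurable_funB.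
  by apply: measurable_funM => //; exact: measurable_funM.
- apply/measurable_EFinP; apply: measurable_funM => //.
  by have [mS _] := jSp; exact: measurableT_comp mS (measurable_pair2 w).
- by move=> x _; rewrite lee_fin mulr_ge0.
- have [B [mB B0 KB]] := ae_kernel_x w; exists B; split => // x /= Ex; apply: KB => /= Kx; apply: Ex => _; congr (_%:E).
  rewrite /density_estimator (window_sum_deviation Y m1 m2 H).
  under eq_bigr => k _ do rewrite Kx.
  by rewrite -mulrBr normrM powRM// (ger0_norm N0).
Qed.

End risk_of_the_estimator.

(** * Constants, exponents and conclusion *)

(** Bookkeeping after inserting 2V for the bound, s = 2 F H A1, l1 = 2 H A1 and L = 2^(p-2) 2 H I.
    The powers of 2 are p/2 + (p/2 - 1) + 1 = p and 2 + (p - 2) + 1 = p + 1, and n and H combine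
    into powers of n H. *)
Lemma scaled_window_bound (R : realType) (p n H V F A1 I A : R) : 4 <= p -> 0 < n -> 0 < H ->
  0 <= V -> 0 <= F -> 0 <= A1 ->
  (n * H)^-1 `^ p * (A * (n `^ (p / 2) * ((2 * V) `^ (p / 2) * (2 * (F * (H * A1))) `^ (p / 2 - 1) * (2 * (H * A1)))
     + n * ((2 * V) ^+ 2 * (2 `^ (p - 2) * (2 * (H * I)))))) =
  A * 2 `^ p * (n * H) `^ (- (p / 2)) * V `^ (p / 2) * F `^ (p / 2 - 1) * A1 `^ (p / 2)
  + A * 2 `^ (p + 1) * (n * H) `^ (1 - p) * (V ^+ 2 * I).
Proof.
move=> p4 n0 H0 V0 F0 A10; have nH : 0 < n * H by rewrite mulr_gt0.
have q0 : 0 < p / 2 by lra.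
have half (x : R) : 0 <= x -> x `^ (p / 2) = x `^ (p / 2 - 1) * x.
  by move=> x0; rewrite [RHS]mulrC mulr_powRB1.
have e2 : 2 `^ p = 2 `^ (p / 2) * (2 `^ (p / 2 - 1) * 2) :> R.
  by rewrite -half// -powRD ?pnatr_eq0 ?implybT//; congr (_ `^ _); field.
have e3 : 2 `^ (p + 1) = 2 ^+ 2 * 2 `^ (p - 2) * 2 :> R.
  rewrite -powR_mulrn// -powRD ?pnatr_eq0 ?implybT// -[X in _ * X]powRr1//.
  by rewrite -powRD ?pnatr_eq0 ?implybT//; congr (_ `^ _); ring.
have eN : (n * H)^-1 `^ p = (n * H) `^ (- p).
  by rewrite -powR_inv1 ?ltW// -powRrM mulN1r.
have eN1 : (n * H) `^ (- (p / 2)) = (n * H) `^ (- p) * (n `^ (p / 2) * (H `^ (p / 2 - 1) * H)).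
  rewrite -(half H (ltW H0)) -(powRM _ (ltW n0) (ltW H0)) -powRD; last by rewrite (gt_eqF nH) implybT.
  by congr (_ `^ _); field.
have eN2 : (n * H) `^ (1 - p) = (n * H) `^ (- p) * (n * H).
  by rewrite -[X in _ = _ * X](powRr1 (ltW nH)) -powRD ?(gt_eqF nH) ?implybT//; congr (_ `^ _); ring.
have HA : 0 <= H * A1 by rewrite mulr_ge0// ltW.
have F1 : 0 <= F * (H * A1) by rewrite mulr_ge0.
rewrite eN eN1 eN2 e2 e3 (half A1)// (powRM _ (ler0n _ 2) V0) (powRM _ (ler0n _ 2) F1).
by rewrite (powRM _ F0 HA) (powRM _ (ltW H0) A10); ring.
Qed.

(** Passing from n to n + 1 <= 2n costs 2^(p - 1 + eta'); the added 1 ensures that the constant of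
    the rate is at least 1. *)
Lemma mixing_rate_bound (R : realType) (p eta eta' c : R) (n : nat) : 4 <= p -> 0 < eta' -> eta' <= eta -> 0 < c ->
  (0 < n)%N -> c * n%:R `^ (- (p - 1 + eta)) <= mixing_rate p eta' (1 + c * 2 `^ (p - 1 + eta')) n.
Proof.
move=> p4 e0 ee c0 n0; have n1 : 1 <= n%:R :> R by rewrite ler1n.
set r := p - 1 + eta'; have r0 : 0 <= r by rewrite /r; lra.
apply: le_trans (_ : c * n%:R `^ (- r) <= _).
  by rewrite ler_wpM2l ?(ltW c0)// ler_powR// lerN2 /r lerD2l.
rewrite /mixing_rate -/r; apply: le_trans (_ : (c * 2 `^ r) * n.+1%:R `^ (- r) <= _); last first.
  by rewrite ler_wpM2r ?powR_ge0// lerDr.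
rewrite -mulrA ler_wpM2l ?(ltW c0)//.
rewrite !powRN -[X in _ <= 2 `^ r * X]div1r mulrA mulr1 ler_pdivlMr ?powR_gt0// mulrC ler_pdivrMr ?powR_gt0 ?ltr0n//.
rewrite -powRM//; apply: ge0_ler_powR; rewrite ?nnegrE ?mulr_ge0//.
by rewrite -natrM ler_nat mul2n -addnn -addn1 leq_add2l.
Qed.

Lemma Lp_risk_le (R : realType) (p eta c : R) : 4 <= p -> 0 < eta -> 0 < c ->
  exists2 A : R, 0 < A &
  forall d (T : measurableType d) (P : probability T R) (Y : int -> {RV P >-> R})
    (Q : nat -> nat -> R.-pker (pastType Y) ~> (R * R)%type) (F : R)
    (m1 m2 : {finite_measure set (measurableTypeR R) -> \bar R})
    (K : R -> R) (D : set R) (h : nat -> R) (n : nat) (A1 I : R),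
  let V := fine (m1 setT) + fine (m2 setT) in
  stationary Y ->
  (forall i j : nat, (0 < i)%N -> (0 < j)%N -> is_conditional_law i j (Q i j)) ->
  0 <= F ->
  (forall B : set R, measurable B -> (distribution P (Y 0%R) B <= F%:E * @lebesgue_measure R B)%E) ->
  measurable_fun [set: R] K -> countable D ->
  (forall u, ~ D u -> K u = cdf_diff m1 m2 u) ->
  (\int[@lebesgue_measure R]_u `|cdf_diff m1 m2 u|%:E = A1%:E)%E ->
  (\int[@lebesgue_measure R]_u (`|cdf_diff m1 m2 u| `^ (p - 2))%R%:E = I%:E)%E ->
  (0 < n)%N -> 0 < h n ->
  (forall m : nat, (0 < m)%N -> (beta2 Q m <= (c * m%:R `^ (- (p - 1 + eta)))%:E)%E) ->
  is_true (Lp_risk Y K h p n <=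
    (A * 2 `^ p * (n%:R * h n) `^ (- (p / 2)) * V `^ (p / 2) * F `^ (p / 2 - 1) * A1 `^ (p / 2)
     + A * 2 `^ (p + 1) * (n%:R * h n) `^ (1 - p) * (V ^+ 2 * I))%:E)%E.
Proof.
(* The partial sums of k^(-sigma) are used in the divergent range sigma < 1, which asks for eta < 1.
   Lowering eta only weakens the decay that is assumed. *)
move=> p4 eta0 c0; set eta' := Num.min eta (1 / 2).
have e0 : 0 < eta' by rewrite lt_min eta0/=.
have e1 : eta' <= 1 / 2 by rewrite ge_min lexx orbT.
have ee : eta' <= eta by rewrite ge_min lexx.
have cc1 : 1 <= 1 + c * 2 `^ (p - 1 + eta') by rewrite lerDl mulr_ge0 ?powR_ge0// ltW.
have [A A0 HA] := rosenthal_inequality p4 e0 e1 cc1; exists A => //.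
move=> d T P Y Q F m1 m2 K D h n A1 I V statY condQ F0 YF mK cD KG GA1 GI n0 h0 hbeta.
have A10 : 0 <= A1 by rewrite -lee_fin -GA1 integral_ge0// => u _; rewrite lee_fin.
have V0 : 0 <= V by rewrite addr_ge0 ?fine_ge0.
rewrite (Lp_risk_window_sum statY YF mK cD KG p4 h0).
have n0' : 0 < n%:R :> R by rewrite ltr0n.
rewrite -scaled_window_bound// EFinM lee_wpmul2l ?lee_fin ?powR_ge0//.
apply: (HA _ _ _ Y Q) => //.
- by have [] := @bounded_deviation _ T R P Y m1 m2 (h n).
- by rewrite mulr_ge0// mulr_ge0// mulr_ge0// ltW.
- by move=> x y; exact: deviation_le.
- by move=> y; exact: integral_deviation_pow.
- by move=> x; exact: mean_deviation.
- by move=> y; exact: integral_deviation.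
- by move=> x i w _; exact: cond_mean_deviation.
- by move=> x i j w _ _; exact: cond_cov_deviation.
move=> i j /andP[j0 ji]; apply: le_trans (mixing_rate_bound p4 e0 ee c0 j0).
by apply: (Rint_bcoef_le (k := j)); rewrite ?leqnn ?ji//; exact: hbeta.
Qed.

Lemma density_law_le d (T : measurableType d) (R : realType) (P : probability T R)
    (Y : int -> {RV P >-> R}) (f : R -> R) (i : int) :
  let mu := @lebesgue_measure R in
  is_density Y i f -> ('N[mu]_+oo[EFin \o f] < +oo)%E ->
  forall B : set R, measurable B ->
    (distribution P (Y i) B <= (fine 'N[mu]_+oo[EFin \o f])%:E * mu B)%E.
Proof.
move=> mu [mf f0 fY] fF B mB.
have F0 := Lnorm_ge0 mu +oo%E (EFin \o f).
rewrite fY// fineK ?ge0_fin_numE//.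
have muT : (0 < mu setT)%E.
  apply: (@lt_le_trans _ _ (mu `[0, 1]%classic)).
    by rewrite /mu lebesgue_measure_itv/= lte_fin ltr01 sube0 lte_fin ltr01.
  by apply: le_measure; rewrite ?inE.
have NE : 'N[mu]_+oo[EFin \o f]%E = ess_sup mu (abse \o (EFin \o f)) by rewrite unlock muT.
rewrite -(integral_cst mu mB).
apply: ae_ge0_le_integral => //.
- by move=> x _; rewrite lee_fin.
- by apply/measurable_EFinP; exact: measurable_funTS.
have [N [mN N0 subN]] := ess_sup_ge mu (abse \o (EFin \o f)).
exists N; split => // x /= Bx; apply: subN => /= fx; apply: Bx => _.
by rewrite NE; apply: le_trans fx; rewrite lee_fin ler_norm.
Qed.

(** K and G agree almost everywhere and |G| <= V, so |G|^r <= V^(r-1) |G|: integrability of K makes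
    the integrals of all powers r >= 1 real numbers. *)
Lemma kernel_power_integral (R : realType) (m1 m2 : {finite_measure set (measurableTypeR R) -> \bar R})
    (K : R -> R) (D : set R) (r : R) :
  let mu := @lebesgue_measure R in
  measurable_fun [set: R] K -> countable D -> (forall u, ~ D u -> K u = cdf_diff m1 m2 u) ->
  (\int[mu]_u `|(K u)%:E| < +oo)%E -> 1 <= r ->
  exists2 I : R, 0 <= I &
    (\int[mu]_u (`|(K u)%:E| `^ r) = I%:E)%E /\ (\int[mu]_u (`|cdf_diff m1 m2 u| `^ r)%R%:E = I%:E)%E.
Proof.
move=> mu mK cD KG K1 r1; set G := cdf_diff m1 m2.
have mG : measurable_fun [set: R] G by exact: measurable_cdf_diff.
have mpow (L : R -> R) (q : R) : measurable_fun [set: R] L -> measurable_fun [set: R] (fun u => (`|L u| `^ q)%R%:E).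
  by move=> mL; apply/measurable_EFinP; apply: (measurableT_comp (measurable_powR q)); exact: measurableT_comp.
have KGq (q : R) : (\int[mu]_u (`|K u| `^ q)%R%:E = \int[mu]_u (`|G u| `^ q)%R%:E)%E.
  apply: ge0_ae_eq_integral => //; [exact: mpow|exact: mpow|].
  exists D; split.
  - by apply: countable_measurable cD => t; exact: measurable_set1.
  - exact: countable_lebesgue_measure0.
  - by move=> u /= Hu; apply: contrapT => Du; apply: Hu => _; rewrite KG.
have E q : (\int[mu]_u (`|(K u)%:E| `^ q) = \int[mu]_u (`|K u| `^ q)%R%:E)%E.
  by apply: eq_integral => u _; rewrite abse_EFin poweR_EFin.
set V := fine (m1 setT) + fine (m2 setT); have V0 : 0 <= V by rewrite addr_ge0 ?fine_ge0.
have I0 q : (0 <= \int[mu]_u (`|G u| `^ q)%R%:E)%E by apply: integral_ge0 => u _; rewrite lee_fin powR_ge0.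
have fin : (\int[mu]_u (`|G u| `^ r)%R%:E < +oo)%E.
  apply: (@le_lt_trans _ _ (\int[mu]_u ((V `^ (r - 1))%:E * (`|G u| `^ 1)%R%:E))%E).
    apply: ge0_le_integral => //.
    - exact: mpow.
    - by apply: measurable_funeM; exact: mpow.
    - move=> u _; rewrite -EFinM lee_fin.
      have -> : `|G u| `^ r = `|G u| `^ (r - 1) * `|G u| `^ 1.
        by rewrite -powRD ?subrK// gt_eqF// (lt_le_trans ltr01).
      by rewrite ler_wpM2r ?powR_ge0// ge0_ler_powR ?nnegrE ?subr_ge0// cdf_diff_le.
  rewrite ge0_integralZl_EFin ?powR_ge0//; last exact: mpow.
  rewrite -KGq -E lte_mul_pinfty ?lee_fin ?powR_ge0//.
  by under eq_integral do rewrite poweRe1//.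
exists (fine (\int[mu]_u (`|G u| `^ r)%R%:E)); first exact: fine_ge0.
by rewrite E KGq fineK// ge0_fin_numE.
Qed.

Theorem proposition33 (R : realType) (p eta c : R)
    (hp : 4 <= p) (heta : 0 < eta) (hc : 0 < c) :
  exists C1 C2 a : R, 0 < C1 /\ 0 < C2 /\
  forall (d : measure_display) (T : measurableType d) (P : probability T R)
    (Y : int -> {RV P >-> R}) (f : R -> R)
    (Q : nat -> nat -> R.-pker (pastType Y) ~> (R * R)%type)
    (K : R -> R) (dK : {charge set (measurableTypeR R) -> \bar R})
    (h : nat -> R),
  let mu := @lebesgue_measure R in
  let normf := ('N[mu]_+oo[EFin \o f])%E in
  let normdK := total_variation_norm dK in
  let intK (q : R) := (\int[mu]_u (`|(K u)%:E| `^ q))%E in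
  bounded_variation_line K ->
  is_stieltjes_charge K dK ->
  (\int[mu]_u `|(K u)%:E| < +oo)%E ->
  (intK p < +oo)%E ->
  stationary Y ->
  is_density Y 0 f ->
  (normf < +oo)%E ->
  (forall n : nat, (0 < n)%N -> 0 < h n) ->
  (forall i j : nat, (0 < i)%N -> (0 < j)%N ->
     is_conditional_law i j (Q i j)) ->
  (forall n : nat, (0 < n)%N ->
     (beta2 Q n <= (c * n%:R `^ (- (p - 1 + eta)))%:E)%E) ->
  (forall n : nat, (0 < n)%N ->
     (Lp_risk Y K h p n <=
        (C1 * (n%:R * h n) `^ (- (p / 2)))%:E
        * normdK `^ (p / 2)%R * normf `^ (p / 2 - 1)%R
        * (\int[mu]_u `|(K u)%:E|) `^ (p / 2)%R
      + (C2 * (n%:R * h n) `^ (1 - p))%:E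
        * (intK p + normdK * intK (p - 1)%R
           + normdK `^ 2 * intK (p - 2)%R))%E)
  /\
  (n%:R * h n @[n --> \oo] --> +oo ->
     (limn_esup (fun n : nat =>
        ((n%:R * h n) `^ (p / 2))%:E * Lp_risk Y K h p n) <=
      a%:E * normdK `^ (p / 2)%R * normf `^ (p / 2 - 1)%R
        * (\int[mu]_u `|(K u)%:E|) `^ (p / 2)%R)%E).
Proof.
have [A A0 HA] := Lp_risk_le hp heta hc.
(* The constants come from [Lp_risk_le]; the limsup keeps the constant of the first term. *)
exists (A * 2 `^ p), (A * 2 `^ (p + 1)), (A * 2 `^ p).
split; first by rewrite mulr_gt0// powR_gt0.
split; first by rewrite mulr_gt0// powR_gt0.
move=> d T P Y f Q K dK h mu normf normdK intK bvK dKK K1 Kp statY fY fF h0 condQ hbeta.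
have [mK [m1 [m2 [VE [D cD KG]]]]] := stieltjes_charge_cdf bvK dKK K1.
set V := fine (m1 setT) + fine (m2 setT) in VE.
have V0 : 0 <= V by rewrite addr_ge0 ?fine_ge0.
have KI := fun r => @kernel_power_integral R m1 m2 K D r mK cD KG K1.
have [A1 A10 [A1K A1G]] := KI 1 (lexx _).
have [Ip Ip0 [IpK _]] := KI p ltac:(lra).
have [I1 I10 [I1K _]] := KI (p - 1) ltac:(lra).
have [I2 I20 [I2K I2G]] := KI (p - 2) ltac:(lra).
have K1E : (\int[mu]_u `|(K u)%:E| = A1%:E)%E.
  by rewrite -A1K; apply: eq_integral => u _; rewrite poweRe1.
have G1E : (\int[mu]_u `|cdf_diff m1 m2 u|%:E = A1%:E)%E.
  by rewrite -A1G; apply: eq_integral => u _; rewrite powRr1.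
set F := fine normf; have FE : normf = F%:E.
  by rewrite /F fineK// ge0_fin_numE// Lnorm_ge0.
have F0 : 0 <= F by rewrite fine_ge0// Lnorm_ge0.
have risk n : (0 < n)%N -> (Lp_risk Y K h p n <=
    (A * 2 `^ p * (n%:R * h n) `^ (- (p / 2)) * V `^ (p / 2) * F `^ (p / 2 - 1) * A1 `^ (p / 2)
     + A * 2 `^ (p + 1) * (n%:R * h n) `^ (1 - p) * (V ^+ 2 * I2))%:E)%E.
  move=> n0; apply: (HA _ _ _ Y Q F m1 m2 K D h n A1 I2 statY condQ F0 _ mK cD KG G1E I2G n0 (h0 n n0) hbeta).
  exact: (density_law_le fY fF).
have C20 : 0 < A * 2 `^ (p + 1) by rewrite mulr_gt0// powR_gt0.
rewrite /normdK VE FE K1E /intK IpK I1K I2K !poweR_EFin; split.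
  move=> n n0; apply: le_trans (risk n n0) _.
  rewrite -!EFinM -!EFinD lee_fin lerD2l ler_wpM2l//.
    by rewrite mulr_ge0 ?powR_ge0// ltW.
  (* The bound on the risk carries only the term with the integral of |K|^(p-2); the other two are
     nonnegative and are added. *)
  by rewrite powR_mulrn// lerDr addr_ge0// mulr_ge0.
move=> /cvgryPge hN; rewrite -!EFinM.
apply: limn_esup_le_eventually => e e0.
set B := A * 2 `^ (p + 1) * (V ^+ 2 * I2).
have B0 : 0 <= B by rewrite mulr_ge0 ?(ltW C20)// mulr_ge0// sqr_ge0.
near=> n; have n0 : (0 < n)%N by near: n; exact: nbhs_infty_gt.
(* Once multiplied by N^(p/2), the second term is N^(1 - p/2) B, at most B / N when N >= 1 and p >=
   4. The summand 1 gives N >= 1 and the summand B / e makes this at most e. *)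
have N1 : 1 + B / e <= n%:R * h n by near: n; exact: (hN (1 + B / e)).
set N := n%:R * h n in N1 *.
have Be : 0 <= B / e by rewrite divr_ge0// ltW.
have N0 : 0 < N by move: Be N1; clear; lra.
apply: le_trans (lee_wpmul2l _ (risk n n0)) _; first by rewrite lee_fin powR_ge0.
rewrite -EFinM -EFinD lee_fin -/N mulrDr.
have eN (r : R) : N `^ (p / 2) * N `^ r = N `^ (p / 2 + r).
  by rewrite -powRD// (gt_eqF N0) implybT.
apply: lerD.
  have e1 := eN (- (p / 2)); rewrite subrr powRr0 in e1.
  rewrite (_ : N `^ (p / 2) * _ = (N `^ (p / 2) * N `^ (- (p / 2))) * (A * 2 `^ p * V `^ (p / 2) * F `^ (p / 2 - 1) * A1 `^ (p / 2))); last by ring.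
  by rewrite e1 mul1r.
rewrite (_ : N `^ (p / 2) * _ = (N `^ (p / 2) * N `^ (1 - p)) * B); last by rewrite /B; ring.
rewrite eN; apply: le_trans (_ : N `^ (-1) * B <= _).
  rewrite ler_wpM2r// ler_powR//; [move: Be N1; clear; lra|move: hp; clear; lra].
rewrite powR_inv1 ?(ltW N0)// mulrC ler_pdivrMr// mulrC -ler_pdivrMr//.
by move: N1; clear; lra.
Unshelve. all: by end_near. Qed.
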